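(* Let $P\subset\mathbb{D}$ be an ideal polygon (a hyperbolic polygon with finitely many sides and all vertices in $\partial\mathbb{D}$) one of whose sides $L$ is a diameter of the unit disc $\mathbb{D}$. Let $H$ be the group generated by the reflections in the sides of $P$ and let $\Gamma$ be the index two subgroup of orientation preserving elements of $H$. Let $\sigma_L$ be the reflection with respect to $L$ and set $\Omega:=P\cup\sigma_L(P)$. Then $\Gamma$ is a free non-uniform Fuchsian lattice, $\Omega$ is an ideal polygon and is the Ford domain of $\Gamma$, and the quotient $\Gamma\backslash\mathbb{D}$ is a punctured sphere.
   Context: Orientation preserving isometries of the hyperbolic disc $\mathbb{D}$ are given by $F=\begin{pmatrix}\alpha&\overline{\beta}\\ \beta&\overline{\alpha}\end{pmatrix}\in\mathrm{SU}(1,1)$, $|\alpha|^2-|\beta|^2=1$, acting by Möbius transformations. For $\beta\ne0$ let $U_F$ be the open disc of centre $-\overline\alpha/\beta$ and radius $|\beta|^{-1}$ (interior of the isometric circle of $F$). If $0$ is not fixed by any nontrivial element of $\Gamma$, the Ford domain of $\Gamma$ is the closure in $\mathbb{D}$ of $\mathbb{D}\setminus\bigcup_{F\in\Gamma\setminus\{\mathrm{Id}\}}U_F$. A lattice is non-uniform if it is discrete with non-compact fundamental domain of finite hyperbolic area. *)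

(* Defs.v *)
From HB Require Import structures.
From mathcomp Require Import all_boot all_order all_algebra.
From mathcomp Require Import all_classical all_reals all_analysis.
From mathcomp Require Import complex ring.

Set Implicit Arguments.
Unset Strict Implicit.
Unset Printing Implicit Defensive.

Import Order.TTheory GRing.Theory Num.Theory.
Import numFieldNormedType.Exports.
Local Open Scope classical_set_scope.
Local Open Scope ring_scope.

HB.instance Definition _ (R : rcfType) := NormedModule.copy R[i] R[i]^o.

Record bijection (T : Type) := Bijection {
  bij_fun :> T -> T;
  bij_inv : T -> T;
  bij_funK : cancel bij_fun bij_inv;
  bij_invK : cancel bij_inv bij_fun }.

HB.instance Definition _ (T : Type) := gen_eqMixin (bijection T).
HB.instance Definition _ (T : Type) := gen_choiceMixin (bijection T).

Section BijectionGroup.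
Context {T : Type}.
Implicit Types s t : bijection T.

Lemma bijection_ext s t : s =1 t -> s = t.
Proof.
case: s t => [f f' fK f'K] [g g' gK g'K] /= fg.
have e : f = g by apply/funext.
subst g; have e' : f' = g' by apply/funext => x; rewrite -{1}(g'K x) fK.
by subst g'; congr Bijection; exact: Prop_irrelevance.
Qed.

Definition bij_id : bijection T :=
  @Bijection T id id (fun=> erefl) (fun=> erefl).

Definition bij_comp s t : bijection T :=
  @Bijection T (s \o t) (bij_inv t \o bij_inv s)
    (can_comp (@bij_funK T s) (@bij_funK T t))
    (can_comp (@bij_invK T t) (@bij_invK T s)).

Definition bij_sym s : bijection T :=
  @Bijection T (bij_inv s) s (@bij_invK T s) (@bij_funK T s).

Fact bij_compA : associative bij_comp.
Proof. by move=> r s t; exact: bijection_ext. Qed.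
Fact bij_comp1 : left_id bij_id bij_comp.
Proof. by move=> s; exact: bijection_ext. Qed.
Fact bij_1comp : right_id bij_id bij_comp.
Proof. by move=> s; exact: bijection_ext. Qed.
Fact bij_compV : left_inverse bij_id bij_sym bij_comp.
Proof. by move=> s; apply: bijection_ext => x /=; exact: bij_funK. Qed.
Fact bij_Vcomp : right_inverse bij_id bij_sym bij_comp.
Proof. by move=> s; apply: bijection_ext => x /=; exact: bij_invK. Qed.

End BijectionGroup.

HB.instance Definition _ (T : Type) := isGroup.Build (bijection T)
  bij_compA bij_comp1 bij_1comp bij_compV bij_Vcomp.

Section Groups.
Context {G : groupType}.
Implicit Types (S K H : set G).

Definition is_subgroup S := group_closed (mem S).

Definition generated S : set G := smallest is_subgroup S.

Definition index_two K H :=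
  [/\ is_subgroup K, K `<=` H &
    exists2 t, (H `\` K) t & H = K `|` [set (t * s)%g | s in K]].

(* The letter (s, false) stands for s, and (s, true) for its inverse. *)
Definition letter_val (l : G * bool) : G := if l.2 then (l.1^-1)%g else l.1.

Definition reduced (w : seq (G * bool)) : bool :=
  sorted (fun a b => (a.1 != b.1) || (a.2 == b.2)) w.

Definition free_basis S K :=
  generated S = K /\
  forall w : seq (G * bool), (forall l, l \in w -> S l.1) -> reduced w ->
    (\prod_(l <- w) letter_val l)%g = 1%g -> w = [::].

Definition is_free K := exists S, free_basis S K.

End Groups.

Definition homeomorphic (X Y : topologicalType) :=
  exists (f : X -> Y) (g : Y -> X),
    [/\ cancel f g, cancel g f, continuous f & continuous g].

Definition sphere (R : realType) : set (R * R * R) :=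
  [set p | p.1.1 ^+ 2 + p.1.2 ^+ 2 + p.2 ^+ 2 = 1].

Definition is_punctured_sphere (R : realType) (X : topologicalType) :=
  exists E : set (R * R * R),
    [/\ finite_set E, E !=set0, E `<=` @sphere R
      & homeomorphic X (@sphere R `\` E : set (R * R * R))].

Definition orbit_of (T : choiceType) (K : set (bijection T)) (x : T) : set T :=
  [set s x | s in K].

(* When K is a group, two points have the same orbit exactly when some element
   of K maps one to the other. *)
Definition same_orbit (T : choiceType) (K : set (bijection T)) : rel T :=
  fun x y => `[< orbit_of K x = orbit_of K y >].

Section OrbitSpace.
Variables (T : choiceType) (K : set (bijection T)).

Fact same_orbit_refl : reflexive (same_orbit K).
Proof. by move=> x; exact/asboolP. Qed.
Fact same_orbit_sym : symmetric (same_orbit K).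
Proof. by move=> x y; apply/asboolP/asboolP. Qed.
Fact same_orbit_trans : transitive (same_orbit K).
Proof. by move=> y x z /asboolP exy /asboolP eyz; apply/asboolP; rewrite exy. Qed.

Definition same_orbit_equiv :=
  EquivRel (same_orbit K) same_orbit_refl same_orbit_sym same_orbit_trans.

End OrbitSpace.

Definition orbit_space (T : topologicalType) (K : set (bijection T)) :=
  quotient_topology {eq_quot (same_orbit_equiv K)}%qT.

Definition unit_disc (R : realType) : set R[i] := [set z | `|z| < 1].

Definition disc (R : realType) : topologicalType := @unit_disc R.

Notation disc_group R := (bijection (disc R)).

Lemma disc_lt1 (R : realType) (z : disc R) : `|val z| < 1.
Proof. by case: z => z hz; exact: set_mem hz. Qed.

Section HyperbolicDisc.
Context {R : realType}.
Local Notation C := R[i].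
Local Notation D := (disc R).
Implicit Types (u w : C) (z : D) (s : disc_group R) (A : set D).
Implicit Types (Gamma : set (disc_group R)).

(* The pair (alpha, beta) stands for the matrix with rows
   (alpha, conj beta) and (beta, conj alpha). *)
Definition SU11 : set (C * C) := [set F | `|F.1| ^+ 2 - `|F.2| ^+ 2 = 1].

Definition mobius (F : C * C) (z : C) : C :=
  (F.1 * z + F.2^*) / (F.2 * z + F.1^*).

Definition acts_by s (F : C * C) := forall z, val (s z) = mobius F (val z).

Definition orientation_preserving : set (disc_group R) :=
  [set s | exists2 F, SU11 F & acts_by s F].

(* The matrices, both signs included, of the elements of Gamma. *)
Definition matrices_of Gamma : set (C * C) :=
  [set F | SU11 F /\ exists2 s, Gamma s & acts_by s F].

Definition is_fuchsian Gamma :=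
  [/\ is_subgroup Gamma, Gamma `<=` orientation_preserving
    & matrices_of Gamma `<=` isolated (matrices_of Gamma)].

Definition hyperbolic_area A : \bar R :=
  \int[(@lebesgue_measure R \x @lebesgue_measure R)%E]_(p in
      [set (complex.Re (val z), complex.Im (val z)) | z in A])
    (4 / (1 - p.1 ^+ 2 - p.2 ^+ 2) ^+ 2)%:E.

Definition fundamental_domain Gamma A :=
  [/\ closed A, closure (interior A) = A,
      \bigcup_(s in Gamma) s @` A = setT
    & forall s, Gamma s -> s <> 1%g ->
        interior A `&` s @` interior A = set0].

(* A group with a compact fundamental domain may also have non-compact ones of
   finite area, so non-compactness is required of all of them. *)
Definition nonuniform_lattice Gamma :=
  [/\ is_fuchsian Gamma,
      exists2 A, fundamental_domain Gamma A & (hyperbolic_area A < +oo)%E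
    & forall A, fundamental_domain Gamma A -> ~ compact A].

Definition isometric_disc (F : C * C) : set D :=
  [set z | `|val z - (- F.1^* / F.2)| < `|F.2|^-1].

Definition ford_domain Gamma : set D :=
  closure (~` \bigcup_(F in matrices_of (Gamma `\ 1%g)) isometric_disc F).

Definition is_ford_domain Gamma A :=
  (forall s z, Gamma s -> val z = 0 -> s z = z -> s = 1%g) /\
  A = ford_domain Gamma.

(* For distinct u, w on the unit circle this vanishes on the circle through u
   and w orthogonal to the unit circle, whose centre is 2uw / (u + w), or on the
   line through u and w when u + w = 0; it is positive to the left of that
   curve, traversed from u to w. *)
Definition geodesic_form u w (z : C) : C :=
  (1 + `|z| ^+ 2) * 'Im (u^* * w) + 2 * 'Im ((w - u)^* * z).

Definition geodesic u w : set D := [set z | geodesic_form u w (val z) = 0].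

Definition half_plane u w : set D :=
  [set z | 0 <= geodesic_form u w (val z)].

Definition is_diameter A :=
  exists2 e : C, `|e| = 1
    & A = [set z | exists t : R, val z = real_complex R t * e].

(* Inversion in the circle of centre c = 2uw / (u + w) orthogonal to the unit
   circle, z |-> c + (|c|^2 - 1) / conj (z - c), with denominators cleared; for
   u + w = 0 it is the Euclidean reflection z |-> u^2 conj z. *)
Definition inversion u w (z : C) : C :=
  (2 * u * w * z^* - (u + w)) / ((u + w) * z^* - 2).

Definition reflection u w : disc_group R :=
  xget 1%g [set s : disc_group R | forall z, val (s z) = inversion u w (val z)].

Section ReflectionTheory.
Variables (u w : C).
Hypotheses (u1 : `|u| = 1) (w1 : `|w| = 1) (uw : u != w).

Let u0 : u != 0. Proof. by rewrite -normr_gt0 u1. Qed.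
Let w0 : w != 0. Proof. by rewrite -normr_gt0 w1. Qed.
Let uC : u^* = u^-1.
Proof. by apply: (mulfI u0); rewrite divff// -normCK u1 expr1n. Qed.
Let wC : w^* = w^-1.
Proof. by apply: (mulfI w0); rewrite divff// -normCK w1 expr1n. Qed.

Let num_lt_den (z : C) : `|z| < 1 ->
  `|2 * u * w * z^* - (u + w)| < `|(u + w) * z^* - 2|.
Proof.
move=> z1; rewrite -(@ltr_pXn2r _ 2) ?nnegrE// -subr_gt0.
have -> : `|(u + w) * z^* - 2| ^+ 2 - `|2 * u * w * z^* - (u + w)| ^+ 2 =
    (1 - `|z| ^+ 2) * `|u - w| ^+ 2.
  by rewrite !normCK !(rmorphB, rmorphD, rmorphM, fmorphV, rmorph1)/= !(conjCK, uC, wC) /=; field; rewrite u0 w0.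
by rewrite mulr_gt0 ?exprn_gt0 ?normr_gt0 ?subr_eq0// subr_gt0 expr_lt1.
Qed.

Let den_neq0 (z : C) : `|z| < 1 -> (u + w) * z^* - 2 != 0.
Proof. by move=> /num_lt_den h; rewrite -normr_gt0 (le_lt_trans _ h). Qed.

Lemma inversion_lt1 (z : C) : `|z| < 1 -> `|inversion u w z| < 1.
Proof.
move=> z1; rewrite /inversion normrM normfV ltr_pdivrMr ?mul1r ?num_lt_den//.
by rewrite normr_gt0 den_neq0.
Qed.

Lemma inversionK (z : C) : `|z| < 1 -> inversion u w (inversion u w z) = z.
Proof.
move=> z1; have := den_neq0 (inversion_lt1 z1); have := den_neq0 z1.
rewrite -conjC_eq0 /inversion !(rmorphB, rmorphD, rmorphM, fmorphV, rmorph1)/= !(conjCK, uC, wC) /= => h1 h2.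
have h3 : 4 * u * w - (u + w) ^+ 2 != 0.
  rewrite (_ : _ - _ = - (u - w) ^+ 2); last by ring.
  by rewrite oppr_eq0 sqrf_eq0 subr_eq0.
have h4 : (u + w) * z - 2 * u * w != 0.
  move: h1; apply: contra => /eqP h; apply/eqP.
  transitivity (((u + w) * z - 2 * u * w) / (u * w)); last by rewrite h mul0r.
  by field; rewrite u0 w0.
field; rewrite w0 u0 /=; apply/andP; split.
  by move: h4; congr (_ != 0); ring.
by move: h3; congr (_ != 0); ring.
Qed.

Lemma reflectionE z : val (reflection u w z) = inversion u w (val z).
Proof.
rewrite /reflection; case: xgetP => [s _ -> //|].
pose f (x : D) : D := exist _ (inversion u w (val x))
  (mem_set (inversion_lt1 (disc_lt1 x))).
have fK : cancel f f.
  by move=> x; apply: val_inj => /=; rewrite inversionK//; exact: disc_lt1.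
by move=> /(_ (Bijection fK fK))[].
Qed.

Lemma geodesicE : geodesic u w = [set z | reflection u w z = z].
Proof.
have two0 : (2 : C) != 0 by rewrite pnatr_eq0.
have formE (z : D) : geodesic_form u w (val z) = 'i * (w - u) / (2 * u * w) *
    (2 * u * w * (val z)^* - (u + w) - val z * ((u + w) * (val z)^* - 2)).
  rewrite /geodesic_form !ImE normCK !(rmorphB, rmorphM)/=.
  rewrite !(conjCK, uC, wC, fmorphV)/= !(uC, wC).
  by field; rewrite ?two0 u0 w0.
apply/seteqP; split=> z /=.
  rewrite /geodesic/= formE => /eqP; rewrite !mulf_eq0 invr_eq0 !mulf_eq0.
  rewrite (negbTE two0) (negbTE u0) (negbTE w0) (negbTE (neq0Ci C)) !orbF.
  rewrite subr_eq0 (eq_sym w) (negbTE uw)/= subr_eq0 => /eqP h.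
  apply: val_inj; rewrite reflectionE /inversion h mulfK//.
  exact/den_neq0/disc_lt1.
move=> /(congr1 val); rewrite reflectionE /inversion => h.
rewrite /geodesic/= formE; apply/eqP; rewrite mulf_eq0; apply/orP; right.
rewrite subr_eq0; apply/eqP.
by apply: (canRL (divfK (den_neq0 (disc_lt1 z)))); exact: h.
Qed.

End ReflectionTheory.

Section Polygon.
Context {n : nat}.
Implicit Types v : 'I_n -> C.

(* The vertices are listed counterclockwise. *)
Definition ideal_vertices v :=
  [/\ (3 <= n)%N, forall i, `|v i| = 1
    & forall i j k : 'I_n, (i < j < k)%N ->
        0 < 'Im ((v j - v i)^* * (v k - v i))].

Definition side v (i : 'I_n) : set D := geodesic (v i) (v (ordS i)).

Definition side_reflection v (i : 'I_n) : disc_group R :=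
  reflection (v i) (v (ordS i)).

Definition ideal_polygon v : set D :=
  \bigcap_(i in setT) half_plane (v i) (v (ordS i)).

End Polygon.

Definition is_ideal_polygon A :=
  exists (n : nat) (v : 'I_n -> C), ideal_vertices v /\ A = ideal_polygon v.

End HyperbolicDisc.

(* Main.v *)
(** The geodesic form of a side, divided by [1 - |z|^2], is the Lorentz product
    of the point of the hyperboloid over [z] with the normal of the side; it is
    odd under the reflection in that side, and the closed half-planes beyond two
    different sides are disjoint. By ping-pong on these half-planes a reduced
    word in the reflections moves [P] beyond the side of its first letter, and
    deleting letters only decreases the distance to the points of [P]. So [P]
    meets every orbit at most once and [|z|] is minimal on the orbit of [z] for
    [z] in [P], because [0] is in [P]. The orbit of [0] is separated, hence
    locally finite, and minimising [|h z|] shows that [P] meets every orbit. The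
    Ford domain, which is the set where [|z| <= |s z|] for all [s], is therefore
    [P] together with its mirror image. The same ping-pong makes the products
    [s_l s_i] free generators.

    Near an ideal vertex [w] the polygon is a sliver of width [O(|z - w|^2)] in
    which [1 - |z|] is comparable to [|z - w|], so its area is finite. The
    quotient is the double of [P]: folding the disc onto [P] does not increase
    distances, and in the Klein model [P] is a Euclidean polygon without its
    vertices, the boundary of the bipyramid over which projects radially onto
    the sphere. *)

Require Import Defs.
From HB Require Import structures.
From mathcomp Require Import all_boot all_order all_algebra.
From mathcomp Require Import all_classical all_reals all_analysis.
From mathcomp Require Import measurable_realfun.
From mathcomp Require Import complex ring lra zify.

Import Order.TTheory GRing.Theory Num.Theory.
Import numFieldNormedType.Exports.
Local Open Scope classical_set_scope.
Local Open Scope ring_scope.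

Set Implicit Arguments.
Unset Strict Implicit.
Unset Printing Implicit Defensive.

(** * Inscribed triangles *)

Section PlaneAlgebra.
Context {R : realType}.
Local Notation C := R[i].
Implicit Types (a b c k p q u w z : C).

(** The diameter is what makes the origin usable: [0] lies on [L], is fixed by the reflection in
    [L], and is strictly inside all other sides. Hence its stabiliser in [H] is generated by that
    reflection and is trivial in [Gamma], and the half-planes beyond the other sides avoid a
    neighbourhood of [0]. Minimality of the norm in an orbit does not determine the sign of the form
    of [L]; that sign is adjusted by the reflection in [L], which preserves the norm.

    Distances enter only through [sinh2], which is rational in the coordinates. One identity,
    [sinh2_inversion], says by how much a reflection changes the distance between two points; the
    isometry property, the fixed points and the decrease under folding are read off it. Incidence
    questions are moved to the Klein model, where the forms become orientation determinants of
    inscribed triangles.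

    For the sphere the origin is the wrong centre, because it lies on the boundary of [P]; the
    bipyramid is built over the barycentre of the vertices. *)

Definition sqnorm z : R := complex.Re z ^+ 2 + complex.Im z ^+ 2.

Definition cross a b : R :=
  complex.Re a * complex.Im b - complex.Im a * complex.Re b.

Definition dot a b : R :=
  complex.Re a * complex.Re b + complex.Im a * complex.Im b.

Definition orient a b c : R := cross (b - a) (c - a).

Definition geoform u w z : R := (1 + sqnorm z) * cross u w + 2 * cross (w - u) z.

Lemma sqnormE z : (sqnorm z)%:C%C = `|z| ^+ 2.
Proof. by rewrite add_Re2_Im2. Qed.

Lemma sqnorm_ge0 z : 0 <= sqnorm z.
Proof. by rewrite addr_ge0 ?sqr_ge0. Qed.

Lemma sqnorm_eq0 z : (sqnorm z == 0) = (z == 0).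
Proof.
by rewrite paddr_eq0 ?sqr_ge0// !sqrf_eq0 eq_complex.
Qed.

Lemma normE z : `|z| = (Num.sqrt (sqnorm z))%:C%C.
Proof. by rewrite normc_def. Qed.

Lemma norm_lt1 z : (`|z| < 1) = (sqnorm z < 1).
Proof.
rewrite -(@ltr_pXn2r _ 2) ?nnegrE// -sqnormE expr1n.
by rewrite -[X in _ < X]/(1%:C)%C ltcR.
Qed.

Lemma norm_eq1 z : (`|z| = 1) <-> (sqnorm z = 1).
Proof.
split=> h.
  by apply: complexI; rewrite sqnormE h expr1n.
by rewrite normE h sqrtr1.
Qed.

Lemma geodesic_formE u w z : geodesic_form u w z = (geoform u w z)%:C%C.
Proof.
rewrite /geodesic_form -sqnormE -!complexIm.
case: u w z => [u1 u2] [w1 w2] [z1 z2]; rewrite /geoform /cross /sqnorm /=.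
by apply/eqP; rewrite eq_complex; simpc.
Qed.

Lemma orientE u v w : 'Im ((v - u)^* * (w - u)) = (orient u v w)%:C%C.
Proof.
rewrite -complexIm /orient /cross.
case: u v w => [u1 u2] [w1 w2] [z1 z2] /=.
by congr (_ +i* _)%C; ring.
Qed.

(** Up to the factor [orient a b c], the numbers [orient b c k], [orient c a k] and [orient a b k]
    are the barycentric coordinates of [k], and [orient p q] is affine. Cleared of denominators, the
    identity also covers degenerate triangles. *)
Lemma orient_bary p q a b c k : orient p q k * orient a b c =
  orient b c k * orient p q a + orient c a k * orient p q b + orient a b k * orient p q c.
Proof. by case: p q a b c k => ? ? [? ?] [? ?] [? ?] [? ?] [? ?]; rewrite /orient /cross /=; ring. Qed.

Lemma orient_rot a b c : orient b c a = orient a b c.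
Proof. by case: a b c => ? ? [? ?] [? ?]; rewrite /orient /cross /=; ring. Qed.

Lemma orient_opp a b c : orient b a c = - orient a b c.
Proof. by case: a b c => ? ? [? ?] [? ?]; rewrite /orient /cross /=; ring. Qed.

Lemma orient0l a b : orient a b a = 0.
Proof. by case: a b => ? ? [? ?]; rewrite /orient /cross /=; ring. Qed.

Lemma orient0r a b : orient a b b = 0.
Proof. by case: a b => ? ? [? ?]; rewrite /orient /cross /=; ring. Qed.

(** The same expansion for the affine function [1 - dot p k], which for a unit vector [p] vanishes
    on the tangent to the circle at [p] and is nonnegative on the closed disc. *)
Lemma dot_bary p a b c k : (1 - dot p k) * orient a b c =
  orient b c k * (1 - dot p a) + orient c a k * (1 - dot p b) + orient a b k * (1 - dot p c).
Proof. by case: p a b c k => ? ? [? ?] [? ?] [? ?] [? ?]; rewrite /orient /cross /dot /=; ring. Qed.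

Lemma dot_self p : dot p p = sqnorm p.
Proof. by rewrite /dot /sqnorm !expr2. Qed.

Lemma dotC p q : dot p q = dot q p.
Proof. by rewrite /dot; ring. Qed.

(* 2 (1 - p.q) = (1 - |p|^2) + (1 - |q|^2) + |p - q|^2 *)
Lemma dot_le1 p q : sqnorm p <= 1 -> sqnorm q <= 1 -> 0 <= 1 - dot p q.
Proof.
case: p q => p1 p2 [q1 q2]; rewrite /sqnorm /dot /=.
have := sqr_ge0 (p1 - q1); have := sqr_ge0 (p2 - q2); lra.
Qed.

Lemma dot_lt1 p q : sqnorm p <= 1 -> sqnorm q <= 1 -> p != q -> 0 < 1 - dot p q.
Proof.
move=> hp hq; rewrite -subr_eq0 -sqnorm_eq0 => h.
have : 0 < sqnorm (p - q) by rewrite lt_def h sqnorm_ge0.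
move: hp hq; clear h; case: p q => p1 p2 [q1 q2]; rewrite /sqnorm /dot /=; nra.
Qed.

Lemma orient_neq a b c : 0 < orient a b c -> [/\ a != b, b != c & c != a].
Proof.
move=> h; split; apply: contraTneq h => ->; rewrite ?orient0l ?orient0r ?ltxx//.
  by rewrite -orient_rot orient0l ltxx.
Qed.

(* If [k] lies beyond the chord [ab] it is on the inner side of the two other
   chords of the inscribed triangle [abc]. *)
Lemma beyond_chord a b c k : sqnorm a = 1 -> sqnorm b = 1 -> sqnorm c = 1 -> sqnorm k <= 1 ->
  0 < orient a b c -> orient a b k <= 0 -> (sqnorm k < 1 \/ orient a b k < 0) ->
  0 < orient b c k /\ 0 < orient c a k.
Proof.
move=> ha hb hc hk habc hle hs.
have [nab nbc nca] := orient_neq habc.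
have lt p q : sqnorm p = 1 -> sqnorm q = 1 -> p != q -> 0 < 1 - dot p q.
  by move=> h1 h2; apply: dot_lt1; rewrite ?h1 ?h2.
(* By [dot_bary] the difference is the contribution of [a] and [b] to
   [(1 - dot p k) * orient a b c]. Taking for [p] one of them kills its own term, since
   [1 - dot p p = 0], and leaves the wanted orientation times a positive number. *)
have gen p : sqnorm p = 1 -> (p != c) -> 0 < (1 - dot p k) * orient a b c - orient a b k * (1 - dot p c).
  move=> hp pc; have h1 := lt _ _ hp hc pc.
  have h2 : 0 <= 1 - dot p k by apply: dot_le1; rewrite ?hp.
  case: hs => hs.
    have h3 : 0 < 1 - dot p k.
      by apply: dot_lt1; rewrite ?hp//; apply: contraTneq hs => <-; rewrite hp ltxx.
    have := mulr_gt0 h3 habc; have : 0 <= (- orient a b k) * (1 - dot p c).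
      by rewrite mulr_ge0 ?oppr_ge0// ltW.
    by rewrite mulNr; lra.
  have : 0 < (- orient a b k) * (1 - dot p c) by rewrite mulr_gt0 ?oppr_gt0.
  by have := mulr_ge0 h2 (ltW habc); rewrite mulNr; lra.
split.
  have := gen b hb nbc; rewrite dot_bary dot_self hb.
  rewrite subrr mulr0 addr0 addrK => h; have := lt b a hb ha.
  by rewrite eq_sym nab => /(_ isT) h'; rewrite -(pmulr_lgt0 _ h').
have := gen a ha; rewrite eq_sym nca => /(_ isT); rewrite dot_bary dot_self ha.
rewrite subrr mulr0 add0r addrK => h; have := lt a b ha hb nab.
by move=> h'; rewrite -(pmulr_lgt0 _ h').
Qed.

(** [b] lies beyond the chord [ac] of the inscribed triangle [acd], so [beyond_chord] places it on
    the inner side of the two other chords. *)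
Lemma cyclic_trans a b c d : sqnorm a = 1 -> sqnorm b = 1 -> sqnorm c = 1 -> sqnorm d = 1 ->
  0 < orient a b c -> 0 < orient a c d -> 0 < orient a b d /\ 0 < orient b c d.
Proof.
move=> ha hb hc hd habc hacd.
have hlt : orient a c b < 0 by rewrite -(orient_rot a c b) orient_opp orient_rot oppr_lt0.
have [] := @beyond_chord a c d b ha hc hd _ hacd (ltW hlt) (or_intror hlt).
  by rewrite hb.
by rewrite (orient_rot b c d) (orient_rot b d a) (orient_rot a b d).
Qed.

End PlaneAlgebra.

(** * Inversions and the group SU(1,1) *)

Section ReflectionAlgebra.
Context {R : realType}.
Local Notation C := R[i].
Local Notation D := (disc R).

(* [sinh ^ 2] of half the hyperbolic distance. *)
Definition sinh2 (z w : C) : R := sqnorm (z - w) / ((1 - sqnorm z) * (1 - sqnorm w)).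

Definition nform (u w z : C) : R := geoform u w z / (1 - sqnorm z).

Lemma sqnorm_conj (z : C) : sqnorm z^* = sqnorm z.
Proof. by case: z => x y; rewrite /sqnorm /= sqrrN. Qed.

Lemma sqnormN (z : C) : sqnorm (- z) = sqnorm z.
Proof. by case: z => x y; rewrite /sqnorm /= !sqrrN. Qed.

Lemma sqnormM (z w : C) : sqnorm (z * w) = sqnorm z * sqnorm w.
Proof. by case: z w => x y [x' y']; rewrite /sqnorm /=; ring. Qed.

Lemma sqnormB (z w : C) : sqnorm (z - w) = sqnorm (w - z).
Proof. by rewrite -opprB sqnormN. Qed.

Lemma sinh2C z w : sinh2 z w = sinh2 w z.
Proof. by rewrite /sinh2 sqnormB [(1 - sqnorm w) * _]mulrC. Qed.

Lemma sinh2_eq0 z w : sqnorm z < 1 -> sqnorm w < 1 -> sinh2 z w = 0 -> z = w.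
Proof.
move=> hz hw /eqP; rewrite /sinh2 mulf_eq0 invr_eq0 mulf_eq0 sqnorm_eq0.
have h (x : C) : sqnorm x < 1 -> (1 - sqnorm x == 0) = false.
  by move=> hx; rewrite subr_eq0 eq_sym lt_eqF.
by rewrite !h// !orbF subr_eq0 => /eqP.
Qed.

Lemma sqnorm0 : sqnorm (0 : C) = 0.
Proof. by apply/eqP; rewrite sqnorm_eq0. Qed.

Lemma sinh2zz z : sinh2 z z = 0.
Proof. by rewrite /sinh2 subrr sqnorm0 mul0r. Qed.

Variables (u w : C).
Hypotheses (u1 : sqnorm u = 1) (w1 : sqnorm w = 1) (uw : u != w).

Let u0 : u != 0. Proof. by rewrite -sqnorm_eq0 u1 oner_eq0. Qed.
Let w0 : w != 0. Proof. by rewrite -sqnorm_eq0 w1 oner_eq0. Qed.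
Let uw0 : u - w != 0. Proof. by rewrite subr_eq0. Qed.
Let wu0 : w - u != 0. Proof. by rewrite subr_eq0 eq_sym. Qed.
Let uC : u^* = u^-1.
Proof. by apply: (mulfI u0); rewrite divff// -normCK -sqnormE u1. Qed.
Let wC : w^* = w^-1.
Proof. by apply: (mulfI w0); rewrite divff// -normCK -sqnormE w1. Qed.
Let s := inversion u w.

Let n2 (z : C) : 1 - (sqnorm z)%:C%C = 1 - z * z^*.
Proof. by rewrite sqnormE normCK. Qed.

Let den_neq0 (z : C) : sqnorm z < 1 -> (u + w) * z^* - 2 != 0.
Proof.
move=> z1; apply/eqP => /eqP; rewrite subr_eq0 => /eqP h.
have : sqnorm ((u + w) * z^*) = 4 
    by apply: complexI; rewrite sqnormE h normr_nat -natrX rmorph_nat.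
rewrite sqnormM sqnorm_conj; apply/eqP; rewrite lt_eqF//.
have h1 : sqnorm (u + w) <= 4.
  move: (sqnorm_ge0 (u - w)) u1 w1; case: (u) (w) => [? ?] [? ?]; rewrite /sqnorm /=.
  lra.
have := sqnorm_ge0 z; have := sqnorm_ge0 (u + w); clear h; nra.
Qed.

Let denc (z : C) : sqnorm z < 1 -> (u + w) * z - 2 * u * w != 0.
Proof.
move=> /den_neq0; rewrite -conjC_eq0 !(rmorphB, rmorphD, rmorphM, rmorph1)/= conjCK uC wC.
move=> h; apply: contra h => /eqP h; apply/eqP.
rewrite (_ : _ - _ = ((u + w) * z - 2 * u * w) / (u * w)).
  by rewrite h mul0r.
by field; rewrite u0 w0.
Qed.

Let sC (z : C) : sqnorm z < 1 -> (s z)^* =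
  (2 * z - (u + w)) / ((u + w) * z - 2 * u * w).
Proof.
move=> z1; have h := denc z1.
rewrite /s /inversion !(rmorphB, rmorphD, rmorphM, fmorphV, rmorph1)/=.
rewrite !(conjCK, uC, wC).
by field; rewrite u0 w0 h.
Qed.

Let nsE (z : C) : sqnorm z < 1 ->
  1 - s z * (s z)^* = (1 - z * z^*) * - (u - w) ^+ 2 /
   (((u + w) * z^* - 2) * ((u + w) * z - 2 * u * w)).
Proof.
move=> z1; rewrite sC// /s /inversion; field.
by rewrite den_neq0// denc.
Qed.

Let geoformC (z : C) : (geoform u w z)%:C%C = 'i * (w - u) / (2 * u * w) *
    (2 * u * w * z^* - (u + w) - z * ((u + w) * z^* - 2)).
Proof.
have two0 : (2 : C) != 0 by rewrite pnatr_eq0.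
rewrite -geodesic_formE /geodesic_form !ImE normCK !(rmorphB, rmorphM)/=.
rewrite !(conjCK, uC, wC, fmorphV)/= !(uC, wC).
by field; rewrite ?two0 u0 w0.
Qed.

Lemma one_sub_sqnorm (z : C) : sqnorm z < 1 -> 1 - sqnorm z != 0.
Proof. by move=> h; rewrite subr_eq0 eq_sym lt_eqF. Qed.

Let one_sub_sqnormC (z : C) : sqnorm z < 1 -> 1 - z * z^* != 0.
Proof.
move=> h; rewrite -n2 -[1]/(1%:C)%C -rmorphB -[0]/(0%:C)%C.
by rewrite (inj_eq (@complexI R)) one_sub_sqnorm.
Qed.

Let nformC (z : C) : (nform u w z)%:C%C = 'i * (w - u) / (2 * u * w) *
    (2 * u * w * z^* - (u + w) - z * ((u + w) * z^* - 2)) / (1 - z * z^*).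
Proof. by rewrite /nform rmorphM fmorphV rmorphB/= n2 geoformC. Qed.

Let sinh2E (z z' : C) : (sinh2 z z')%:C%C = (z - z') * (z^* - z'^*) /
  ((1 - z * z^*) * (1 - z' * z'^*)).
Proof.
by rewrite /sinh2 rmorphM fmorphV rmorphM !rmorphB/= !n2 sqnormE normCK rmorphB.
Qed.

Lemma nform_inversion z : sqnorm z < 1 -> nform u w (s z) = - nform u w z.
Proof.
move=> z1; apply: complexI; rewrite rmorphN/= !nformC nsE// sC// /s /inversion.
have two0 : (2 : C) != 0 by rewrite pnatr_eq0.
field.
by rewrite u0 w0 one_sub_sqnormC ?den_neq0 ?denc//= ?subr_eq0 ?uw ?two0.
Qed.

Let ggC (p z : C) : (nform u w p * nform u w z)%:C%C = - ((w - u) / (2 * u * w)) ^+ 2 *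
    (2 * u * w * z^* - (u + w) - z * ((u + w) * z^* - 2)) / (1 - z * z^*) *
    ((2 * u * w * p^* - (u + w) - p * ((u + w) * p^* - 2)) / (1 - p * p^*)).
Proof.
rewrite rmorphM/= !nformC.
move: (1 - z * z^*) (1 - p * p^*) (_ - z * _) (_ - p * _) => a b c d.
transitivity ('i ^+ 2 * ((w - u) / (2 * u * w)) ^+ 2 * (c / a) * (d / b)).
  by rewrite -!mulrA; ring.
by rewrite sqrCi; ring.
Qed.

(** This is the formula for a Lorentz reflection. The normal of the side has time coordinate
    [cross u w] and a space part of squared length [sqnorm (u - w)], so its Lorentz square is
    [sqnorm (u - w) - cross u w ^+ 2]. For unit vectors this equals [sqnorm (u - w) ^+ 2 / 4], and
    the coefficient is its inverse. *)
Lemma sinh2_inversion p z : sqnorm p < 1 -> sqnorm z < 1 ->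
  sinh2 p (s z) = sinh2 p z + 4 / sqnorm (u - w) ^+ 2 * (nform u w p * nform u w z).
Proof.
move=> p1 z1; apply: complexI.
rewrite [in RHS]rmorphD [X in _ = _ + X]rmorphM/= !sinh2E ggC nsE// sC// /s /inversion.
rewrite [X in _ = _ + X * _]rmorphM/= fmorphV rmorphXn/= sqnormE normCK rmorphB/= uC wC rmorph_nat.
have two0 : (2 : C) != 0 by rewrite pnatr_eq0.
field.
rewrite u0 w0 !one_sub_sqnormC ?den_neq0 ?denc//=.
by rewrite mulN1r !subr_eq0 uw eq_sym uw.
Qed.

(** As [|2uw|^2 - |u + w|^2 = |u - w|^2], division by [w - u] normalises the determinant. The
    conjugate entries then match because conjugation inverts [u] and [w]. *)
Lemma inversion_anti : exists2 F : C * C, SU11 F &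
  forall z : C, inversion u w z = mobius F z^*.
Proof.
exists (2 * u * w / (w - u), (u + w) / (w - u)).
  rewrite /SU11 /= !normCK !(rmorphB, rmorphD, rmorphM, fmorphV, rmorph1)/=.
  rewrite !uC !wC; field.
  by rewrite ?u0 ?w0 ?mulN1r ?wu0 ?uw0.
move=> z; rewrite /mobius /= !(rmorphB, rmorphD, rmorphM, fmorphV, rmorph1)/=.
rewrite !uC !wC.
have -> : (1 + 1) / u / w / (w^-1 - u^-1) = - 2 / (w - u).
  by field; rewrite ?u0 ?w0 ?mulN1r ?wu0 ?uw0.
have -> : (u^-1 + w^-1) / (w^-1 - u^-1) = - (u + w) / (w - u).
  by field; rewrite ?u0 ?w0 ?mulN1r ?wu0 ?uw0.
transitivity ((2 * u * w * z^* - (u + w)) / (w - u) /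
    (((u + w) * z^* - 2) / (w - u))).
  by rewrite -mulf_div divff ?invr_eq0// mulr1.
by congr (_ / _); ring.
Qed.

End ReflectionAlgebra.

(** * Moebius maps of SU(1,1) *)

Section Mobius.
Context {R : realType}.
Local Notation C := R[i].
Implicit Types (F G : C * C) (z : C).

Definition mmul F G : C * C :=
  (F.1 * G.1 + F.2^* * G.2, F.2 * G.1 + F.1^* * G.2).

Definition mconj F : C * C := (F.1^*, F.2^*).

Definition minv F : C * C := (F.1^*, - F.2).

Lemma SU11E F : SU11 F <-> F.1 * F.1^* - F.2 * F.2^* = 1.
Proof. by rewrite /SU11 /= !normCK. Qed.

Lemma SU11_mul F G : SU11 F -> SU11 G -> SU11 (mmul F G).
Proof.
move=> /SU11E f /SU11E g; apply/SU11E; rewrite /= !(rmorphD, rmorphM)/= !conjCK.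
by rewrite -[RHS]mulr1 -[in X in _ = X * _]f -g; ring.
Qed.

Lemma SU11_conj F : SU11 F -> SU11 (mconj F).
Proof. by move=> /SU11E f; apply/SU11E; rewrite /= !conjCK -f; ring. Qed.

Lemma SU11_inv F : SU11 F -> SU11 (minv F).
Proof.
by move=> /SU11E f; apply/SU11E; rewrite /= !rmorphN !conjCK -f; ring.
Qed.

Lemma SU11_sqnorm F : SU11 F -> sqnorm F.1 = 1 + sqnorm F.2.
Proof.
move=> /= f; apply: complexI; rewrite [RHS]rmorphD/= !sqnormE rmorph1 -f.
by rewrite subrK.
Qed.

Lemma sqnormD_le (z w : C) : sqnorm (z + w) <= 2 * (sqnorm z + sqnorm w).
Proof.
by move: (sqnorm_ge0 (z - w)); case: z w => ? ? [? ?]; rewrite /sqnorm /=; lra.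
Qed.

Lemma mobius_den F z : SU11 F -> sqnorm z < 1 -> F.2 * z + F.1^* != 0.
Proof.
move=> /SU11_sqnorm f hz; apply/eqP => /eqP; rewrite addr_eq0 => /eqP /(congr1 sqnorm).
rewrite sqnormN sqnorm_conj sqnormM f; have := sqnorm_ge0 F.2; have := sqnorm_ge0 z; nra.
Qed.

Lemma mobius_comp F G z : SU11 F -> SU11 G -> sqnorm z < 1 ->
  mobius F (mobius G z) = mobius (mmul F G) z.
Proof.
move=> f g hz; have h1 := mobius_den g hz.
have h2 := mobius_den (SU11_mul f g) hz.
move: h2; rewrite /mobius /= !(rmorphD, rmorphM)/= !conjCK => h2.
field.
by rewrite h1 !andbT; apply: contra h2 => /eqP h; apply/eqP; rewrite -[RHS]h; ring.
Qed.

Lemma mobius_conj F z : (mobius F z)^* = mobius (mconj F) z^*.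
Proof. by rewrite /mobius /= !(rmorphM, rmorphD, fmorphV)/=. Qed.

Lemma mobius0 F : mobius F 0 = F.2^* / F.1^*.
Proof. by rewrite /mobius !mulr0 !add0r. Qed.

Lemma mobius1 z : mobius (1, 0) z = z.
Proof. by rewrite /mobius /= mul1r mul0r !rmorph0 rmorph1 addr0 add0r divr1. Qed.

Lemma mmulVm F : SU11 F -> mmul (minv F) F = (1, 0).
Proof.
by move=> /SU11E f; rewrite /mmul /= rmorphN !conjCK; congr (_, _); rewrite -?f; ring.
Qed.

Lemma mmulA F G K : mmul F (mmul G K) = mmul (mmul F G) K.
Proof.
by rewrite /mmul /= !(rmorphM, rmorphD)/= !conjCK; congr (_, _); ring.
Qed.

Lemma minvK F : minv (minv F) = F.
Proof. by case: F => a b; rewrite /minv /= conjCK opprK. Qed.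

Lemma mmul1m F : mmul (1, 0) F = F.
Proof.
by case: F => a b; rewrite /mmul /= rmorph0 rmorph1 !mul0r !mul1r addr0 add0r.
Qed.

Lemma sqnorm_mobius F z : SU11 F -> sqnorm z < 1 ->
  1 - sqnorm (mobius F z) = (1 - sqnorm z) / sqnorm (F.2 * z + F.1^*).
Proof.
move=> f hz; have h := mobius_den f hz.
apply: complexI; rewrite [RHS]rmorphM fmorphV !rmorphB/= !sqnormE !normCK.
move: h; move/SU11E: f; rewrite /mobius !(rmorphM, rmorphD, fmorphV)/= !conjCK rmorph1.
move=> f h.
have h' : (F.2)^* * z^* + F.1 != 0.
  by rewrite -conjC_eq0 rmorphD rmorphM/= !conjCK.
rewrite -[X in _ = X / _]mulr1 -[X in _ = _ * X / _]f; field.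
by rewrite h h'.
Qed.

Lemma sqnorm_mobius_lt1 F z : SU11 F -> sqnorm z < 1 -> sqnorm (mobius F z) < 1.
Proof.
move=> f hz; rewrite -subr_gt0 sqnorm_mobius// divr_gt0 ?subr_gt0// lt_def sqnorm_ge0.
by rewrite sqnorm_eq0 mobius_den.
Qed.

(** [F.2 * G.1 - G.2 * F.1] is the lower left entry of [mmul (minv G) F], and for a matrix of
    SU(1,1) the squared modulus of that entry is [sinh2] between [0] and its image. This turns
    closeness of matrices into closeness of the images of [0]. *)
Lemma sinh2_mobius0 F G : SU11 F -> SU11 G ->
  sinh2 (mobius F 0) (mobius G 0) = sqnorm (F.2 * G.1 - G.2 * F.1).
Proof.
move=> f g; have z1 : sqnorm (0 : C) < 1 by rewrite sqnorm0 ltr01.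
rewrite /sinh2 !sqnorm_mobius// sqnorm0 subr0 !mulr0 !add0r !sqnorm_conj !div1r !mobius0.
have hF : F.1 != 0 by have := mobius_den f z1; rewrite mulr0 add0r conjC_eq0.
have hG : G.1 != 0 by have := mobius_den g z1; rewrite mulr0 add0r conjC_eq0.
rewrite invfM !invrK -sqnorm_conj !(rmorphM, rmorphB, fmorphV)/= !conjCK -!sqnormM.
by congr sqnorm; field; rewrite hF hG.
Qed.

Lemma mobius_id F : SU11 F -> (forall z, sqnorm z < 1 -> mobius F z = z) ->
  F = (1, 0) \/ F = (- 1, 0).
Proof.
move=> f h; have hd z (hz : sqnorm z < 1) := mobius_den f hz.
have z1 : sqnorm (0 : C) < 1 by rewrite sqnorm0 ltr01.
have e z : sqnorm z < 1 -> F.1 * z + F.2^* = z * (F.2 * z + F.1^*).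
  by move=> hz; apply: (canRL (divfK (hd z hz))); exact: h.
have F2 : F.2 = 0.
  by apply/eqP; rewrite -conjC_eq0; have := e 0 z1; rewrite !mulr0 add0r mul0r => ->.
have hh : sqnorm (2^-1 : C) < 1.
  rewrite -norm_lt1 normfV normr_nat invf_lt1 ?ltr0n// ltr1n//.
have := e _ hh; rewrite F2 rmorph0 addr0 mul0r add0r mulrC => F1.
have {}F1 : F.1 = F.1^* by apply: (mulfI _ F1); rewrite invr_eq0 pnatr_eq0.
have /eqP : F.1 ^+ 2 = 1.
  by move/SU11E: f; rewrite -F1 F2 mul0r subr0 expr2.
rewrite sqrf_eq1 => /orP[] /eqP F1'; [left|right].
  by rewrite [LHS]surjective_pairing F1' F2.
by rewrite [LHS]surjective_pairing F1' F2.
Qed.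

Lemma mobius_inj F G : SU11 F -> SU11 G ->
  (forall z, sqnorm z < 1 -> mobius F z = mobius G z) ->
  F = G \/ F = (- G.1, - G.2).
Proof.
move=> f g h; have gi := SU11_inv g.
have h1 z : sqnorm z < 1 -> mobius (mmul (minv G) F) z = z.
  by move=> hz; rewrite -mobius_comp// h// mobius_comp// mmulVm// mobius1.
have -> : F = mmul G (mmul (minv G) F).
  by rewrite mmulA -{1}[G]minvK mmulVm// mmul1m.
have [->|->] := mobius_id (SU11_mul gi f) h1; [left|right].
  by case: G {g h gi h1} => a b; rewrite /mmul /= !mulr0 !mulr1 !addr0.
by rewrite /mmul /= !mulr0 !mulrN1 !addr0.
Qed.

(** An equality would make complex conjugation a Moebius map; testing it at [0], [1/2] and [i/2]
    annihilates both entries of its matrix. This is what separates even from odd words in the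
    reflections. *)
Lemma mobius_anti F G : SU11 F -> SU11 G ->
  ~ (forall z, sqnorm z < 1 -> mobius F z = mobius G z^*).
Proof.
move=> f g h; have fi := SU11_inv f.
have [K kK h1] : exists2 K, SU11 K & forall z, sqnorm z < 1 -> mobius K z^* = z.
  exists (mmul (minv F) G); first exact: SU11_mul.
  move=> z hz; rewrite -mobius_comp ?sqnorm_conj// -h// mobius_comp// mmulVm//.
  by rewrite mobius1.
have z1 : sqnorm (0 : C) < 1 by rewrite sqnorm0 ltr01.
have e z : sqnorm z < 1 -> K.1 * z^* + K.2^* = z * (K.2 * z^* + K.1^*).
  move=> hz; have hz' : sqnorm z^* < 1 by rewrite sqnorm_conj.
  by apply: (canRL (divfK (mobius_den kK hz'))); exact: h1.
have K2 : K.2 = 0.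
  apply/eqP; rewrite -conjC_eq0; have := e 0 z1.
  by rewrite !rmorph0 !mulr0 add0r mul0r => ->.
have hh : sqnorm (2^-1 : C) < 1.
  by rewrite -norm_lt1 normfV normr_nat invf_lt1 ?ltr0n// ltr1n.
have hi : sqnorm ('i / 2 : C) < 1.
  by rewrite -norm_lt1 normrM normCi mul1r normfV normr_nat invf_lt1 ?ltr0n// ltr1n.
have := e _ hh; have := e _ hi; rewrite K2 !rmorph0 !mul0r !addr0 !add0r.
rewrite rmorphM/= fmorphV conjCi rmorph_nat => e1 e2.
have n2 : (2^-1 : C) != 0 by rewrite invr_eq0 pnatr_eq0.
move: e2; rewrite mulrC => /(mulfI n2) e2; move: e1; rewrite -e2.
rewrite [RHS]mulrC => /eqP; rewrite -subr_eq0 -mulrBr mulf_eq0.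
rewrite (_ : - 'i / 2 - 'i / 2 = - 'i); last by field.
rewrite oppr_eq0 (negbTE (neq0Ci _)) orbF => /eqP K1.
move/SU11E: kK; rewrite K1 K2 !mul0r subr0 => /eqP.
by rewrite eq_sym oner_eq0.
Qed.

End Mobius.

(** * The reflection group of an ideal polygon *)

Section Klein.
Context {R : realType}.
Local Notation C := R[i].
Local Notation D := (disc R).

Lemma sqnorm_lt1 (z : D) : sqnorm (val z) < 1.
Proof. by rewrite -norm_lt1 disc_lt1. Qed.

(* From the Poincare to the Klein model, where geodesics are chords. *)
Definition klein (z : C) : C := (2 / (1 + sqnorm z))%:C%C * z.

Lemma sqnorm_real (x : R) : sqnorm x%:C%C = x ^+ 2.
Proof. by rewrite /sqnorm /= expr0n addr0. Qed.

Lemma one_sqnorm_gt0 (z : C) : 0 < 1 + sqnorm z.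
Proof. by rewrite ltr_pwDl ?sqnorm_ge0. Qed.

Lemma one_sub_klein (z : C) :
  1 - sqnorm (klein z) = ((1 - sqnorm z) / (1 + sqnorm z)) ^+ 2.
Proof.
rewrite /klein sqnormM sqnorm_real; field.
by rewrite gt_eqF ?one_sqnorm_gt0.
Qed.

Lemma sqnorm_klein_lt1 (z : C) : sqnorm z < 1 -> sqnorm (klein z) < 1.
Proof.
move=> h; rewrite -subr_gt0 one_sub_klein exprn_gt0// divr_gt0 ?one_sqnorm_gt0//.
by rewrite subr_gt0.
Qed.

Lemma geoform_klein u w (z : C) : geoform u w z = (1 + sqnorm z) * orient u w (klein z).
Proof.
have := one_sqnorm_gt0 z; rewrite /geoform /orient /klein; move: (sqnorm z) => N hN.
case: u w z => [u1 u2] [w1 w2] [z1 z2]; rewrite /cross /=; field.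
by rewrite gt_eqF.
Qed.

Lemma nform_ge0 u w (z : C) : sqnorm z < 1 ->
  (0 <= nform u w z) = (0 <= orient u w (klein z)).
Proof.
move=> h; rewrite /nform pmulr_lge0; last by rewrite invr_gt0 subr_gt0.
rewrite geoform_klein.
by rewrite pmulr_rge0 ?one_sqnorm_gt0.
Qed.

Lemma nform_gt0 u w (z : C) : sqnorm z < 1 ->
  (0 < nform u w z) = (0 < orient u w (klein z)).
Proof.
move=> h; rewrite /nform pmulr_lgt0; last by rewrite invr_gt0 subr_gt0.
rewrite geoform_klein.
by rewrite pmulr_rgt0 ?one_sqnorm_gt0.
Qed.

Lemma nform_og_ge0 u w (z : C) : sqnorm z < 1 -> (0 <= nform u w z) = (0 <= geoform u w z).
Proof. by move=> h; rewrite /nform pmulr_lge0// invr_gt0 subr_gt0. Qed.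

Lemma half_planeE u w (z : D) : half_plane u w z <-> 0 <= nform u w (val z).
Proof.
rewrite nform_og_ge0 ?sqnorm_lt1// /half_plane /= geodesic_formE.
by rewrite -[X in X <= _]/(0%:C)%C lecR.
Qed.

(** Points at bounded distance from [z] stay away from the unit circle. The estimate comes from the
    square of [(1 + sqnorm z) x - 2 z], whose coefficients make its mixed term agree with that of
    [2 * (1 + sqnorm z) * sqnorm (x - z)]. *)
Lemma sinh2_bound (x z : C) (M : R) : sqnorm x < 1 -> sqnorm z < 1 -> sinh2 x z <= M ->
  (1 - sqnorm z) / (2 * (1 + sqnorm z)) <= (M + 2^-1) * (1 - sqnorm x).
Proof.
move=> hx hz; rewrite /sinh2 ler_pdivrMr ?mulr_gt0 ?subr_gt0// => h.
rewrite ler_pdivrMr ?mulr_gt0 ?one_sqnorm_gt0//.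
have k : sqnorm x * (1 - sqnorm z) * (1 + sqnorm z) - 2 * sqnorm z * (1 - sqnorm z) <=
    2 * (1 + sqnorm z) * sqnorm (x - z).
  rewrite -subr_ge0 (_ : _ - _ = sqnorm ((1 + sqnorm z)%:C%C * x - 2%:C%C * z)).
    exact: sqnorm_ge0.
  by clear; case: x z => [x1 x2] [z1 z2]; rewrite /sqnorm /=; ring.
have hz' : 0 < 1 - sqnorm z by rewrite subr_gt0.
have h1 : 2 * (1 + sqnorm z) * sqnorm (x - z) <=
    2 * (1 + sqnorm z) * (M * ((1 - sqnorm x) * (1 - sqnorm z))).
  by rewrite ler_wpM2l// mulr_ge0// ltW// one_sqnorm_gt0.
have h2 := le_trans k h1; rewrite -(ler_pM2r hz').
by move: h2; move: (sqnorm x) (sqnorm z) => a b; lra.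
Qed.

End Klein.

(** * Ping-pong for the side reflections of an ideal polygon *)

Section Polygon.
Context {R : realType} {n : nat}.
Local Notation C := R[i].
Local Notation D := (disc R).
Variable v : 'I_n -> C.
Hypothesis iv : ideal_vertices v.
Implicit Types (i j k : 'I_n) (y z p : D) (w : seq 'I_n).

Lemma ge3n : (3 <= n)%N. Proof. by case: iv. Qed.
Lemma sqnormv i : sqnorm (v i) = 1. Proof. by case: iv => _ h _; apply/norm_eq1. Qed.

Lemma orient_v i j k : (i < j < k)%N -> 0 < orient (v i) (v j) (v k).
Proof.
case: iv => _ _ h /h; rewrite orientE.
by rewrite (ltcR 0).
Qed.

Lemma ordS_neq i : ordS i != i.
Proof.
rewrite -val_eqE /=; have := ge3n; have := ltn_ord i => lt h.
have [e|ne] := eqVneq i.+1 n; first by rewrite e modnn; lia.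
by rewrite modn_small; lia.
Qed.

Lemma ordSS_neq i : ordS (ordS i) != i.
Proof.
rewrite -val_eqE /=; have := ge3n; have := ltn_ord i => lt h.
have [e|ne] := eqVneq i.+1 n; first by rewrite e modnn modn_small; lia.
rewrite (@modn_small i.+1); last lia.
have [e'|ne'] := eqVneq i.+2 n; first by rewrite e' modnn; lia.
by rewrite modn_small; lia.
Qed.

Lemma side_gt0 i k : k != i -> k != ordS i -> 0 < orient (v i) (v (ordS i)) (v k).
Proof.
rewrite -!val_eqE /=; have := ltn_ord i; have := ltn_ord k => lk li.
have [e|ne] := eqVneq i.+1 n.
  rewrite {1}e modnn => k1 k2.
  by rewrite -orient_rot; apply: orient_v; rewrite /= e modnn; lia.
rewrite {1}modn_small => [k1 k2|]; last lia.
have e : val (ordS i) = i.+1 by rewrite /= modn_small; lia.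
have [lt|ge] := ltnP k i.
  by rewrite orient_rot; apply: orient_v; rewrite e; lia.
by apply: orient_v; rewrite e; lia.
Qed.

Lemma side_ge0 i k : 0 <= orient (v i) (v (ordS i)) (v k).
Proof.
have [->|h1] := eqVneq k i; first by rewrite orient0l.
have [->|h2] := eqVneq k (ordS i); first by rewrite orient0r.
by rewrite ltW// side_gt0.
Qed.

Lemma v_inj : injective v.
Proof.
move=> i j e; apply: contrapT => /eqP ne.
have [e1|ne1] := eqVneq j (ordS i).
  have := @side_gt0 j i ne; rewrite {1}e1 eq_sym ordSS_neq => /(_ isT).
  by rewrite e orient0l ltxx.
by have := @side_gt0 i j; rewrite eq_sym ne ne1 -e orient0l ltxx => /(_ isT isT).
Qed.

Lemma side_neq i : v i != v (ordS i).
Proof. by apply/eqP => /v_inj /eqP; rewrite eq_sym (negbTE (ordS_neq i)). Qed.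

Definition side_form i z : R := nform (v i) (v (ordS i)) (val z).
Definition hsinh2 y z : R := sinh2 (val y) (val z).
Local Notation g := side_form.
Local Notation d := hsinh2.
Local Notation sg := (side_reflection v).
Local Notation P := (ideal_polygon v).

Lemma sgE i z : val (sg i z) = inversion (v i) (v (ordS i)) (val z).
Proof. by rewrite reflectionE ?side_neq//; apply/norm_eq1; exact: sqnormv. Qed.

Lemma g_sg i z : g i (sg i z) = - g i z.
Proof. by rewrite /side_form sgE nform_inversion ?sqnorm_lt1 ?sqnormv ?side_neq. Qed.

Definition refl_coef i : R := 4 / sqnorm (v i - v (ordS i)) ^+ 2.

Lemma refl_coef_gt0 i : 0 < refl_coef i.
Proof.
rewrite divr_gt0// exprn_gt0// lt_def sqnorm_ge0 sqnorm_eq0 subr_eq0 side_neq//.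
Qed.

Lemma hsinh2_sg p i z : d p (sg i z) = d p z + refl_coef i * (g i p * g i z).
Proof. by rewrite /hsinh2 sgE sinh2_inversion ?sqnorm_lt1 ?sqnormv ?side_neq. Qed.

Lemma sgK i z : sg i (sg i z) = z.
Proof.
apply: val_inj; rewrite !sgE inversionK ?side_neq ?disc_lt1//; apply/norm_eq1; exact: sqnormv.
Qed.

Lemma sg2 i : (sg i * sg i = 1)%g.
Proof. by apply: bijection_ext => z; rewrite /= sgK. Qed.

Lemma sgV i : ((sg i)^-1 = sg i)%g.
Proof. exact/mulg1_eq/sg2. Qed.

Lemma hsinh2C p z : d p z = d z p. Proof. exact: sinh2C. Qed.
Lemma hsinh2zz z : d z z = 0. Proof. exact: sinh2zz. Qed.
Lemma hsinh2_eq0 p z : d p z = 0 -> p = z.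
Proof. by move=> h; apply/val_inj/sinh2_eq0; rewrite ?sqnorm_lt1. Qed.

Lemma hsinh2_ge0 p z : 0 <= d p z.
Proof.
by rewrite divr_ge0 ?sqnorm_ge0// mulr_ge0// subr_ge0 ltW ?sqnorm_lt1.
Qed.

(** Two uses of [hsinh2_sg] contribute opposite correction terms, since [g i] is odd under
    [sg i]. *)
Lemma sg_isom i p z : d (sg i p) (sg i z) = d p z.
Proof. by rewrite hsinh2_sg g_sg [d (sg i p) z]hsinh2C hsinh2_sg [d z p]hsinh2C; ring. Qed.

Lemma g_eq0 i z : g i z = 0 -> sg i z = z.
Proof. by move=> h; apply/esym/hsinh2_eq0; rewrite hsinh2_sg hsinh2zz h !mulr0 addr0. Qed.

(** In the Klein model let [c] be an endpoint of side [i] that is not on side [j]. Beyond side [j]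
    the point has positive barycentric coordinates at both ends of [j] in the triangle over that
    side with apex [c]. The form of side [i] vanishes at [c], is nonnegative at these two ends and
    positive at one of them. Points on side [j] itself are covered because they are inside the open
    disc. *)
Lemma g_sep i j z : i != j -> g j z <= 0 -> 0 < g i z.
Proof.
move=> ij; rewrite leNgt /side_form !nform_gt0 ?sqnorm_lt1// -leNgt.
have hk := sqnorm_klein_lt1 (sqnorm_lt1 z); move: (klein _) hk => k hk hj.
have main c : 0 < orient (v j) (v (ordS j)) c -> sqnorm c = 1 ->
    orient (v i) (v (ordS i)) c = 0 ->  0 < orient (v i) (v (ordS i)) k.
  move=> h hc h0.
  have [h1 h2] := @beyond_chord _ _ _ c k (sqnormv j) (sqnormv (ordS j)) hc (ltW hk) h hj (or_introl hk).
  rewrite -(pmulr_lgt0 _ h) orient_bary h0 mulr0 addr0.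
  have [jS|jS] := eqVneq j (ordS i).
    rewrite ltr_wpDl//; first by rewrite mulr_ge0 ?side_ge0// ltW.
    rewrite mulr_gt0// side_gt0// jS ?ordSS_neq ?ordS_neq//.
  rewrite ltr_pwDl//; last by rewrite mulr_ge0 ?side_ge0// ltW.
  by rewrite mulr_gt0// side_gt0// eq_sym.
have [e|ne] := eqVneq i (ordS j); last first.
  by apply: (main (v i)); rewrite ?sqnormv ?orient0l// side_gt0.
apply: (main (v (ordS i))); rewrite ?sqnormv ?orient0r// side_gt0// e ?ordSS_neq ?ordS_neq//.
Qed.

Lemma PE z : P z <-> forall i, 0 <= g i z.
Proof.
split=> [h i|h i _]; last exact/half_planeE/h.
by apply/half_planeE; exact: h.
Qed.

Definition word_val w : disc_group R := (\prod_(i <- w) sg i)%g.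
Local Notation W := word_val.

Lemma W_cons i w z : W (i :: w) z = sg i (W w z).
Proof. by rewrite /word_val big_cons. Qed.

Lemma W_nil z : W [::] z = z.
Proof. by rewrite /word_val big_nil. Qed.

Lemma W_isom w p z : d (W w p) (W w z) = d p z.
Proof. by elim: w => [|i w IH]; rewrite ?W_nil// !W_cons sg_isom. Qed.

Definition reduced_word w := sorted (fun a b => a != b) w.

Lemma reduced_word_behead i w : reduced_word (i :: w) -> reduced_word w.
Proof. by rewrite /reduced_word /=; exact: path_sorted. Qed.

Definition reflection_group :=
  generated [set side_reflection v i | i in [set: 'I_n]].
Local Notation H := reflection_group.

Lemma subgroup_H : is_subgroup H.
Proof.
split; first by rewrite inE => A [[hA _] _]; move: hA; rewrite inE.
move=> x y; rewrite !inE => hx hy A [[h1 h2] h3].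
have := h2 x y; rewrite !inE; apply; [exact: hx|exact: hy].
Qed.

Lemma H_sg i : H (sg i).
Proof. by move=> A [_ hA]; apply: hA; exists i. Qed.

Lemma subgroupM (S : set (disc_group R)) (x y : disc_group R) :
  is_subgroup S -> S x -> S y -> S (x * y)%g.
Proof.
move=> /group_closedM h hx hy.
by have := h x y; rewrite !in_setE; apply.
Qed.

Lemma subgroupV (S : set (disc_group R)) (x : disc_group R) :
  is_subgroup S -> S x -> S (x^-1)%g.
Proof. by move=> /group_closedV h hx; have := h x; rewrite !in_setE; apply. Qed.

Lemma subgroup1 (S : set (disc_group R)) : is_subgroup S -> S 1%g.
Proof. by case; rewrite in_setE. Qed.

Lemma is_subgroupI (S : set (disc_group R)) : S 1%g ->
  (forall x y : disc_group R, S x -> S y -> S (x * y)%g) ->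
  (forall x : disc_group R, S x -> S (x^-1)%g) ->
  is_subgroup S.
Proof.
move=> h1 hM hV; split; first by rewrite in_setE.
by move=> x y; rewrite !in_setE => hx hy; apply/hM/hV.
Qed.

Lemma W_cat w1 w2 : W (w1 ++ w2) = (W w1 * W w2)%g.
Proof. by rewrite /word_val big_cat. Qed.

Lemma W_rev w : W (rev w) = ((W w)^-1)%g.
Proof.
elim: w => [|i w IH]; first by rewrite /word_val !big_nil invg1.
rewrite rev_cons -cats1 W_cat IH.
by rewrite /word_val big_seq1 big_cons invgM sgV.
Qed.

Lemma reduce w : exists2 w', reduced_word w' & W w = W w'.
Proof.
elim: w => [|i w [w' rw' e]]; first by exists [::].
case: w' rw' e => [_ e|j w' rw' e].
  by exists [:: i] => //; rewrite /word_val big_cons -/(W w) e /word_val !big_cons.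
have [ij|ij] := eqVneq i j.
  exists w'; first exact: reduced_word_behead rw'.
  by rewrite /word_val big_cons -/(W w) e ij /word_val big_cons mulgA sg2 mul1g.
exists (i :: j :: w'); first by rewrite /reduced_word /= ij.
by rewrite /word_val big_cons -/(W w) e [RHS]big_cons.
Qed.

Lemma H_words h : H h -> exists w, h = W w.
Proof.
move=> hH; apply: (hH [set h | exists w, h = W w]); split.
  apply: is_subgroupI; first by exists [::]; rewrite /word_val big_nil.
    by move=> _ _ [w1 ->] [w2 ->]; exists (w1 ++ w2); rewrite W_cat.
  by move=> _ [w1 ->]; exists (rev w1); rewrite W_rev.
by move=> _ [i _ <-]; exists [:: i]; rewrite /word_val big_seq1.
Qed.

Lemma H_word h : H h -> exists2 w, reduced_word w & h = W w.
Proof. by move=> /H_words[w ->]; exact: reduce. Qed.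

Lemma H_isom h p z : H h -> d (h p) (h z) = d p z.
Proof. by move=> /H_words[w ->]; exact: W_isom. Qed.

(** [g_sep] turns the weak sign for the second letter [j] into a strict sign of [g i] before [sg i]
    is applied. A single letter gives only the weak inequality, as [y] may lie on side [i]. *)
Lemma ping_pong i w y : reduced_word (i :: w) -> P y ->
  g i (W (i :: w) y) <= 0 /\ (w != [::] -> g i (W (i :: w) y) < 0).
Proof.
move=> + /PE Py; elim: w i => [|j w IH] i rw.
  by rewrite W_cons W_nil g_sg oppr_le0.
have [h _] := IH j (reduced_word_behead rw).
have ij : i != j by move: rw; rewrite /reduced_word /= => /andP[].
have hi := g_sep ij h.
by rewrite W_cons g_sg oppr_le0 oppr_lt0 hi ltW.
Qed.

(** The word is recorded along with the fixed point: that only the identity carries a point of [P]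
    off the sides back into [P] is what disjointness of the translates and [upperE] rest on. *)
Lemma strict_domain w y : reduced_word w -> P y -> P (W w y) ->
  W w y = y /\ (w = [::] \/ exists2 i, w = [:: i] & g i y = 0).
Proof.
case: w => [|i w] rw Py Pwy; first by rewrite W_nil; split=> //; left.
have [h1 h2] := ping_pong rw Py.
have /PE/(_ i) h3 := Pwy.
have e0 : g i (W (i :: w) y) = 0 by apply/eqP; rewrite eq_le h1.
case: w rw h2 e0 {h1 h3 Pwy} => [|j w] rw h2 e0; last first.
  by have := h2 isT; rewrite e0 ltxx.
move: e0; rewrite W_cons W_nil g_sg => /eqP; rewrite oppr_eq0 => /eqP e0.
by split; [exact: g_eq0|right; exists i].
Qed.

(** By ping-pong the image is beyond the side of the first letter, so undoing that letter brings it
    back to the side of [p], and the correction term of [hsinh2_sg] has the right sign. *)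
Lemma fold_min_word w p y : reduced_word w -> P p -> P y -> d p y <= d p (W w y).
Proof.
move=> + /[dup] Pp /PE Pp' Py; elim: w => [|i w IH] rw; first by rewrite W_nil.
apply: le_trans (IH (reduced_word_behead rw)) _.
have [h _] := ping_pong rw Py.
have -> : W w y = sg i (W (i :: w) y) by rewrite W_cons sgK.
rewrite hsinh2_sg gerDl; apply: mulr_ge0_le0; first by rewrite ltW// refl_coef_gt0.
by apply: mulr_ge0_le0.
Qed.

Lemma fold_min h p y : H h -> P p -> P y -> d p y <= d p (h y).
Proof. by move=> /H_word[w rw ->]; exact: fold_min_word. Qed.

Lemma fold_uniq h y : H h -> P y -> P (h y) -> h y = y.
Proof. by move=> /H_word[w rw ->] Py Phy; have [] := strict_domain rw Py Phy. Qed.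

End Polygon.

(** * Minima over finite sets and finiteness of separated sets *)

Section Finiteness.
Context {R : realType}.

Lemma finite_arg_min (T : Type) (A : set T) (f : T -> R) : finite_set A ->
  A !=set0 -> exists2 x, A x & forall y, A y -> f x <= f y.
Proof.
move=> fA [x0 Ax0].
have [B fB] := (finite_set_leP (f @` A)).1 (finite_image f fA).
have : finite_set (f @` A) by exact: finite_image.
move=> /finite_seqP[s sE].
have [r rs rmin] : exists2 r, r \in s & forall y, y \in s -> r <= y.
  have : s != [::].
    apply/eqP => s0; have : (f @` A) (f x0) by exists x0.
    by rewrite sE s0.
  clear; elim: s => [//|a s IH] _.
  have [->|/IH[r rs rmin]] := eqVneq s [::].
    by exists a; rewrite ?mem_head// => y; rewrite mem_seq1 => /eqP->.
  have [ar|ra] := leP a r.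
    exists a; first exact: mem_head.
    by move=> y; rewrite inE => /orP[/eqP->//|/rmin]; exact: le_trans.
  exists r; first by rewrite inE rs orbT.
  by move=> y; rewrite inE => /orP[/eqP->|/rmin//]; exact: ltW.
have : (f @` A) r by rewrite sE.
case=> x Ax fx; exists x => // y Ay; rewrite fx; apply: rmin.
by have : (f @` A) (f y) by [exists y]; rewrite sE.
Qed.

(* Pigeonhole: a fine enough grid separates the points of [A]. *)
Lemma finite_separated (A : set R[i]) (eta : R) : 0 < eta ->
  (forall x, A x -> sqnorm x <= 1) ->
  (forall x y, A x -> A y -> x <> y -> eta <= sqnorm (x - y)) -> finite_set A.
Proof.
move=> e0 A1 Asep.
(* Two points in one cell of mesh [1/N] are at squared distance below [2 / N^2], which is at most
   [2 / N], hence below [eta]. *)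
pose N := (Num.truncn (2 / eta)).+2.
have Nlt : 2 / eta < N%:R.
  by rewrite (lt_trans (truncnS_gt _))// ltr_nat.
pose f (x : R[i]) : int * int :=
  (Num.floor (complex.Re x * N%:R), Num.floor (complex.Im x * N%:R)).
have finj : {in A &, injective f}.
  move=> x y /set_mem Ax /set_mem Ay [e1 e2]; apply: contrapT => xy.
  have := Asep _ _ Ax Ay xy; apply/negP; rewrite -ltNge.
  have N0 : 0 < N%:R :> R by rewrite ltr0n.
  have fl (a b : R) : Num.floor (a * N%:R) = Num.floor (b * N%:R) ->
      (a - b) ^+ 2 * N%:R ^+ 2 < 1.
    move=> e; rewrite -exprMn mulrBl.
    have := floor_le (a * N%:R); have := floorD1_gt (a * N%:R).
    have := floor_le (b * N%:R); have := floorD1_gt (b * N%:R).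
    rewrite e !intrD; move: (_%:~R) => t; nra.
  have h1 := fl _ _ e1; have h2 := fl _ _ e2.
  have N1 : 1 <= N%:R :> R by rewrite ler1n.
  rewrite ltr_pdivrMr// in Nlt.
  have : sqnorm (x - y) * N%:R ^+ 2 < 2.
    rewrite (_ : sqnorm _ = (complex.Re x - complex.Re y) ^+ 2 + (complex.Im x - complex.Im y) ^+ 2); first by lra.
    by case: (x) (y) => [? ?] [? ?].
  move: (sqnorm (x - y)) => t h3; nra.
suff : finite_set (f @` A).
  move=> h; apply: (card_le_finite _ h).
  by rewrite (card_le_eqr (inj_card_eq finj)) card_lexx.
pose B : set int := [set k | (`|k| <= N)%N].
have fB : finite_set B.
  apply: (@sub_finite_set _ _ ((Posz @` `I_N.+1) `|` (Negz @` `I_N.+1))).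
    by case=> k; rewrite /B /= => hk; [left|right]; exists k => //=; lia.
  by rewrite finite_setU; split; apply: finite_image; exact: finite_II.
apply: (sub_finite_set _ (finite_setX fB fB)).
have fl (a : R) : a ^+ 2 <= 1 -> B (Num.floor (a * N%:R)).
  move=> a1; have [am aM] : - 1 <= a /\ a <= 1 by split; nra.
  have N0 : 0 <= N%:R :> R by [].
  have := floor_le (a * N%:R); have := floorD1_gt (a * N%:R).
  rewrite /B /=; move: (Num.floor _) => k h1 h2.
  have hk1 : k%:~R <= (N%:Z)%:~R :> R by rewrite (le_trans h2)//; nra.
  have hk2 : (- N%:Z)%:~R < (k + 1)%:~R :> R.
    by rewrite (le_lt_trans _ h1)// mulrNz; nra.
  by move: hk1 hk2; rewrite ler_int ltr_int; lia.
move=> _ [x Ax <-]; have := A1 x Ax; rewrite /sqnorm => h.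
have h1 := sqr_ge0 (complex.Re x); have h2 := sqr_ge0 (complex.Im x).
by split; apply: fl; lra.
Qed.

End Finiteness.

(** * The orbit of the origin when one side is a diameter *)

Section Diameter.
Context {R : realType} {n : nat}.
Local Notation C := R[i].
Local Notation D := (disc R).
Local Notation d := hsinh2.
Variables (v : 'I_n -> C) (l : 'I_n).
Hypothesis iv : ideal_vertices v.
Hypothesis diam : is_diameter (side v l).
Implicit Types (i j k : 'I_n) (y z p : D) (w : seq 'I_n).
Local Notation g := (side_form v).
Local Notation sg := (side_reflection v).
Local Notation P := (ideal_polygon v).
Local Notation H := (reflection_group v).
Local Notation W := (word_val v).

Lemma disc0_subproof : (0 : C) \in @unit_disc R.
Proof. by rewrite inE /unit_disc /= normr0 ltr01. Qed.
Definition disc0 : D := exist _ 0 disc0_subproof.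

Lemma g_disc0 i : g i disc0 = cross (v i) (v (ordS i)).
Proof.
by rewrite /side_form /nform /geoform /= sqnorm0 subr0 divr1 /cross /=; ring.
Qed.

Lemma g_diameter_disc0 : g l disc0 = 0.
Proof.
have [e _ sE] := diam.
have : side v l disc0 by rewrite sE /=; exists 0; rewrite mul0r.
rewrite /side /geodesic /= geodesic_formE => /complexI h.
by rewrite /side_form /nform h mul0r.
Qed.

Lemma sg_diameter_disc0 : sg l disc0 = disc0. Proof. exact: g_eq0 g_diameter_disc0. Qed.

Lemma g_disc0_gt0 i : i != l -> 0 < g i disc0.
Proof. by move=> il; apply: (g_sep iv il); rewrite g_diameter_disc0. Qed.

Lemma g_disc0_ge0 i : 0 <= g i disc0.
Proof.
by have [->|/g_disc0_gt0/ltW//] := eqVneq i l; rewrite g_diameter_disc0.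
Qed.

Lemma polygon_disc0 : P disc0. Proof. by apply/PE => i; exact: g_disc0_ge0. Qed.

Lemma v_opp : v (ordS l) = - v l.
Proof.
have := g_diameter_disc0; rewrite g_disc0.
have := sqnormv iv l; have := sqnormv iv (ordS l); have := side_neq iv l.
move: (v l) (v (ordS l)) => a b ab b1 a1 c0.
have := @dot_lt1 R a b; rewrite a1 b1 lexx => /(_ isT isT ab) lt.
have h : dot a b ^+ 2 = 1.
  have : dot a b ^+ 2 + cross a b ^+ 2 = sqnorm a * sqnorm b.
    by clear; case: a b => [? ?] [? ?]; rewrite /dot /cross /sqnorm /=; ring.
  by rewrite c0 a1 b1 expr0n addr0 mulr1.
have {h lt} h : dot a b = - 1 by nra.
have : sqnorm (a + b) == 0.
  rewrite (_ : sqnorm _ = sqnorm a + sqnorm b + 2 * dot a b); first by rewrite h a1 b1; lra.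
  by clear; case: a b => [? ?] [? ?]; rewrite /dot /sqnorm /=; ring.
by rewrite sqnorm_eq0 addr_eq0 => /eqP->; rewrite opprK.
Qed.

Lemma hsinh2_disc0E z : d disc0 z = sqnorm (val z) / (1 - sqnorm (val z)).
Proof. by rewrite /hsinh2 /sinh2 /= sqnorm0 sub0r sqnormN subr0 mul1r. Qed.

Lemma hsinh2_disc0_le y z : (d disc0 y <= d disc0 z) = (sqnorm (val y) <= sqnorm (val z)).
Proof.
rewrite !hsinh2_disc0E; have := sqnorm_lt1 y; have := sqnorm_lt1 z.
move: (sqnorm (val y)) (sqnorm (val z)) => a b hb ha.
rewrite ler_pdivrMr ?subr_gt0// mulrAC ler_pdivlMr ?subr_gt0//.
by apply/idP/idP; nra.
Qed.

Lemma sqnorm_sg_l z : sqnorm (val (sg l z)) = sqnorm (val z).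
Proof.
have e : d disc0 (sg l z) = d disc0 z by rewrite -{1}sg_diameter_disc0 sg_isom.
by apply/eqP; rewrite eq_le -!hsinh2_disc0_le e lexx.
Qed.

(* The sides other than the diameter stay away from the origin. *)
Lemma sides_away : exists2 eps : R, 0 < eps &
  forall i z, i != l -> g i z <= 0 -> eps <= sqnorm (val z).
Proof.
(* By the Cauchy-Schwarz inequality and [sqnorm (b - a) <= 4], the linear term of the form has
   square at most [16 * sqnorm z]; beyond the side it must outweigh the value at the origin. *)
pose c i : R := g i disc0 ^+ 2 / 16.
have c0 i : i != l -> 0 < c i by move=> /g_disc0_gt0 h; rewrite divr_gt0// exprn_gt0.
have [eps e0 eP] : exists2 eps : R, 0 < eps & forall i, i != l -> eps <= c i.
  exists (\big[Num.min/1]_(i | i != l) c i).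
    by apply: (big_ind (fun x => 0 < x)) => // x y x0 y0; rewrite lt_min x0.
  by move=> i il; rewrite (bigD1 i)//= ge_min lexx.
exists eps => // i z il gz; apply: (le_trans (eP i il)); rewrite /c ler_pdivrMr//.
move: gz (g_disc0_gt0 il); rewrite g_disc0 /side_form /nform pmulr_lle0; last first.
  by rewrite invr_gt0 subr_gt0 sqnorm_lt1.
have := sqnorm_ge0 (val z); have := sqnormv iv i; have := sqnormv iv (ordS i).
rewrite /geoform; move: (cross (v i) _) => e; move: (v i) (v (ordS i)) (val z) => a b x b1 a1 x0 h e1.
have h1 : cross (b - a) x ^+ 2 <= 4 * sqnorm x.
  apply: (@le_trans _ _ (sqnorm (b - a) * sqnorm x)).
    rewrite -subr_ge0 (_ : _ - _ = dot (b - a) x ^+ 2) ?sqr_ge0//.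
    by clear; move: (b - a) => c; case: c x => [? ?] [? ?]; rewrite /dot /cross /sqnorm /=; ring.
  apply: ler_wpM2r => //; have := sqnorm_ge0 (a + b); move: a1 b1; clear.
  by case: a b => [? ?] [? ?]; rewrite /sqnorm /=; lra.
have h2 : e <= - 2 * cross (b - a) x.
  have := mulr_ge0 x0 (ltW e1); lra.
move: h1 h2 e1; move: (cross _ _) (sqnorm x) => s t; nra.
Qed.

Lemma orbit_o_sep : exists2 eps : R, 0 < eps &
  forall h, H h -> h disc0 = disc0 \/ eps <= sqnorm (val (h disc0)).
Proof.
have [eps e0 eP] := sides_away; exists eps => // h /(H_word iv)[w + ->].
elim: w => [|i w IH] rw; first by left; rewrite W_nil.
have [h1 h2] := ping_pong iv rw polygon_disc0.
have [il|il] := eqVneq i l; last by right; exact: eP h1.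
rewrite W_cons il; have [->|h3] := IH (reduced_word_behead rw); first by left; exact: sg_diameter_disc0.
by right; rewrite sqnorm_sg_l.
Qed.

(** A nonempty reduced word that fixes [0] begins with [l], since the other forms are positive at
    [0]; a second letter would make [g l] strictly negative there, while it vanishes. *)
Lemma stab_disc0 h : H h -> h disc0 = disc0 -> h = 1%g \/ h = sg l.
Proof.
move=> /(H_word iv)[[|i w] rw ->]; first by left; rewrite /word_val big_nil.
move=> e; have [h1 h2] := ping_pong iv rw polygon_disc0; rewrite e in h1 h2.
have il : i = l.
  by apply: contrapT => /eqP /g_disc0_gt0; rewrite ltNge h1.
case: w rw h2 {e h1} => [|j w] rw; first by right; rewrite /word_val big_seq1 il.
by move=> /(_ isT); rewrite il g_diameter_disc0 ltxx.
Qed.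

Lemma orbit_o_sep2 : exists2 eps : R, 0 < eps &
  forall h h', H h -> H h' -> h disc0 = h' disc0 \/ eps <= d (h disc0) (h' disc0).
Proof.
have [eps e0 eP] := orbit_o_sep; exists eps => // h h' Hh Hh'.
have HV : H (h^-1 * h')%g.
  by apply: (subgroupM (subgroup_H v)) => //; exact: (subgroupV (subgroup_H v)).
have e z : h ((h^-1)%g z) = z by exact: bij_invK.
have [h1|h1] := eP _ HV.
  by left; rewrite -[RHS]e; congr (h _); rewrite -[LHS]h1.
right; rewrite -[h' disc0]e (H_isom iv)//; apply: (le_trans h1).
rewrite hsinh2_disc0E ler_pdivlMr ?subr_gt0 ?sqnorm_lt1//.
by rewrite ler_piMr ?sqnorm_ge0// gerBl sqnorm_ge0.
Qed.

(** Within bounded distance of [z] the factor [1 - sqnorm x] is at least [c], so a separation [eps]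
    for [sinh2] becomes the Euclidean separation [eps * c ^+ 2]. *)
Lemma orbit_o_finite (M : R) z :
  finite_set [set x | (exists2 h, H h & x = h disc0) /\ d x z <= M].
Proof.
have [eps e0 eP] := orbit_o_sep2.
pose A := [set x : D | (exists2 h, H h & x = h disc0) /\ d x z <= M].
pose c := (1 - sqnorm (val z)) / (2 * (1 + sqnorm (val z))) / (M + 2^-1).
have [M0|M0] := ltP M 0.
  rewrite (_ : [set _ | _] = set0) //; apply/seteqP; split=> // x [_].
  by rewrite leNgt (lt_le_trans M0)// hsinh2_ge0.
have M1 : 0 < M + 2^-1 by rewrite ltr_wpDl.
have c0 : 0 < c.
  rewrite divr_gt0// divr_gt0 ?subr_gt0 ?sqnorm_lt1//.
  by rewrite mulr_gt0 ?one_sqnorm_gt0.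
have cP x : A x -> c <= 1 - sqnorm (val x).
  by move=> [_ /(sinh2_bound (sqnorm_lt1 x) (sqnorm_lt1 z)) h]; rewrite /c ler_pdivrMr// [leRHS]mulrC.
have inj : {in A &, injective (val : D -> C)} by move=> x y _ _; exact: val_inj.
suff : finite_set (val @` A).
  by move=> h; apply: (card_le_finite _ h); rewrite (card_le_eqr (inj_card_eq inj)) card_lexx.
apply: (@finite_separated _ _ (eps * c ^+ 2)).
- by rewrite mulr_gt0// exprn_gt0.
- by move=> _ [x _ <-]; rewrite ltW ?sqnorm_lt1.
move=> _ _ [x Ax <-] [y Ay <-] xy.
have cx := cP x Ax; have cy := cP y Ay.
have [[h Hh ex] _] := Ax; have [[h' Hh' ey] _] := Ay.
have [e|] := eP h h' Hh Hh'; first by case: xy; rewrite ex ey e.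
rewrite -ex -ey /hsinh2 /sinh2 ler_pdivlMr; last by rewrite mulr_gt0// subr_gt0 sqnorm_lt1.
apply: le_trans; rewrite ler_pM2l// expr2.
by apply: ler_pM => //; exact: ltW.
Qed.

(* A minimiser of [|h z|] can only lie beyond the diameter, and the reflection in
   the diameter preserves the norm. *)
Lemma H_cover z : exists2 h, H h & P (h z).
Proof.
have HV h : H h -> H (h^-1)%g by exact: (subgroupV (subgroup_H v)).
have H1 : H 1%g by exact: subgroup1 (subgroup_H v).
(* The distance from [h disc0] to [z] is that from [disc0] to [h^-1 z]. Only orbit points at least
   as near to [z] as [disc0] compete, and there are finitely many of them. *)
have [x [[h Hh ->] _] hmin] := finite_arg_min (fun x => d x z)
  (orbit_o_finite (d disc0 z) z) (ex_intro _ disc0 (conj (ex_intro2 _ _ 1%g H1 erefl) (lexx _))).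
have {}hmin h' : H h' -> d disc0 ((h^-1)%g z) <= d disc0 (h' z).
  move=> Hh'.
  have e1 : d disc0 ((h^-1)%g z) = d (h disc0) z.
    rewrite -(H_isom iv disc0 ((h^-1)%g z) Hh).
    by congr d; exact: bij_invK.
  have e2 : d disc0 (h' z) = d ((h'^-1)%g disc0) z.
    rewrite -(H_isom iv ((h'^-1)%g disc0) z Hh').
    by congr d; apply/esym; exact: bij_invK.
  rewrite e1 e2; have [le|/ltW le] := leP (d ((h'^-1)%g disc0) z) (d disc0 z).
    by apply: hmin; split=> //; exists (h'^-1)%g => //; exact: HV.
  apply: le_trans le; apply: hmin; split=> //; by exists 1%g.
have {hmin} [k [Hk kmin kl]] : exists k : disc_group R, [/\ H k,
    forall h', H h' -> d disc0 (k z) <= d disc0 (h' z) & 0 <= g l (k z)].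
  have [ge|lt] := leP 0 (g l ((h^-1)%g z)).
    by exists (h^-1)%g; split=> //; exact: HV.
  exists (sg l * h^-1)%g; split.
  - by apply: (subgroupM (subgroup_H v)); [exact: H_sg|exact: HV].
  - move=> h' /hmin; apply: le_trans.
    by rewrite -{1}sg_diameter_disc0 [X in d _ X <= _](_ : _ = sg l ((h^-1)%g z)) // sg_isom.
  by rewrite [X in g l X](_ : _ = sg l ((h^-1)%g z))// g_sg// oppr_ge0 ltW.
exists k => //; apply/PE => i; have [->//|il] := eqVneq i l.
rewrite leNgt; apply/negP => lt.
(* If [g i] were negative, reflecting in side [i] would bring the point nearer to [disc0], where
   [g i] is positive. *)
have := kmin (sg i * k)%g; rewrite [X in _ <= d _ X](_ : _ = sg i (k z))// hsinh2_sg//.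
move=> /(_ (subgroupM (subgroup_H v) (@H_sg _ _ v i) Hk)); rewrite lerDl leNgt.
by rewrite pmulr_rlt0 ?refl_coef_gt0// pmulr_rlt0 ?g_disc0_gt0// lt.
Qed.

Lemma sqnorm_min h z : H h -> P z -> sqnorm (val z) <= sqnorm (val (h z)).
Proof. by move=> Hh Pz; rewrite -hsinh2_disc0_le; exact: (fold_min iv Hh polygon_disc0 Pz). Qed.

End Diameter.

(** * The orientation preserving subgroup *)

Section Orientation.
Context {R : realType}.
Local Notation C := R[i].
Local Notation D := (disc R).
Implicit Types (s t : disc_group R).
Local Notation OP := (@orientation_preserving R).

(** Orientation reversing isometries, written as conjugation followed by an element of SU(1,1). *)
Definition anti s := exists2 F : C * C, SU11 F &
  forall z, val (s z) = mobius F (val z)^*.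

Lemma disc_ex (z : C) : sqnorm z < 1 -> exists x : D, val x = z.
Proof. by rewrite -norm_lt1 => h; exists (exist _ z (mem_set h)). Qed.

Lemma OP_anti s : OP s -> ~ anti s.
Proof.
move=> [F f hF] [G gG hG]; apply: (mobius_anti f gG) => z /disc_ex[x <-].
by rewrite -hF hG.
Qed.

Lemma OP_mul s t : OP s -> OP t -> OP (s * t)%g.
Proof.
move=> [F f hF] [G gG hG]; exists (mmul F G); first exact: SU11_mul.
by move=> z; rewrite -mobius_comp ?sqnorm_lt1// -hG -hF.
Qed.

Lemma anti_OP_mul s t : anti s -> OP t -> anti (s * t)%g.
Proof.
move=> [F f hF] [G gG hG]; exists (mmul F (mconj G)).
  exact/SU11_mul/SU11_conj.
move=> z; rewrite -mobius_comp ?sqnorm_conj ?sqnorm_lt1//; last exact: SU11_conj.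
by rewrite -mobius_conj -hG -hF.
Qed.

Lemma anti_mul s t : anti s -> anti t -> OP (s * t)%g.
Proof.
move=> [F f hF] [G gG hG]; exists (mmul F (mconj G)).
  exact/SU11_mul/SU11_conj.
move=> z; rewrite -mobius_comp ?sqnorm_lt1//; last exact: SU11_conj.
by rewrite -[val z]conjCK -mobius_conj -hG -hF.
Qed.

Lemma OP1 : OP 1%g.
Proof.
exists (1, 0); first by apply/SU11E; rewrite /= rmorph1 rmorph0 mulr0 mulr1 subr0.
by move=> z; rewrite mobius1.
Qed.

Lemma OPV s : OP s -> OP (s^-1)%g.
Proof.
move=> [F f hF]; exists (minv F); first exact: SU11_inv.
move=> z; rewrite -{2}[z](bij_invK s) hF mobius_comp ?sqnorm_lt1//; last exact: SU11_inv.
by rewrite mmulVm// mobius1.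
Qed.

End Orientation.

(** * Index two, free generators and discreteness *)

Section RotationGroup.
Context {R : realType} {n : nat}.
Local Notation C := R[i].
Local Notation D := (disc R).
Local Notation d := hsinh2.
Variables (v : 'I_n -> C) (l : 'I_n).
Hypothesis iv : ideal_vertices v.
Hypothesis diam : is_diameter (side v l).
Implicit Types (i j k : 'I_n) (y z p : D) (w : seq 'I_n) (h s t : disc_group R).
Local Notation g := (side_form v).
Local Notation sg := (side_reflection v).
Local Notation P := (ideal_polygon v).
Local Notation H := (reflection_group v).
Local Notation W := (word_val v).
Local Notation OP := (@orientation_preserving R).

Definition rotation_group := H `&` OP.
Local Notation Gamma := rotation_group.

Lemma anti_sg i : anti (sg i).
Proof.
have [F f hF] := inversion_anti (sqnormv iv i) (sqnormv iv (ordS i)) (side_neq iv i).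
by exists F => // z; rewrite (sgE iv) hF.
Qed.

Lemma W_parity w : if odd (size w) then anti (W w) else OP (W w).
Proof.
elim: w => [|i w IH]; first by rewrite /= /word_val big_nil; exact: OP1.
rewrite /word_val big_cons -/(W w) /=; case: (odd _) IH => /= IH.
  by apply: anti_mul => //; exact: anti_sg.
by apply: anti_OP_mul => //; exact: anti_sg.
Qed.

Lemma H_orientation h : H h -> OP h \/ anti h.
Proof.
by move=> /(H_words iv)[w ->]; have := W_parity w; case: odd; [right|left].
Qed.

Lemma subgroup_Gamma : is_subgroup Gamma.
Proof.
have sH := subgroup_H v; apply: is_subgroupI.
- by split; [exact: subgroup1|exact: OP1].
- move=> x y [x1 x2] [y1 y2].
  by split; [exact: (subgroupM sH)|exact: OP_mul].
- by move=> x [x1 x2]; split; [exact: (subgroupV sH)|exact: OPV].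
Qed.

Lemma Gamma_sg_l h : H h -> ~ Gamma h -> Gamma (sg l * h)%g.
Proof.
move=> Hh nG; have [oh|ah] := H_orientation Hh; first by case: nG; split.
split; first by apply: (subgroupM (subgroup_H v)) => //; exact: H_sg.
by apply: anti_mul => //; exact: anti_sg.
Qed.

Lemma not_Gamma_sg i : ~ Gamma (sg i).
Proof. by move=> [_ /OP_anti]; apply; exact: anti_sg. Qed.

Lemma index_two_Gamma : index_two Gamma H.
Proof.
split; [exact: subgroup_Gamma|by move=> x []|].
exists (sg l); first by split; [exact: H_sg|exact: not_Gamma_sg].
apply/seteqP; split=> [h Hh|h].
  have [Gh|nG] := pselect (Gamma h); first by left.
  right; exists (sg l * h)%g; first exact: Gamma_sg_l.
  by rewrite mulgA (sg2 iv) mul1g.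
case=> [[]//|[s [Hs _] <-]].
by apply: (subgroupM (subgroup_H v)) => //; exact: H_sg.
Qed.

Definition rotation_basis : set (disc_group R) :=
  [set (sg l * sg i)%g | i in [set i | i != l]].

Lemma is_subgroup_generated (S : set (disc_group R)) :
  is_subgroup (generated S).
Proof.
split; first by rewrite inE => A [[hA _] _]; move: hA; rewrite inE.
move=> x y; rewrite !inE => hx hy A [[h1 h2] h3].
have := h2 x y; rewrite !inE; apply; [exact: hx|exact: hy].
Qed.

(** Each letter either preserves or exchanges the alternatives that a word, or its product with
    [sg l], lies in the generated group. For an orientation preserving word the second alternative
    is impossible, as that product reverses orientation. *)
Lemma generated_basis : generated rotation_basis = Gamma.
Proof.
have sK := is_subgroup_generated rotation_basis.
have KG : generated rotation_basis `<=` Gamma.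
  move=> h; apply; split; first exact: subgroup_Gamma.
  move=> _ [i il <-]; split.
    by apply: (subgroupM (subgroup_H v)); exact: H_sg.
  by apply: anti_mul; exact: anti_sg.
have Kb i : i != l -> generated rotation_basis (sg l * sg i)%g.
  by move=> il A [_ hA]; apply: hA; exists i.
apply/seteqP; split=> // h [/(H_words iv)[w ->] ow].
have K w' : generated rotation_basis (W w') \/ generated rotation_basis (sg l * W w')%g.
  elim: w' => [|i w' IH].
    by left; rewrite /word_val big_nil; exact: subgroup1.
  rewrite /word_val big_cons -/(W w').
  have [->|il] := eqVneq i l.
    by case: IH => IH; [right; rewrite mulgA (sg2 iv) mul1g|left].
  case: IH => IH.
    by right; rewrite mulgA; apply: (subgroupM sK) => //; exact: Kb.
  left; have := subgroupM sK (subgroupV sK (Kb i il)) IH.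
  by rewrite invgM !(sgV iv) mulgA -(mulgA (sg i)) (sg2 iv) mulg1.
have [//|/KG[_ /OP_anti]] := K w.
by case; apply: anti_OP_mul => //; exact: anti_sg.
Qed.

(* The half-plane into which the letter [a] of a reduced word moves the images of
   [0] under the words that may follow it. *)
Definition region (a : disc_group R * bool) y := exists i,
  [/\ i != l, a.1 = (sg l * sg i)%g & if a.2 then g i y < 0 else g i (sg l y) < 0].

Lemma region_step a y : rotation_basis a.1 ->
  (y = disc0 \/ exists2 b, region b y & (a.1 != b.1) || (a.2 == b.2)) ->
  region a (letter_val a y).
Proof.
case: a => s c /= [i il <-] hy; exists i; split=> //=.
have sep := g_sep iv.
case: c hy => hy.
  have -> : letter_val ((sg l * sg i)%g, true) = (sg i * sg l)%g.
    by transitivity ((sg l * sg i)^-1)%g => //; rewrite invgM !(sgV iv).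
  rewrite [X in g i X](_ : _ = sg i (sg l y))// (g_sg iv) oppr_lt0.
  case: hy => [->|[[_ b] [j /= [jl -> hb]]]].
    by rewrite (sg_diameter_disc0 iv diam) (g_disc0_gt0 iv diam).
  case: b hb => hb.
    have := sep l j y; rewrite eq_sym jl => /(_ isT (ltW hb)) h _.
    by apply: (sep i l) => //; rewrite (g_sg iv) oppr_le0 ltW.
  rewrite orbF => ne; apply: (sep i j) => //; last exact: ltW.
  by apply: contraNneq ne => ->.
rewrite [X in sg l X](_ : _ = sg l (sg i y))// (sgK iv) (g_sg iv) oppr_lt0.
case: hy => [->|[[_ b] [j /= [jl -> hb]]]]; first exact: (g_disc0_gt0 iv diam).
case: b hb => hb.
  rewrite orbF => ne; apply: (sep i j) => //; last exact: ltW.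
  by apply: contraNneq ne => ->.
have := sep l j (sg l y); rewrite eq_sym jl => /(_ isT (ltW hb)).
by rewrite (g_sg iv) oppr_gt0 => h _; apply: (sep i l) => //; exact: ltW.
Qed.

Lemma free_basis_Gamma : free_basis rotation_basis Gamma.
Proof.
split; first exact: generated_basis.
have main (a : disc_group R * bool) (w : seq (disc_group R * bool)) :
    (forall b, b \in a :: w -> rotation_basis b.1) -> reduced (a :: w) ->
    region a ((\prod_(b <- a :: w) letter_val b)%g disc0).
  elim: w a => [|b w IH] a aw rw.
    rewrite big_seq1; apply: region_step; last by left.
    by apply: aw; rewrite mem_head.
  rewrite big_cons; apply: (@region_step a).
    by apply: aw; rewrite mem_head.
  move: rw; rewrite /reduced /= => /andP[ab rw].
  right; exists b => //; apply: IH => // c cw; apply: aw.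
  by rewrite inE cw orbT.
case=> [//|a w] aw rw e; have := main a w aw rw; rewrite e => -[i [il _]].
have := g_disc0_gt0 iv diam il; have : sg l disc0 = disc0 := sg_diameter_disc0 iv diam.
rewrite /= => -> h; case: a.2; rewrite ltNge ltW//.
Qed.

Lemma rotation_stab_disc0 s : Gamma s -> s disc0 = disc0 -> s = 1%g.
Proof.
move=> Gs so; have [//|e] := stab_disc0 iv diam Gs.1 so.
by case: (@not_Gamma_sg l); rewrite -e.
Qed.

Lemma acts_disc0 s F : acts_by s F -> val (s disc0) = mobius F 0.
Proof. by move=> h; rewrite h. Qed.

Lemma nbhs_sqnorm (z : C) (e : R) : 0 < e -> nbhs z [set x | sqnorm (x - z) < e].
Proof.
move=> e0; apply/nbhs_ballP; exists (Num.sqrt e)%:C%C.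
  by rewrite /= (ltcR 0) sqrtr_gt0.
move=> x; rewrite /ball /= normE ltcR sqnormB.
by rewrite ltr_sqrt.
Qed.

(** A matrix near [F0] sends [0] so close to [s0 disc0] that the two orbit points coincide; the
    stabiliser of [0] in [Gamma] is trivial, so [s = s0]. The matrices then agree up to sign, and
    [- F0] is too far away, since the first entries differ by [2 * F0.1] with [sqnorm F0.1 >= 1]. *)
Lemma fuchsian_Gamma : is_fuchsian Gamma.
Proof.
split; [exact: subgroup_Gamma|by move=> x []|].
have [eps e0 eP] := orbit_o_sep2 iv diam.
move=> F0 MF0; have [f0 [s0 Gs0 a0]] := MF0; split; first by rewrite in_setE.
pose m := sqnorm F0.1 + sqnorm F0.2.
have m0 : 0 < m by rewrite /m (SU11_sqnorm f0) -addrA ltr_pwDl// addr_ge0 ?sqnorm_ge0.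
(* With both entries within [eta], the bound [sqnormD_le] keeps [sinh2] of the two images of [0]
   below [2 * eta * m], which is at most [eps]; the cap [1] excludes [- F0]. *)
pose eta := Num.min 1 (eps / (2 * m)).
have eta0 : 0 < eta by rewrite lt_min ltr01 divr_gt0// mulr_gt0.
exists [set F | sqnorm (F.1 - F0.1) < eta /\ sqnorm (F.2 - F0.2) < eta].
  exists ([set x | sqnorm (x - F0.1) < eta], [set x | sqnorm (x - F0.2) < eta]) => /=.
    by split; exact: nbhs_sqnorm.
  by move=> [x y].
apply/seteqP; split=> [F [[F1 F2] [f [s Gs a]]]|_ ->]; last first.
  by split=> //; split; rewrite subrr sqnorm0.
have so : s disc0 = s0 disc0.
  have [//|] := eP s s0 Gs.1 Gs0.1.
  rewrite /hsinh2 (acts_disc0 a) (acts_disc0 a0) sinh2_mobius0// => h.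
  have h1 : sqnorm (F.2 * F0.1 - F0.2 * F.1) <=
      2 * (sqnorm (F.2 - F0.2) * sqnorm F0.1 + sqnorm (F.1 - F0.1) * sqnorm F0.2).
    rewrite -!sqnormM -[sqnorm ((F.1 - F0.1) * _)]sqnormN; apply: le_trans (sqnormD_le _ _).
    by rewrite le_eqVlt; apply/orP; left; apply/eqP; congr sqnorm; ring.
  have h2 : eta <= eps / (2 * m) by rewrite ge_min lexx orbT.
  rewrite ler_pdivlMr ?mulr_gt0// in h2.
  have := sqnorm_ge0 F0.2; have := SU11_sqnorm f0; move: h h1 h2 F1 F2; rewrite /m.
  move: (sqnorm F0.1) (sqnorm F0.2) (sqnorm (F.1 - F0.1)) (sqnorm (F.2 - F0.2)) (sqnorm (F.2 * F0.1 - F0.2 * F.1)).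
  clear => x1 x2 x3 x4 x5 h1 h2 h3 h4 h5 h6 h7.
  have k1 : 0 < (eta - x4) * x1 by rewrite mulr_gt0 ?subr_gt0//; lra.
  have k2 : 0 <= (eta - x3) * x2 by rewrite mulr_ge0// subr_ge0 ltW.
  exfalso; lra.
have ss : s = s0.
  have : (s0^-1 * s)%g = 1%g.
    apply: rotation_stab_disc0.
      by apply: (subgroupM subgroup_Gamma) => //; exact: (subgroupV subgroup_Gamma).
    by rewrite [LHS](_ : _ = bij_inv s0 (s disc0))// so bij_funK.
  by move=> e; rewrite -[LHS](mul1g s) -(mulgV s0) -mulgA e mulg1.
have [|//|e] := @mobius_inj R F F0 f f0.
  by move=> z /disc_ex[x <-]; rewrite -a -a0 ss.
have h1 : eta <= 1 by rewrite ge_min lexx.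
move: F1; rewrite e /= -opprD sqnormN -mulr2n -mulr_natl sqnormM.
rewrite (SU11_sqnorm f0); have := sqnorm_ge0 F0.2.
have -> : sqnorm (2 : C) = 4.
  by apply: complexI; rewrite sqnormE normr_nat -natrX rmorph_nat.
by move=> h2 h3; exfalso; lra.
Qed.

End RotationGroup.

(** * Doubling the polygon across the diameter *)

Section Double.
Context {R : realType} {n : nat}.
Local Notation C := R[i].
Local Notation D := (disc R).
Local Notation d := hsinh2.
Variables (v : 'I_n -> C) (l : 'I_n).
Hypothesis iv : ideal_vertices v.
Hypothesis diam : is_diameter (side v l).
Implicit Types (i j : 'I_n) (y z p : D) (w : seq 'I_n) (h s t : disc_group R).
Local Notation g := (side_form v).
Local Notation sg := (side_reflection v).
Local Notation P := (ideal_polygon v).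
Local Notation H := (reflection_group v).
Local Notation Gamma := (rotation_group v).

(** The reflection in [L] on the whole plane, so that it also acts on ideal vertices; the inversion
    takes this form because the ends of [L] are opposite. *)
Definition mirror (x : C) : C := v l ^+ 2 * x^*.

Lemma mirrorE z : val (sg l z) = mirror (val z).
Proof.
rewrite (sgE iv) (v_opp iv diam) /inversion /mirror subrr !mul0r subr0 sub0r.
have two0 : (2 : C) != 0 by rewrite pnatr_eq0.
by field.
Qed.

Lemma sqnorm_vl2 : sqnorm (v l ^+ 2) = 1.
Proof. by rewrite expr2 sqnormM (sqnormv iv) mulr1. Qed.

Lemma mirrorK x : mirror (mirror x) = x.
Proof.
have e : v l ^+ 2 * (v l ^+ 2)^* = 1.
  by rewrite -normCK -sqnormE sqnorm_vl2.
by rewrite /mirror rmorphM/= conjCK mulrA e mul1r.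
Qed.

Lemma sqnorm_mirror x : sqnorm (mirror x) = sqnorm x.
Proof. by rewrite /mirror sqnormM sqnorm_vl2 mul1r sqnorm_conj. Qed.

Lemma crossM (c x y : C) : cross (c * x) (c * y) = sqnorm c * cross x y.
Proof. by case: c x y => ? ? [? ?] [? ?]; rewrite /cross /sqnorm /=; ring. Qed.

Lemma cross_conj (x y : C) : cross x^* y^* = - cross x y.
Proof. by case: x y => ? ? [? ?]; rewrite /cross /=; ring. Qed.

Lemma cross_mirror (x y : C) : cross (mirror x) (mirror y) = - cross x y.
Proof. by rewrite /mirror crossM sqnorm_vl2 mul1r cross_conj. Qed.

Lemma mirrorB (x y : C) : mirror x - mirror y = mirror (x - y).
Proof. by rewrite /mirror -mulrBr rmorphB. Qed.

Lemma orient_mirror a b c : orient (mirror a) (mirror b) (mirror c) = - orient a b c.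
Proof. by rewrite /orient !mirrorB cross_mirror. Qed.

Lemma crossC (x y : C) : cross y x = - cross x y.
Proof. by rewrite /cross; ring. Qed.

(** The endpoints trade places because the mirror reverses orientation. *)
Lemma nform_mirror a b x : nform (mirror b) (mirror a) x = nform a b (mirror x).
Proof.
have e1 : cross (mirror b) (mirror a) = cross a b by rewrite cross_mirror -crossC.
have e2 : cross (mirror a - mirror b) x = cross (b - a) (mirror x).
  rewrite mirrorB -{1}[x]mirrorK cross_mirror; move: (mirror x) => y; clear.
  by case: a b y => [? ?] [? ?] [? ?]; rewrite /cross /=; ring.
by rewrite /nform /geoform sqnorm_mirror e1 e2.
Qed.

(** Cyclic numbering that starts at [ordS l] and reaches [l] at [n.-1], so that [vshift] runs from
    one end of the diameter to the other. *)
Definition side_index (k : nat) : 'I_n := iter k (@ordS n) (ordS l).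
Definition vshift k := v (side_index k).

Lemma n3 : (3 <= n)%N. Proof. exact: ge3n iv. Qed.

Lemma val_side_index k : val (side_index k) = ((l + k.+1) %% n)%N.
Proof.
rewrite /side_index; elim: k => [|k IH] /=; first by rewrite addn1.
by rewrite IH -[(_ %% n)%N.+1]addn1 modnDml addn1 !addnS.
Qed.

Lemma side_index_small k : (k < n)%N -> val (side_index k) = if (l + k.+1 < n)%N then (l + k.+1)%N else (l + k.+1 - n)%N.
Proof.
move=> kn; rewrite val_side_index; have := ltn_ord l => ll; case: ltnP => h.
  by rewrite modn_small.
by rewrite -{1}(subnK h) modnDr modn_small; lia.
Qed.

Lemma side_index_last : side_index n.-1 = l.
Proof.
have := n3; have := ltn_ord l => ll h; apply: val_inj; rewrite side_index_small; last by lia.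
by case: ltnP => /= *; lia.
Qed.

Lemma side_index_surj i : i != l -> exists2 k, (k < n.-1)%N & side_index k = i.
Proof.
rewrite -val_eqE /= => il; have := n3; have := ltn_ord l; have := ltn_ord i => li ll h.
exists (if (l < i)%N then (i - l.+1)%N else (i + n - l.+1)%N).
  by case: (ltnP l i) => h1; lia.
apply: val_inj; case: (ltnP l i) => h1; rewrite side_index_small; try lia.
  by case: ltnP => h2 /=; lia.
by case: ltnP => h2 /=; lia.
Qed.

Lemma side_index_neq (k : nat) : (k < n.-1)%N -> side_index k != l.
Proof.
move=> kn; rewrite -val_eqE /= side_index_small; last by lia.
by case: (ltnP (l + k.+1) n) => h1 /=; have := ltn_ord l; lia.
Qed.

Lemma orient_vshift (i j k : nat) : (i < j < k)%N -> (k < n)%N -> 0 < orient (vshift i) (vshift j) (vshift k).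
Proof.
move=> ijk kn; have ll := ltn_ord l; rewrite /vshift.
have lt k' : (l + k'.+1 < n)%N -> side_index k' = (l + k'.+1)%N :> nat.
  by move=> h; have /= -> := @side_index_small k' ltac:(lia); rewrite h.
have ge k' : (n <= l + k'.+1)%N -> (k' < n)%N -> side_index k' = (l + k'.+1 - n)%N :> nat.
  by move=> h h'; have /= -> := @side_index_small k' h'; rewrite ltnNge h.
have [ki|ki] := ltnP (l + k.+1) n.
  by apply: (orient_v iv); rewrite !lt; lia.
have [ji|ji] := ltnP (l + j.+1) n.
  by rewrite orient_rot; apply: (orient_v iv); rewrite (lt i) ?(lt j) ?(ge k); lia.
have [ii|ii] := ltnP (l + i.+1) n.
  by rewrite -orient_rot; apply: (orient_v iv); rewrite (lt i) ?(ge j) ?(ge k); lia.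
by apply: (orient_v iv); rewrite !ge; lia.
Qed.

Lemma vshift0E : vshift 0 = - v l.
Proof. exact: v_opp iv diam. Qed.

Lemma vshift_lastE : vshift n.-1 = v l.
Proof. by rewrite /vshift side_index_last. Qed.

Lemma mirror_vl : mirror (v l) = v l.
Proof.
have e : v l * (v l)^* = 1 by rewrite -normCK -sqnormE (sqnormv iv).
by rewrite /mirror expr2 -mulrA e mulr1.
Qed.

Lemma mirror_vshift0 : mirror (vshift 0) = vshift 0.
Proof. by rewrite vshift0E /mirror rmorphN mulrN -/(mirror _) mirror_vl. Qed.

(* Counterclockwise: the vertices of [P] from [- v l] to [v l], then their mirror
   images in reverse order. *)
Definition unfolded (k : nat) : C := if (k < n)%N then vshift k else mirror (vshift (n.-1.*2 - k)).

(** The two branches overlap at [n.-1], because [v l] is on the mirror axis. So each pair of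
    consecutive vertices can be treated within a single branch. *)
Lemma unfolded_mirror k : (n.-1 <= k)%N -> unfolded k = mirror (vshift (n.-1.*2 - k)).
Proof.
rewrite /unfolded leq_eqVlt => /orP[/eqP<-|h].
  rewrite (_ : (n.-1 < n)%N); last by have := n3; lia.
  by rewrite vshift_lastE (_ : (n.-1.*2 - n.-1)%N = n.-1) ?vshift_lastE ?mirror_vl//; lia.
by case: ltnP => //; have := n3; lia.
Qed.

Lemma unfolded_vshift k : (k < n)%N -> unfolded k = vshift k.
Proof. by rewrite /unfolded => ->. Qed.

Lemma sqnorm_unfolded k : sqnorm (unfolded k) = 1.
Proof. by rewrite /unfolded; case: ifP => _; rewrite ?sqnorm_mirror (sqnormv iv). Qed.

Lemma orient_unfolded0 k : (0 < k)%N -> (k.+1 < n.-1.*2)%N -> 0 < orient (unfolded 0) (unfolded k) (unfolded k.+1).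
Proof.
have n3 := n3 => center kN; rewrite (@unfolded_vshift 0); last by lia.
have [kn|kn] := ltnP k.+1 n.
  by rewrite !unfolded_vshift; [apply: orient_vshift; lia|lia|lia].
rewrite -mirror_vshift0 !unfolded_mirror; [|lia|lia].
rewrite orient_mirror -orient_opp -orient_rot; apply: orient_vshift; lia.
Qed.

(** The fan of triangles from vertex [0] has the right orientation, and [cyclic_trans] glues its
    consecutive triangles to any triple containing [0]. Two such triples glue in the same way to an
    arbitrary one. *)
Lemma orient_unfolded (i j k : nat) : (i < j < k)%N -> (k < n.-1.*2)%N ->
  0 < orient (unfolded i) (unfolded j) (unfolded k).
Proof.
move=> /andP[ij jk] kN.
have h0 b c : (0 < b)%N -> (b < c)%N -> (c < n.-1.*2)%N -> 0 < orient (unfolded 0) (unfolded b) (unfolded c).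
  move=> b0; elim: c => [//|c IH]; rewrite ltnS leq_eqVlt => /orP[/eqP<-|bc] cN.
    exact: orient_unfolded0.
  have h1 := IH bc (ltnW cN); have h2 := @orient_unfolded0 c (ltn_trans b0 bc) cN.
  by have [] := cyclic_trans (sqnorm_unfolded _) (sqnorm_unfolded _) (sqnorm_unfolded _) (sqnorm_unfolded _) h1 h2.
case: i ij => [|i] ij; first exact: h0.
have h1 := h0 i.+1 j isT ij (ltn_trans jk kN).
have h2 := h0 j k (leq_ltn_trans (leq0n _) ij) jk kN.
by have [] := cyclic_trans (sqnorm_unfolded _) (sqnorm_unfolded _) (sqnorm_unfolded _) (sqnorm_unfolded _) h1 h2.
Qed.

Definition double_vertex (k : 'I_(n.-1.*2)) : C := unfolded k.
Local Notation wv := double_vertex.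

Lemma ideal_vertices_double : ideal_vertices wv.
Proof.
split; first by have := n3; lia.
  by move=> i; apply/norm_eq1; exact: sqnorm_unfolded.
by move=> i j k ijk; rewrite orientE (ltcR 0); apply: orient_unfolded.
Qed.

Lemma double_vertexS k : wv (ordS k) = unfolded k.+1.
Proof.
rewrite /double_vertex /=; have := ltn_ord k; rewrite leq_eqVlt => /orP[/eqP e|h]; last first.
  by rewrite modn_small.
rewrite e modnn (@unfolded_vshift 0); last by have := n3; lia.
by rewrite unfolded_mirror ?subnn ?mirror_vshift0//; lia.
Qed.

Definition doubled_polygon := P `|` sg l @` P.
Local Notation Omega := doubled_polygon.

(** The mirror image of a point of [P] is on or beyond side [l], hence by [g_sep] on the inner side
    of all the others. Conversely the sign of [g l] tells the two halves apart. *)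
Lemma OmegaE z : Omega z <->
  (forall i, i != l -> 0 <= g i z /\ 0 <= g i (sg l z)).
Proof.
split=> [[/PE Pz|[y /PE Py <-]] i il|hz].
- split=> //; apply: ltW; apply: (g_sep iv il).
  by rewrite (g_sg iv) oppr_le0.
- rewrite (sgK iv); split=> //; apply: ltW; apply: (g_sep iv il).
  by rewrite (g_sg iv) oppr_le0.
have [gl|gl] := leP 0 (g l z).
  by left; apply/PE => i; have [->//|/hz[]] := eqVneq i l.
right; exists (sg l z); last by rewrite (sgK iv).
apply/PE => i; have [->|/hz[]//] := eqVneq i l.
by rewrite (g_sg iv) oppr_ge0 ltW.
Qed.

Lemma nform_unfolded k z : (k < n.-1.*2)%N -> nform (unfolded k) (unfolded k.+1) (val z) =
  if (k < n.-1)%N then g (side_index k) z else g (side_index (n.-1.*2 - k.+1)) (sg l z).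
Proof.
have n3 := n3; move=> kN; case: ltnP => kn.
  by rewrite !unfolded_vshift //; lia.
rewrite !unfolded_mirror; [|lia|lia].
rewrite (_ : (n.-1.*2 - k = (n.-1.*2 - k.+1).+1)%N); last by lia.
by rewrite nform_mirror -mirrorE.
Qed.

Lemma Omega_polygon : Omega = ideal_polygon wv.
Proof.
apply/seteqP; split=> z.
  move=> /OmegaE hz k _; apply/half_planeE; rewrite double_vertexS nform_unfolded//.
  case: ifP => kn; first by have [] := hz _ (side_index_neq kn).
  have kn' : (n.-1.*2 - k.+1 < n.-1)%N by have := n3; have := ltn_ord k; lia.
  by have [] := hz _ (side_index_neq kn').
move=> hz; apply/OmegaE => i /side_index_surj[k kn <-].
have hz' m : (m < n.-1.*2)%N -> 0 <= nform (unfolded m) (unfolded m.+1) (val z).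
  move=> mN; have := hz (Ordinal mN) I.
  by move=> /half_planeE; rewrite double_vertexS.
split.
  by have := hz' k; rewrite nform_unfolded ?kn; [apply|]; lia.
have := hz' (n.-1.*2 - k.+1)%N; rewrite nform_unfolded; last by lia.
have -> : (n.-1.*2 - k.+1 < n.-1)%N = false by lia.
have -> : (n.-1.*2 - (n.-1.*2 - k.+1).+1 = k)%N by lia.
by apply; lia.
Qed.

Lemma Omega_min s z : H s -> Omega z -> sqnorm (val z) <= sqnorm (val (s z)).
Proof.
move=> Hs [Pz|[y Py <-]]; first exact: (sqnorm_min iv diam).
rewrite (sqnorm_sg_l iv diam) [s _](_ : _ = (s * sg l)%g y)//.
apply: (sqnorm_min iv diam) => //; apply: (subgroupM (subgroup_H v)) => //; exact: H_sg.
Qed.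

(** Minimality over [Gamma] extends to [H], because [sg l] preserves the norm. A negative [g i] with
    [i != l] would then allow [sg i] to lower the norm, as [g i] is positive at [0]. *)
Lemma Omega_of_min z : (forall s, Gamma s -> sqnorm (val z) <= sqnorm (val (s z))) ->
  Omega z.
Proof.
move=> hz; have hH s : H s -> sqnorm (val z) <= sqnorm (val (s z)).
  move=> Hs; have [Gs|nG] := pselect (Gamma s); first exact: hz.
  by rewrite -(sqnorm_sg_l iv diam (s z)); exact: hz (Gamma_sg_l l iv Hs nG).
have main i y : i != l -> (forall s, H s -> sqnorm (val y) <= sqnorm (val (s y))) -> 0 <= g i y.
  move=> il hy; rewrite leNgt; apply/negP => lt.
  have := hy (sg i) (@H_sg _ _ v i); rewrite -hsinh2_disc0_le (hsinh2_sg iv) lerDl leNgt.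
  rewrite pmulr_rlt0 ?(refl_coef_gt0 iv)// pmulr_rlt0 ?lt//.
  exact: (g_disc0_gt0 iv diam).
apply/OmegaE => i il; split; apply: main => // s Hs.
rewrite (sqnorm_sg_l iv diam) [s _](_ : _ = (s * sg l)%g z)//.
by apply: hH; apply: (subgroupM (subgroup_H v)) => //; exact: H_sg.
Qed.

End Double.

(** * Fundamental domain and Ford domain *)

Section Topology.
Context {R : realType}.
Local Notation C := R[i].
Local Notation D := (disc R).

Lemma nbhs_subtype (T : topologicalType) (A : set T) (x : A) (U : set A) :
  nbhs x U <-> exists2 V, nbhs (val x) V & forall y : A, V (val y) -> U y.
Proof.
split.
  case=> _ [[B oB <-] Bx BU]; exists B; first exact: open_nbhs_nbhs.
  by move=> y By; apply: BU.
move=> [V + VU]; rewrite nbhsE => -[B [oB Bx] BV].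
exists (val @^-1` B); split=> //; first by exists B.
by move=> y By; apply/VU/BV.
Qed.

Lemma nbhs_C (z : C) (U : set C) :
  nbhs z U <-> exists2 e : R, 0 < e & forall x, sqnorm (x - z) < e -> U x.
Proof.
split; last first.
  by move=> [e e0 eU]; apply: filterS (nbhs_sqnorm z e0) => x; exact: eU.
move=> /nbhs_ballP[e /= e0 eU].
have er : complex.Im e = 0 by apply: ger0_Im; exact: ltW.
have eE : e = (complex.Re e)%:C%C by case: (e) er => a b /= ->.
have r0 : 0 < complex.Re e by rewrite -(ltcR 0) -eE.
exists (complex.Re e ^+ 2); first by rewrite exprn_gt0.
move=> x hx; apply: eU; rewrite /ball /= normE eE ltcR sqnormB.
by rewrite -[X in _ < X](ger0_norm (ltW r0)) -sqrtr_sqr ltr_sqrt ?exprn_gt0.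
Qed.

Lemma nbhs_D (z : D) (U : set D) :
  nbhs z U <-> exists2 e : R, 0 < e & forall x : D, sqnorm (val x - val z) < e -> U x.
Proof.
split.
  move=> /nbhs_subtype[V /nbhs_C[e e0 eV] VU]; exists e => // x hx.
  exact/VU/eV.
move=> [e e0 eU]; apply/nbhs_subtype; exists [set x | sqnorm (x - val z) < e] => //.
exact: nbhs_sqnorm.
Qed.

Lemma Re_continuous : continuous (@complex.Re R).
Proof.
move=> z U /nbhs_ballP[e /= e0 eU]; apply/nbhs_C; exists (e ^+ 2).
  by rewrite exprn_gt0.
move=> x hx; apply: eU; rewrite /ball /= -ltr_sqr ?nnegrE ?(ltW e0)//.
rewrite real_normK ?num_real//; apply: le_lt_trans hx.
by case: z x => [a b] [a' b']; rewrite /sqnorm /=; have := sqr_ge0 (b' - b); lra.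
Qed.

Lemma Im_continuous : continuous (@complex.Im R).
Proof.
move=> z U /nbhs_ballP[e /= e0 eU]; apply/nbhs_C; exists (e ^+ 2).
  by rewrite exprn_gt0.
move=> x hx; apply: eU; rewrite /ball /= -ltr_sqr ?nnegrE ?(ltW e0)//.
rewrite real_normK ?num_real//; apply: le_lt_trans hx.
by case: z x => [a b] [a' b']; rewrite /sqnorm /=; have := sqr_ge0 (a' - a); lra.
Qed.

Lemma continuous_C (T : topologicalType) (f : T -> C) (x : T) :
  {for x, continuous (@complex.Re R \o f)} -> {for x, continuous (@complex.Im R \o f)} ->
  {for x, continuous f}.
Proof.
move=> h1 h2 U /nbhs_C[e e0 eU].
have e2 : 0 < e / 2 by rewrite divr_gt0.
have e3 : 0 < Num.sqrt (e / 2) by rewrite sqrtr_gt0.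
have n1 : nbhs (complex.Re (f x)) [set y | `|complex.Re (f x) - y| < Num.sqrt (e / 2)].
  by apply/nbhs_ballP; exists (Num.sqrt (e / 2)).
have n2 : nbhs (complex.Im (f x)) [set y | `|complex.Im (f x) - y| < Num.sqrt (e / 2)].
  by apply/nbhs_ballP; exists (Num.sqrt (e / 2)).
have m1 : nbhs x [set y | `|complex.Re (f x) - complex.Re (f y)| < Num.sqrt (e / 2)].
  exact: h1 n1.
have m2 : nbhs x [set y | `|complex.Im (f x) - complex.Im (f y)| < Num.sqrt (e / 2)].
  exact: h2 n2.
suff : nbhs x (f @^-1` U) by [].
apply: filterS (filterI m1 m2) => y [/= d1 d2].
apply: eU.
have s (a : R) : `|a| < Num.sqrt (e / 2) -> a ^+ 2 < e / 2.
  move=> h; rewrite -[X in _ < X](sqr_sqrtr (ltW e2)) -(real_normK (num_real a)).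
  by rewrite ltr_sqr ?nnegrE ?sqrtr_ge0.
have := s _ d1; have := s _ d2; rewrite sqnormB; case: (f x) (f y) => [a b] [a' b'].
rewrite /sqnorm /=; lra.
Qed.

Lemma val_continuous (T : topologicalType) (A : set T) : continuous (val : A -> T).
Proof. exact: initial_continuous. Qed.

Lemma continuous_sub (T S : topologicalType) (A : set T) (f : S -> A) (x : S) :
  {for x, continuous (val \o f : S -> T)} -> {for x, continuous f}.
Proof.
move=> h U /nbhs_subtype[V nV VU]; suff : nbhs x (f @^-1` U) by [].
have nV' : nbhs x [set y | V (val (f y))] by exact: h nV.
by apply: filterS nV' => y; exact: VU.
Qed.

Lemma rez_continuous : continuous (fun z : D => complex.Re (val z)).
Proof.
by move=> z; apply: continuous_comp; [exact: val_continuous|exact: Re_continuous].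
Qed.

Lemma imz_continuous : continuous (fun z : D => complex.Im (val z)).
Proof.
by move=> z; apply: continuous_comp; [exact: val_continuous|exact: Im_continuous].
Qed.

Lemma sqnormD_continuous : continuous (fun z : D => sqnorm (val z)).
Proof.
have -> : (fun z : D => sqnorm (val z)) = (fun z : D =>
    complex.Re (val z) * complex.Re (val z) + complex.Im (val z) * complex.Im (val z)).
  by apply/funext => z; rewrite /sqnorm !expr2.
move=> z; exact: (continuousD (continuousM (@rez_continuous z) (@rez_continuous z))
  (continuousM (@imz_continuous z) (@imz_continuous z))).
Qed.

Lemma geoform_continuous u w : continuous (fun z : D => geoform u w (val z)).
Proof.
have cst (a : R) : continuous (fun _ : D => a) by move=> z; exact: cst_continuous.
move=> z; exact: (continuousD
  (continuousM (continuousD (cst 1 z) (@sqnormD_continuous z)) (cst (cross u w) z))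
  (continuousM (cst 2 z) (continuousB
    (continuousM (cst (complex.Re (w - u)) z) (@imz_continuous z))
    (continuousM (cst (complex.Im (w - u)) z) (@rez_continuous z))))).
Qed.

Lemma nform_og_gt0 u w (z : C) : sqnorm z < 1 -> (0 < nform u w z) = (0 < geoform u w z).
Proof. by move=> h; rewrite /nform pmulr_lgt0// invr_gt0 subr_gt0. Qed.

End Topology.

(** * Polygons that are star-shaped about the origin *)

Section StarPolygon.
Context {R : realType} {n : nat}.
Local Notation C := R[i].
Local Notation D := (disc R).
Variable v : 'I_n -> C.
Hypothesis c0 : forall i, 0 < geoform (v i) (v (ordS i)) 0.
Implicit Types (z : D).
Local Notation g := (side_form v).
Local Notation P := (ideal_polygon v).

(** For [z] in the disc, the last factor is positive for [0 <= t < 1] and negative for [t] slightly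
    above [1]. With a positive value at [0], shrinking a point of the polygon makes it interior, and
    stretching a point of a side expels it. *)
Lemma geoform_scale u w (z : C) (t : R) : geoform u w (t%:C%C * z) =
  t * geoform u w z + geoform u w 0 * ((1 - t) * (1 - t * sqnorm z)).
Proof.
by case: u w z => ? ? [? ?] [? ?]; rewrite /geoform /cross /sqnorm /=; ring.
Qed.

Lemma sqnorm_scale (z : C) (t : R) : sqnorm (t%:C%C * z) = t ^+ 2 * sqnorm z.
Proof. by rewrite sqnormM sqnorm_real. Qed.

Lemma sqnorm_scaleB (z : C) (t : R) : sqnorm (t%:C%C * z - z) = (1 - t) ^+ 2 * sqnorm z.
Proof. by rewrite -{2}[z]mul1r -mulrBl sqnormM -[1]/(1%:C%C) -rmorphB sqnorm_real -sqrrN opprB. Qed.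

Lemma polygon_closed : closed P.
Proof.
have -> : P = \bigcap_(i in setT) [set z : D | 0 <= geoform (v i) (v (ordS i)) (val z)].
  apply/seteqP; split=> z; first by move=> /PE h i _ /=; rewrite -nform_og_ge0 ?sqnorm_lt1//; exact: h.
  by move=> h; apply/PE => i; rewrite /side_form nform_og_ge0 ?sqnorm_lt1//; exact: h.
apply: closed_bigI => i _.
have /continuous_closedP h := @geoform_continuous R (v i) (v (ordS i)).
by have := h _ (@closed_ge R 0).
Qed.

Lemma strict_open : open [set z : D | forall i, 0 < g i z].
Proof.
rewrite openE => z hz.
have h i : nbhs z [set x : D | 0 < geoform (v i) (v (ordS i)) (val x)].
  have := hz i; rewrite /side_form nform_og_gt0 ?sqnorm_lt1// => oz.
  have : nbhs (geoform (v i) (v (ordS i)) (val z)) [set x : R | 0 < x].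
    by apply: open_nbhs_nbhs; split=> //; exact: open_gt.
  exact: geoform_continuous.
apply: filterS (filter_forall _ h) => x hx i; rewrite /side_form nform_og_gt0 ?sqnorm_lt1//; exact: hx.
Qed.

Lemma interior_polygon : interior P = [set z : D | forall i, 0 < g i z].
Proof.
apply/seteqP; split=> z /=; last first.
  move=> hz; apply: (@filterS _ _ _ [set z : D | forall i, 0 < g i z]).
    by move=> x hx; apply/PE => i; exact: ltW.
  by apply: open_nbhs_nbhs; split=> //; exact: strict_open.
move=> /[dup] /interior_subset /PE Pz /nbhs_D[e e0 eP] i.
rewrite lt_def Pz andbT; apply/eqP => gz.
have q1 := sqnorm_lt1 z; have q0 := sqnorm_ge0 (val z).
have oz : geoform (v i) (v (ordS i)) (val z) = 0.
  by move/eqP: gz; rewrite mulf_eq0 invr_eq0 subr_eq0 (gt_eqF q1) orbF => /eqP.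
(* Small enough for the stretched point to stay in the disc and in the given neighbourhood. *)
pose dd := Num.min 1 (Num.min (e / 2) ((1 - sqnorm (val z)) / 4)).
have d0 : 0 < dd by rewrite !lt_min ltr01 !divr_gt0// subr_gt0.
have d1 : dd <= 1 by rewrite ge_min lexx.
have d2 : dd <= e / 2 by rewrite !ge_min lexx !orbT.
have d3 : dd <= (1 - sqnorm (val z)) / 4 by rewrite !ge_min lexx !orbT.
have tz1 : sqnorm ((1 + dd)%:C%C * val z) < 1.
  rewrite sqnorm_scale.
  have : (1 + dd) ^+ 2 <= 1 + 3 * dd by nra.
  move=> h; apply: (@le_lt_trans _ _ ((1 + 3 * dd) * sqnorm (val z))).
    exact: ler_wpM2r.
  by nra.
have [x xE] := disc_ex tz1.
have : P x.
  apply: eP; rewrite xE sqnorm_scaleB.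
  have -> : (1 - (1 + dd)) ^+ 2 = dd ^+ 2 by ring.
  have h1 : dd ^+ 2 <= dd by rewrite expr2 ler_piMr// ltW.
  have h2 : dd ^+ 2 * sqnorm (val z) <= dd ^+ 2 by rewrite ler_piMr ?sqr_ge0// ltW.
  by lra.
move=> /PE /(_ i); rewrite /side_form nform_og_ge0 ?sqnorm_lt1// xE geoform_scale oz mulr0 add0r.
rewrite leNgt pmulr_rlt0 ?c0// nmulr_rlt0; last by rewrite subr_lt0 ltrDl.
move=> /negP; apply; rewrite subr_gt0.
by move: tz1; rewrite sqnorm_scale; nra.
Qed.

Lemma scale_interior z t (x : D) : P z -> 0 <= t -> t < 1 ->
  val x = t%:C%C * val z -> forall i, 0 < g i x.
Proof.
move=> /PE Pz t0 t1 xE i; rewrite /side_form nform_og_gt0 ?sqnorm_lt1// xE geoform_scale.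
have := Pz i; rewrite /side_form nform_og_ge0 ?sqnorm_lt1// => oz.
rewrite ltr_wpDl// ?mulr_ge0// mulr_gt0 ?c0// mulr_gt0 ?subr_gt0//.
by have := sqnorm_lt1 z; have := sqnorm_ge0 (val z); nra.
Qed.

Lemma closure_interior_polygon : closure (interior P) = P.
Proof.
apply/seteqP; split.
  rewrite [X in _ `<=` X](iffLR (closure_id P) polygon_closed).
  apply: closure_subset; exact: interior_subset.
move=> z Pz U /nbhs_D[e e0 eU].
pose dd := Num.min 1 (e / 2).
have d0 : 0 < dd by rewrite !lt_min ltr01 !divr_gt0// subr_gt0.
have d1 : dd <= 1 by rewrite ge_min lexx.
have d2 : dd <= e / 2 by rewrite !ge_min lexx !orbT.
have q1 := sqnorm_lt1 z; have q0 := sqnorm_ge0 (val z).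
have tz1 : sqnorm ((1 - dd)%:C%C * val z) < 1.
  by rewrite sqnorm_scale; apply: le_lt_trans q1; rewrite ler_piMl//; nra.
have [x xE] := disc_ex tz1.
exists x; split; last first.
  apply: eU; rewrite xE sqnorm_scaleB.
  have -> : (1 - (1 - dd)) ^+ 2 = dd ^+ 2 by ring.
  have h1 : dd ^+ 2 <= dd by rewrite expr2 ler_piMr// ltW.
  have h2 : dd ^+ 2 * sqnorm (val z) <= dd ^+ 2 by rewrite ler_piMr ?sqr_ge0// ltW.
  by lra.
rewrite interior_polygon; apply: (scale_interior Pz _ _ xE).
  by rewrite subr_ge0.
by rewrite gtrBl.
Qed.

End StarPolygon.

(** * The doubled polygon as fundamental domain and as Ford domain *)

Section FordDomain.
Context {R : realType} {n : nat}.
Local Notation C := R[i].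
Local Notation D := (disc R).
Variables (v : 'I_n -> C) (l : 'I_n).
Hypothesis iv : ideal_vertices v.
Hypothesis diam : is_diameter (side v l).
Implicit Types (i j : 'I_n) (y z p : D) (h s t : disc_group R).
Local Notation g := (side_form v).
Local Notation sg := (side_reflection v).
Local Notation P := (ideal_polygon v).
Local Notation H := (reflection_group v).
Local Notation Gamma := (rotation_group v).
Local Notation Omega := (doubled_polygon v l).
Local Notation wv := (double_vertex v l).

Lemma double_star k : 0 < geoform (wv k) (wv (ordS k)) 0.
Proof.
have z1 : sqnorm (0 : C) < 1 by rewrite sqnorm0.
rewrite -nform_og_gt0// (double_vertexS iv diam) (_ : 0 = val (@disc0 R))// (nform_unfolded iv diam)//.
have n3 := ge3n iv; have kN := ltn_ord k; case: ifP => kn.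
  by apply: (g_disc0_gt0 iv diam); exact: (side_index_neq l kn).
rewrite (sg_diameter_disc0 iv diam); apply: (g_disc0_gt0 iv diam); apply: side_index_neq; lia.
Qed.

Lemma Omega_closed : closed Omega.
Proof. by rewrite (Omega_polygon iv diam); exact: polygon_closed. Qed.

Lemma Omega_closure_interior : closure (interior Omega) = Omega.
Proof.
rewrite (Omega_polygon iv diam); apply: closure_interior_polygon.
exact: double_star.
Qed.

Lemma Omega_interior z : interior Omega z ->
  forall i, i != l -> 0 < g i z /\ 0 < g i (sg l z).
Proof.
rewrite (Omega_polygon iv diam) (interior_polygon double_star) => hz i.
have n3 := ge3n iv; move=> /(side_index_surj iv)[k kn <-].
have hz' m : (m < n.-1.*2)%N -> 0 < nform (unfolded v l m) (unfolded v l m.+1) (val z).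
  move=> mN; have := hz (Ordinal mN).
  by rewrite /side_form (double_vertexS iv diam).
split.
  by have := hz' k; rewrite (nform_unfolded iv diam) ?kn; [apply|]; lia.
have := hz' (n.-1.*2 - k.+1)%N; rewrite (nform_unfolded iv diam); last by lia.
have -> : (n.-1.*2 - k.+1 < n.-1)%N = false by lia.
have -> : (n.-1.*2 - (n.-1.*2 - k.+1).+1 = k)%N by lia.
by apply; lia.
Qed.

Lemma Omega_fold z : Omega z -> exists2 a, a = 1%g \/ a = sg l & P (a z).
Proof.
case=> [Pz|[y Py <-]]; first by exists 1%g; [left|].
by exists (sg l); [right|rewrite (sgK iv)].
Qed.

(** Both points are folded into [P] by [a] and [b], each [1] or [sg l]. By [strict_domain] the
    product [b * s * a] is trivial or a reflection in a side through the folded point; interior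
    points lie on no side but [l]. So [s] is [1] or [sg l], and the latter is not in [Gamma]. *)
Lemma Omega_disjoint s : Gamma s -> s <> 1%g ->
  interior Omega `&` s @` interior Omega = set0.
Proof.
move=> Gs s1; apply/seteqP; split=> // z [iz [y iy zE]]; apply: s1; rewrite -{z}zE in iz.
have [a ha Pa] := Omega_fold (interior_subset iy).
have [b hb Pb] := Omega_fold (interior_subset iz).
have aa : (a * a = 1)%g by case: ha => ->; rewrite ?mulg1 ?(sg2 iv).
have bb : (b * b = 1)%g by case: hb => ->; rewrite ?mulg1 ?(sg2 iv).
have Hx c : c = 1%g \/ c = sg l -> H c.
  by case=> ->; [exact: subgroup1 (subgroup_H v)|exact: H_sg].
have HM := subgroupM (subgroup_H v).
have Hw : H (b * s * a)%g.
  by apply: (HM); [apply: (HM); [exact: Hx|exact: Gs.1]|exact: Hx].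
have [w rw wE] := H_word iv Hw.
have Pw : P (word_val v w (a y)).
  rewrite -wE [X in P X](_ : _ = b (s ((a * a)%g y)))//.
  by rewrite aa.
have [_ hw] := strict_domain iv rw Pa Pw.
have hx : (b * s * a)%g = 1%g \/ (b * s * a)%g = sg l.
  case: hw => [w0|[i wi gi]]; first by left; rewrite wE w0 /word_val big_nil.
  have [il|il] := eqVneq i l; first by right; rewrite wE wi /word_val big_seq1 il.
  have [g1 g2] := Omega_interior iy il.
  by move: gi; case: ha => -> gi; [move: g1|move: g2]; rewrite gi ltxx.
have sE : s = (b * (b * s * a) * a)%g.
  by rewrite !mulgA bb mul1g -mulgA aa mulg1.
have : s = 1%g \/ s = sg l.
  rewrite sE; case: hx => ->; case: ha => ->; case: hb => ->;
  rewrite ?mulg1 ?mul1g ?(sg2 iv) ?mul1g ?mulg1 -?mulgA ?(sg2 iv) ?mulg1; by [left|right].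
by case=> // e; case: (@not_Gamma_sg _ _ _ iv l); rewrite -e.
Qed.

Lemma Omega_cover : \bigcup_(s in Gamma) s @` Omega = setT.
Proof.
apply/seteqP; split=> // z _.
have [h Hh Ph] := H_cover iv diam z.
have GV := subgroupV (subgroup_Gamma v).
have [Gh|nG] := pselect (Gamma h).
  exists (h^-1)%g; first exact: GV.
  exists (h z); first by left.
  exact: bij_funK.
exists ((sg l * h)^-1)%g; first by apply: GV; exact: Gamma_sg_l.
exists ((sg l * h)%g z); first by right; exists (h z).
exact: bij_funK.
Qed.

Lemma fundamental_Omega : fundamental_domain Gamma Omega.
Proof.
split; [exact: Omega_closed|exact: Omega_closure_interior|exact: Omega_cover|].
exact: Omega_disjoint.
Qed.

(** A compact set stays in a disc [sqnorm z <= r] with [r < 1]. But [P] contains the points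
    [t * v l] on the diameter, which approach the circle and have minimal norm in their orbits, so
    translates of the set miss some of them. *)
Lemma not_compact A : fundamental_domain Gamma A -> ~ compact A.
Proof.
move=> [_ _ Acov _] cA.
pose f (z : D) : R := (1 - sqnorm (val z))^-1.
have fc : continuous f.
  move=> z; have cst (a : R) : continuous (fun _ : D => a) by move=> x; exact: cst_continuous.
  have q : 1 - sqnorm (val z) != 0 by rewrite subr_eq0 eq_sym lt_eqF// sqnorm_lt1.
  exact (@continuousV _ _ (fun z : D => 1 - sqnorm (val z)) z q (continuousB (cst 1 z) (@sqnormD_continuous R z))).
have cf : compact (f @` A) by apply: continuous_compact => //; exact: continuous_subspaceT.
have [M [_ hM]] := compact_bounded cf.
pose K := Num.max 1 (M + 1).
have KM : M < K by rewrite lt_max ltrDl ltr01 orbT.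
have K1 : 1 <= K by rewrite le_max lexx.
have fK z : A z -> sqnorm (val z) <= 1 - K^-1.
  move=> Az; have := hM K KM (f z) (ex_intro2 _ _ z Az erefl).
  have q : 0 < 1 - sqnorm (val z) by rewrite subr_gt0 sqnorm_lt1.
  have K0 : 0 < K by rewrite (lt_le_trans _ K1).
  rewrite /= ger0_norm /f ?invr_ge0 ?(ltW q)// => h.
  rewrite lerBrDr -lerBrDl -(invrK (1 - _)) lef_pV2// posrE ?invr_gt0//.
pose r := 1 - K^-1.
have r1 : r < 1 by rewrite ltrBlDr ltrDl invr_gt0 (lt_le_trans _ K1).
have r0 : 0 <= r by rewrite subr_ge0 invf_le1 ?(lt_le_trans _ K1).
(* As [t] is the arithmetic mean of [1] and [r], its square exceeds [r], by [(1 - r)^2 > 0]. *)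
pose t : R := (1 + r) / 2.
have t1 : t < 1 by rewrite /t; lra.
have t0 : 0 <= t by rewrite /t; lra.
have tr : r < t ^+ 2 by rewrite /t; nra.
have tz1 : sqnorm (t%:C%C * v l) < 1 by rewrite sqnorm_scale (sqnormv iv) mulr1; nra.
have [z zE] := disc_ex tz1.
have Pz : P z.
  apply/PE => i; rewrite /side_form nform_og_ge0 ?sqnorm_lt1// zE geoform_scale.
  have hc : 0 <= geoform (v i) (v (ordS i)) 0.
    by have := g_disc0_ge0 iv diam i; rewrite /side_form nform_og_ge0 ?sqnorm0.
  rewrite addr_ge0// mulr_ge0//.
    rewrite geoform_klein; apply: mulr_ge0; first by rewrite ltW ?one_sqnorm_gt0.
    rewrite /klein (sqnormv iv) (_ : 2 / (1 + 1) = 1); last by field.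
    by rewrite rmorph1 mul1r (side_ge0 iv).
  by rewrite (sqnormv iv) mulr1 -expr2 sqr_ge0.
have [s Gs [y Ay e]] : (\bigcup_(s in Gamma) s @` A) z by rewrite Acov.
have := sqnorm_min iv diam (subgroupV (subgroup_Gamma v) Gs).1 Pz.
have -> : (s^-1)%g z = y by rewrite -e; exact: bij_funK.
rewrite zE sqnorm_scale (sqnormv iv) mulr1 => h.
by have := fK y Ay; rewrite -/r; lra.
Qed.

(** The disc is where [|F.2 * z + conj F.1| < 1], and [1 - |F z|^2] is [1 - |z|^2] divided by the
    square of this modulus. *)
Lemma isometric_discE F s z : SU11 F -> acts_by s F -> F.2 != 0 ->
  isometric_disc F z <-> sqnorm (val (s z)) < sqnorm (val z).
Proof.
move=> f a F2; rewrite /isometric_disc /=.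
have -> : val z - - F.1^* / F.2 = (F.2 * val z + F.1^*) / F.2 by field.
rewrite normrM normfV ltr_pdivrMr ?normr_gt0// mulVf ?normr_eq0// norm_lt1 a.
have q1 := sqnorm_lt1 z.
have h := sqnorm_mobius f q1.
have d0 : 0 < sqnorm (F.2 * val z + F.1^*).
  by rewrite lt_def sqnorm_ge0 sqnorm_eq0 (mobius_den f q1).
have e : (1 - sqnorm (mobius F (val z))) * sqnorm (F.2 * val z + F.1^*) = 1 - sqnorm (val z).
  by rewrite h divfK// gt_eqF.
have m1 := sqnorm_mobius_lt1 f q1.
by move: e d0 q1 m1; clear; move: (sqnorm _) (sqnorm _) (sqnorm _) => x1 x2 x3 *; split=> ?; nra.
Qed.

Lemma ford_Omega : is_ford_domain Gamma Omega.
Proof.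
split.
  move=> s z Gs z0 sz; apply: (rotation_stab_disc0 iv diam Gs).
  by have -> : disc0 = z by apply: val_inj; rewrite z0.
rewrite /ford_domain [X in closure X](_ : _ = Omega).
  by apply/closure_id; exact: Omega_closed.
apply/seteqP; split=> z.
  move=> hz; apply: (Omega_of_min iv diam) => s Gs; rewrite leNgt; apply/negP => lt.
  have s1 : s <> 1%g by move=> e; move: lt; rewrite e ltxx.
  have [_ [F f a]] := Gs; apply: hz; exists F.
    by split=> //; exists s.
  apply/(isometric_discE z f a) => //; apply/eqP => F2; apply: s1.
  apply: (rotation_stab_disc0 iv diam Gs); apply: val_inj; rewrite (acts_disc0 a) mobius0 F2.
  by rewrite rmorph0 mul0r.
move=> Oz [F [f [s [Gs s1] a]]].
(* For [F.2 = 0] the radius is the inverse of [0], which is [0], so the isometric disc is empty. *)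
have [F2|F2] := eqVneq F.2 0.
  by rewrite /isometric_disc /= F2 normr0 !invr0 normr_lt0.
move=> /(isometric_discE z f a F2); rewrite ltNge => /negP; apply.
exact: (Omega_min iv diam Gs.1).
Qed.

End FordDomain.

(** * Area *)

Section PolygonGeometry.
Context {R : realType} {n : nat}.
Local Notation C := R[i].
Variable v : 'I_n -> C.
Hypothesis iv : ideal_vertices v.
Implicit Types (i j : 'I_n) (z k : C).

(** The sign of [orient (v (u 0)) (v (u m)) k] goes from nonnegative at [m = 1] to nonpositive at
    [m = n.-1]; where it changes, [k] lies in a triangle of the fan from [u 0]. *)
Lemma triangulate k : (forall i, 0 <= orient (v i) (v (ordS i)) k) ->
  exists a b c : 'I_n, [/\ 0 < orient (v a) (v b) (v c), 0 <= orient (v a) (v b) k,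
    0 <= orient (v b) (v c) k & 0 <= orient (v c) (v a) k].
Proof.
move=> hk; have n3 := ge3n iv.
have lt : (n.-1 < n)%N by lia.
pose l := Ordinal lt; pose u := side_index l.
have side m : 0 <= orient (v (u m)) (v (u m.+1)) k by exact: hk.
have uL : v (u n.-1) = v l by rewrite /u (side_index_last l iv).
have top : orient (v (u 0)) (v (u n.-1)) k <= 0.
  by rewrite uL orient_opp oppr_le0; exact: hk.
have [m [m1 mn hm hm']] : exists m, [/\ (0 < m)%N, (m.+1 < n)%N,
    0 <= orient (v (u 0)) (v (u m)) k & orient (v (u 0)) (v (u m.+1)) k <= 0].
  have : forall m, (1 < m)%N -> (m < n)%N -> orient (v (u 0)) (v (u m)) k <= 0 ->
    exists m, [/\ (0 < m)%N, (m.+1 < n)%N,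
      0 <= orient (v (u 0)) (v (u m)) k & orient (v (u 0)) (v (u m.+1)) k <= 0].
    elim=> [//|[//|m] IH] _ mn hm.
    have [ge|/ltW le] := leP 0 (orient (v (u 0)) (v (u m.+1)) k).
      by exists m.+1.
    case: m IH mn hm le => [|m] IH mn hm le; first by exists 1%N; split=> //; exact: side.
    by apply: IH => //; exact: ltnW.
  by move=> h; apply: (h n.-1 _ _ top); lia.
exists (u 0), (u m), (u m.+1); split=> //.
  by apply: (orient_vshift l iv); lia.
by rewrite orient_opp oppr_ge0.
Qed.

(** In a triangle containing [k], [1 - sqnorm k] is the mean of [1 - dot (v i) k] over the three
    corners, weighted by the barycentric coordinates of [k]. One weight is at least [1/3], which
    gives the constant. *)
Lemma polygon_vertex k : (forall i, 0 <= orient (v i) (v (ordS i)) k) ->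
  exists i, 0 <= 1 - dot (v i) k <= 3 * (1 - sqnorm k).
Proof.
move=> /triangulate[a [b [c [h0 h1 h2 h3]]]].
have es : orient (v b) (v c) k + orient (v c) (v a) k + orient (v a) (v b) k =
    orient (v a) (v b) (v c).
  by clear; case: (v a) (v b) (v c) k => ? ? [? ?] [? ?] [? ?]; rewrite /orient /cross /=; ring.
have e1 : (1 - dot (v a) k) * orient (v a) (v b) (v c) =
    orient (v c) (v a) k * (1 - dot (v a) (v b)) + orient (v a) (v b) k * (1 - dot (v a) (v c)).
  by rewrite dot_bary dot_self (sqnormv iv) subrr mulr0 add0r.
have e2 : (1 - dot (v b) k) * orient (v a) (v b) (v c) =
    orient (v b) (v c) k * (1 - dot (v a) (v b)) + orient (v a) (v b) k * (1 - dot (v b) (v c)).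
  by rewrite dot_bary dot_self (sqnormv iv) subrr mulr0 addr0 (dotC (v b) (v a)).
have e3 : (1 - dot (v c) k) * orient (v a) (v b) (v c) =
    orient (v b) (v c) k * (1 - dot (v a) (v c)) + orient (v c) (v a) k * (1 - dot (v b) (v c)).
  by rewrite dot_bary dot_self (sqnormv iv) subrr mulr0 addr0 !(dotC (v c)).
have e4 : (1 - sqnorm k) * orient (v a) (v b) (v c) = orient (v b) (v c) k * (1 - dot (v a) k) +
    orient (v c) (v a) k * (1 - dot (v b) k) + orient (v a) (v b) k * (1 - dot (v c) k).
  by rewrite -dot_self dot_bary !(dotC k).
have dle i j : 0 <= 1 - dot (v i) (v j) by apply: dot_le1; rewrite (sqnormv iv).
have dab := dle a b; have dac := dle a c; have dbc := dle b c.
have p0 x y : 0 <= x * y -> 0 < y -> 0 <= x :> R by move=> h y0; rewrite -(pmulr_lge0 _ y0).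
have pa : 0 <= 1 - dot (v a) k by apply: (p0 _ _ _ h0); rewrite e1 addr_ge0 ?mulr_ge0.
have pb : 0 <= 1 - dot (v b) k by apply: (p0 _ _ _ h0); rewrite e2 addr_ge0 ?mulr_ge0.
have pc : 0 <= 1 - dot (v c) k by apply: (p0 _ _ _ h0); rewrite e3 addr_ge0 ?mulr_ge0.
have main (x y s px py pz : R) : 0 <= y -> 0 <= s -> 0 <= px -> 0 <= py -> 0 <= pz ->
    x + y + s = orient (v a) (v b) (v c) -> y <= x -> s <= x ->
    (1 - sqnorm k) * orient (v a) (v b) (v c) = x * px + y * py + s * pz -> px <= 3 * (1 - sqnorm k).
  clear -h0; move=> y0 z0 px0 py0 pz0 ss yx zx e.
  rewrite -(ler_pM2r h0) -mulrA e -ss.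
  have := mulr_ge0 y0 py0; have := mulr_ge0 z0 pz0.
  have : y * px <= x * px by exact: ler_wpM2r.
  have : s * px <= x * px by exact: ler_wpM2r.
  by lra.
move: h1 h2 h3 es e4 pa pb pc main; clear e1 e2 e3.
move: (orient (v a) (v b) k) (orient (v b) (v c) k) (orient (v c) (v a) k) => z x y z0 x0 y0 es e4 pa pb pc main.
have [xy|/ltW xy] := leP y x.
  have [xz|/ltW xz] := leP z x.
    by exists a; rewrite pa (main x y z _ _ _ y0 z0 pa pb pc es xy xz e4).
  exists c; rewrite pc/=.
  apply: (main z x y _ _ _ x0 y0 pc pa pb); rewrite ?e4 -?es; try lra.
have [xz|/ltW xz] := leP z y.
  exists b; rewrite pb/=.
  by apply: (main y x z _ _ _ x0 z0 pb pa pc); rewrite ?e4 -?es; lra.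
exists c; rewrite pc/=.
by apply: (main z x y _ _ _ x0 y0 pc pa pb); rewrite ?e4 -?es; lra.
Qed.

Lemma ideal_point k : (forall i, 0 <= orient (v i) (v (ordS i)) k) ->
  sqnorm k < 1 \/ exists i, k = v i.
Proof.
move=> hk; have [i /andP[h0 h1]] := polygon_vertex hk.
have [|ge] := ltP (sqnorm k) 1; first by left.
right; exists i; apply/esym/eqP; rewrite -[_ == _]negbK; apply/negP => ne.
have k1 : sqnorm k = 1 by apply/eqP; rewrite eq_le ge andbT -subr_ge0; nra.
have := @dot_lt1 R (v i) k; rewrite (sqnormv iv) k1 lexx ne => /(_ isT isT isT).
by move: h1; rewrite k1; nra.
Qed.

Lemma one_sub_dot_klein (a z : C) : sqnorm a = 1 ->
  1 - dot a (klein z) = sqnorm (z - a) / (1 + sqnorm z).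
Proof.
move=> a1; have := one_sqnorm_gt0 z => z0.
have -> : 1 - dot a (klein z) = (sqnorm a + sqnorm z - 2 * dot a z) / (1 + sqnorm z).
  rewrite /klein a1; move: z0; case: a z {a1} => [a1 a2] [z1 z2].
  move: (sqnorm _) => N N0; rewrite /dot /=; field; by rewrite gt_eqF.
by congr (_ / _); case: a z {a1 z0} => [a1 a2] [z1 z2]; rewrite /dot /sqnorm /=; ring.
Qed.

(** For [k = klein z], [1 - sqnorm k] is the square of a multiple of [1 - sqnorm z], while
    [1 - dot (v i) k] is a multiple of [sqnorm (z - v i)]; so both sides are quadratic. *)
Lemma cusp_vertex z : sqnorm z < 1 -> (forall i, 0 <= nform (v i) (v (ordS i)) z) ->
  exists i, sqnorm (z - v i) <= 3 * (1 - sqnorm z) ^+ 2.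
Proof.
move=> z1 hz; have hk i : 0 <= orient (v i) (v (ordS i)) (klein z).
  by rewrite -nform_ge0.
have [i /andP[_ h]] := polygon_vertex hk; exists i.
have z0 := sqnorm_ge0 z.
move: h; rewrite (one_sub_dot_klein _ (sqnormv iv i)) one_sub_klein ler_pdivrMr ?one_sqnorm_gt0//.
have p0 := one_sqnorm_gt0 z.
rewrite (_ : 3 * _ * _ = 3 * (1 - sqnorm z) ^+ 2 / (1 + sqnorm z)); last first.
  by field; rewrite gt_eqF.
move=> h; apply: (le_trans h); rewrite ler_pdivrMr//.
have X0 : 0 <= 3 * (1 - sqnorm z) ^+ 2 by apply: mulr_ge0 => //; exact: sqr_ge0.
by rewrite ler_peMr// lerDl.
Qed.

(** The two sides ending at [v i] are tangent there to the radius. Expanded about [v i], their forms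
    are a multiple of [cross (v i) z] plus a multiple of [sqnorm (z - v i)], with opposite signs of
    the first multiple, and so bound [cross (v i) z] from both sides. *)
Lemma cusp_sliver : exists2 K : R, 1 <= K & forall i z, sqnorm z < 1 ->
  (forall j, 0 <= nform (v j) (v (ordS j)) z) ->
  `|cross (v i) z| <= K * sqnorm (z - v i).
Proof.
pose q i := (2 * (1 - dot (v i) (v (ordS i))))^-1.
have d0 i : 0 < 2 * (1 - dot (v i) (v (ordS i))).
  by rewrite mulr_gt0// dot_lt1 ?(sqnormv iv) ?(side_neq iv).
have q0 i : 0 < q i by rewrite invr_gt0.
exists (1 + \sum_i q i); first by rewrite lerDl sumr_ge0// => i _; exact: ltW.
have qle i : q i <= 1 + \sum_i q i.
  by rewrite (bigD1 i)//= addrCA lerDl addr_ge0// sumr_ge0// => j _; exact: ltW.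
move=> i z z1 hz.
have N0 := sqnorm_ge0 (z - v i).
have cross1 (a b : C) : sqnorm a = 1 -> sqnorm b = 1 -> `|cross a b| <= 1.
  move=> a1 b1; rewrite -(@ler_pXn2r _ 2) ?nnegrE// expr1n real_normK ?num_real//.
  have : dot a b ^+ 2 + cross a b ^+ 2 = sqnorm a * sqnorm b.
    by clear; case: a b => [? ?] [? ?]; rewrite /dot /cross /sqnorm /=; ring.
  by rewrite a1 b1; have := sqr_ge0 (dot a b); lra.
have side (a b : C) : sqnorm a = 1 -> sqnorm b = 1 ->
    geoform a b z = cross a b * sqnorm (z - a) - 2 * (1 - dot a b) * cross a z /\
    geoform a b z = cross a b * sqnorm (z - b) + 2 * (1 - dot a b) * cross b z.
  move=> a1 b1; split.
    (* The added zero is a multiple of [1 - sqnorm a], which turns the claim into a polynomial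
       identity. *)
    rewrite -[LHS]addr0 -(mulr0 (cross a b + 2 * cross b z)) -(subrr 1) -{2}a1.
    by clear; case: a b z => [? ?] [? ?] [? ?]; rewrite /geoform /dot /cross /sqnorm /=; ring.
  rewrite -[LHS]addr0 -(mulr0 (cross a b - 2 * cross a z)) -(subrr 1) -{2}b1.
  by clear; case: a b z => [? ?] [? ?] [? ?]; rewrite /geoform /dot /cross /sqnorm /=; ring.
have bound (e d t : R) : `|e| <= 1 -> 0 < d -> 0 <= e * sqnorm (z - v i) - d * t ->
    t <= d^-1 * sqnorm (z - v i).
  move=> e1 d1 h; rewrite mulrC ler_pdivlMr// mulrC.
  have : e * sqnorm (z - v i) <= 1 * sqnorm (z - v i).
    by apply: ler_wpM2r => //; exact: le_trans (ler_norm e) e1.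
  by lra.
rewrite ler_norml lerNl; apply/andP; split.
  have [h1 h2] := side (v (ord_pred i)) (v i) (sqnormv iv _) (sqnormv iv _).
  have := hz (ord_pred i); rewrite ord_predK nform_og_ge0// h2 => h.
  apply: le_trans (ler_wpM2r N0 (qle (ord_pred i))); rewrite /q ord_predK.
  apply: (bound (cross (v (ord_pred i)) (v i))).
  - by apply: cross1; exact: (sqnormv iv).
  - by rewrite -{2}(ord_predK i).
  - by rewrite mulrN opprK.
have [h1 h2] := side (v i) (v (ordS i)) (sqnormv iv _) (sqnormv iv _).
have := hz i; rewrite nform_og_ge0// h1 => h.
apply: le_trans (ler_wpM2r N0 (qle i)).
by apply: (bound (cross (v i) (v (ordS i)))) => //; apply: cross1; exact: (sqnormv iv).
Qed.

End PolygonGeometry.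

(** * Integrability over a model cusp *)

Section CuspMeasure.
Context {R : realType}.
Local Notation mu := (@lebesgue_measure R).

Lemma inv_measurable : measurable_fun setT (fun x : R => x^-1).
Proof.
have -> : [set: R] = [set 0] `|` [set x | x != 0].
  apply/seteqP; split=> // x _ /=.
  by have [->|x0] := eqVneq x 0; [left|right].
apply/measurable_funU => //.
  by apply: open_measurable; exact: open_neq.
split; first exact: measurable_fun_set1.
apply: open_continuous_measurable_fun; first exact: open_neq.
by move=> x; rewrite inE /= => x0; exact: inv_continuous.
Qed.

Variables (p q a K : R).
Hypotheses (p0 : p != 0) (K0 : 0 <= K).

(** In the applications [(p, q)] is an ideal vertex, possibly with its coordinates exchanged, and
    [a = p]; the second condition bounds the distance to the line through [0] and that vertex. *)
Definition cusp_region : set (R * R) :=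
  [set z | `|z.1| <= 1 /\ `|p * z.2 - q * z.1| <= K * (z.1 - a) ^+ 2].

(* Dominates the hyperbolic density in a sliver ending at a point of the circle
   with first coordinate [a]; the junk value at [z.1 = a] is harmless. *)
Definition cusp_density (z : R * R) : R := 12 / (z.1 - a) ^+ 2 * \1_cusp_region z.

(** A slice has length at most [2 * K * (s - a)^2 / |p|], against the density [12 / (s - a)^2]; the
    product does not depend on [s]. *)
Let M : R := 24 * K / `|p|.

Lemma cusp_density_ge0 z : 0 <= cusp_density z.
Proof.
by rewrite mulr_ge0// divr_ge0// sqr_ge0.
Qed.

Lemma measurable_cusp_region : measurable cusp_region.
Proof.
have -> : cusp_region = [set z | `|z.1| <= 1] `&`
    [set z | `|p * z.2 - q * z.1| <= K * (z.1 - a) ^+ 2] by [].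
have m1 : measurable_fun setT (fun z : R * R => z.1) by exact: measurable_fst.
have m2 : measurable_fun setT (fun z : R * R => z.2) by exact: measurable_snd.
have le (f h : R * R -> R) : measurable_fun setT f -> measurable_fun setT h ->
    measurable [set z | f z <= h z].
  move=> mf mh; have := measurable_fun_ler mf mh.
  move=> /(_ measurableT [set true] I); rewrite setTI.
  rewrite (_ : _ @^-1` _ = [set z | f z <= h z])//.
apply: measurableI; apply: le.
- by apply: measurableT_comp => //; exact: normr_measurable.
- exact: measurable_cst.
- apply: measurableT_comp; first exact: normr_measurable.
  by apply: measurable_funB; apply: measurable_funM => //; exact: measurable_cst.
- apply: measurable_funM; first exact: measurable_cst.
  by apply: measurable_funX; apply: measurable_funB => //; exact: measurable_cst.
Qed.

Lemma measurable_cusp_density : measurable_fun setT cusp_density.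
Proof.
apply: measurable_funM; last by apply: measurable_indic; exact measurable_cusp_region.
apply: measurable_funM; first exact: measurable_cst.
apply: (measurableT_comp inv_measurable).
apply: measurable_funX; apply: measurable_funB; last exact: measurable_cst.
exact: measurable_fst.
Qed.

Lemma slice_int s :
  (\int[mu]_t (cusp_density (s, t))%:E <= (M * \1_(`[-1, 1]%classic) s)%:E)%E.
Proof.
have c0 : 0 <= 12 / (s - a) ^+ 2 by rewrite divr_ge0// sqr_ge0.
have [s1|s1] := boolP (s \in `[-1, 1]); last first.
  rewrite integral0_eq; last first.
    move=> t _; rewrite /cusp_density indicE memNset ?mulr0// => -[/= h _].
    by move/negP: s1; apply; rewrite in_itv/= -ler_norml.
  by rewrite lee_fin mulr_ge0// /M divr_ge0// mulr_ge0.
pose m := q * s / p; pose r := K * (s - a) ^+ 2 / `|p|.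
pose I : set R := `[m - r, m + r]%classic.
have r0 : 0 <= r by rewrite divr_ge0// mulr_ge0// sqr_ge0.
have mI : measurable I by exact: measurable_itv.
apply: (@le_trans _ _ (\int[mu]_t ((12 / (s - a) ^+ 2)%:E * (\1_I t)%:E)%E)%E).
  apply: ge0_le_integral => //.
  - by move=> t _; rewrite lee_fin; exact: cusp_density_ge0.
  - apply/measurable_EFinP; apply: (measurableT_comp measurable_cusp_density).
    exact: pair1_measurable.
  - by apply/measurable_EFinP; apply: measurable_funM; [exact: measurable_cst|exact: measurable_indic].
  move=> t _; rewrite /cusp_density -EFinM lee_fin ler_wpM2l//= !indicE.
  case: (boolP (_ \in cusp_region)) => [|_]; last by rewrite ler0n.
  rewrite inE => -[/= _ h]; rewrite mem_set//.
  rewrite /I /= in_itv/= -ler_distl /r /m.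
  rewrite (_ : t - q * s / p = (p * t - q * s) / p); last by field.
  by rewrite normrM normfV ler_pM2r// invr_gt0 normr_gt0.
rewrite ge0_integralZl_EFin//; last by apply/measurable_EFinP/measurable_indic.
rewrite integral_indic// setIT /I /= lebesgue_measure_itv/=.
rewrite indicE mem_set// mulr1.
case: ifP => _; last first.
  by rewrite mule0 lee_fin /M divr_ge0// mulr_ge0.
rewrite -EFinD -EFinM lee_fin /M /r.
(* At [s = a] division by zero makes the density vanish, so the bound still holds. *)
have [->|sa] := eqVneq s a.
  by rewrite subrr expr0n/= invr0 mulr0 mul0r divr_ge0// mulr_ge0.
rewrite le_eqVlt; apply/orP; left; apply/eqP; field.
by rewrite normr_eq0 p0 subr_eq0 sa.
Qed.

Let int_bound : (\int[mu]_s (M * \1_(`[-1, 1]%classic) s)%:E < +oo)%E.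
Proof.
under eq_integral do rewrite EFinM.
rewrite ge0_integralZl_EFin//; first last.
- by rewrite /M divr_ge0// mulr_ge0.
- by apply/measurable_EFinP/measurable_indic.
rewrite integral_indic// setIT /= lebesgue_measure_itv/=.
by case: ifP => _; rewrite ?mule0 ?ltry//.
Qed.

Lemma cusp_density_int1 : (\int[(mu \x mu)%E]_z (cusp_density z)%:E < +oo)%E.
Proof.
have mE : measurable_fun setT (fun z => (cusp_density z)%:E).
  by apply/measurable_EFinP; exact: measurable_cusp_density.
have gE z : (0 <= (cusp_density z)%:E)%E by rewrite lee_fin; exact: cusp_density_ge0.
apply: (@le_lt_trans _ _ (\int[mu]_s \int[mu]_t (cusp_density (s, t))%:E)%E).
  rewrite le_eqVlt; apply/orP; left; apply/eqP; exact: (@fubini_tonelli1 _ _ _ _ R mu mu _ mE gE).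
apply: le_lt_trans int_bound; apply: ge0_le_integral => //.
- by move=> s _; apply: integral_ge0 => t _; exact: gE.
- exact: (@measurable_fun_fubini_tonelli_F _ _ _ _ R mu _ mE gE).
- by apply/measurable_EFinP; apply: measurable_funM; [exact: measurable_cst|exact: measurable_indic].
by move=> s _; exact: slice_int.
Qed.

(** Slices in the other direction, for vertices near the second axis, whose first coordinate may be
    [0]. *)
Definition cusp_density_swap (z : R * R) : R := cusp_density (z.2, z.1).

Lemma measurable_cusp_density_swap : measurable_fun setT cusp_density_swap.
Proof.
apply: (measurableT_comp measurable_cusp_density).
by apply: measurable_fun_pair; [exact: measurable_snd|exact: measurable_fst].
Qed.

Lemma cusp_density_int2 : (\int[(mu \x mu)%E]_z (cusp_density_swap z)%:E < +oo)%E.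
Proof.
have mE : measurable_fun setT (fun z => (cusp_density_swap z)%:E).
  by apply/measurable_EFinP; exact: measurable_cusp_density_swap.
have gE z : (0 <= (cusp_density_swap z)%:E)%E by rewrite lee_fin; exact: cusp_density_ge0.
apply: (@le_lt_trans _ _ (\int[mu]_s \int[mu]_t (cusp_density_swap (t, s))%:E)%E).
  by rewrite le_eqVlt; apply/orP; left; apply/eqP; exact: (@fubini_tonelli2 _ _ _ _ R mu mu _ mE gE).
apply: le_lt_trans int_bound; apply: ge0_le_integral => //.
- by move=> s _; apply: integral_ge0 => t _; exact: gE.
- exact: (@measurable_fun_fubini_tonelli_G _ _ _ _ R mu _ mE gE).
- by apply/measurable_EFinP; apply: measurable_funM; [exact: measurable_cst|exact: measurable_indic].
by move=> s _; exact: slice_int.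
Qed.

End CuspMeasure.

(** * Finite area of ideal polygons *)

Section Area.
Context {R : realType} {n : nat}.
Local Notation C := R[i].
Local Notation D := (disc R).
Variable v : 'I_n -> C.
Hypothesis iv : ideal_vertices v.
Implicit Types (i j : 'I_n) (z : C).
Local Notation mu := (@lebesgue_measure R).

(** [r] and [t] are the radial and the transversal offset from the vertex. Close to the vertex the
    sliver condition gives [16 * t^2 <= r^2 + t^2], so the offset is nearly radial, and
    [w1^2 >= 1/2] makes its first coordinate comparable to its length. *)
Lemma sliver_width (K w1 w2 x y : R) : w1 ^+ 2 + w2 ^+ 2 = 1 ->
  1 <= K -> `|w1 * y - w2 * x| <= K * ((x - w1) ^+ 2 + (y - w2) ^+ 2) ->
  (x - w1) ^+ 2 + (y - w2) ^+ 2 <= (16 * K ^+ 2)^-1 -> 2^-1 <= w1 ^+ 2 ->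
  (x - w1) ^+ 2 + (y - w2) ^+ 2 <= 9 * (x - w1) ^+ 2.
Proof.
move=> ww K1 ht hN hw.
pose t := w1 * y - w2 * x; pose r := w1 * x + w2 * y - 1.
have xE : x - w1 = w1 * r - w2 * t.
  transitivity ((w1 ^+ 2 + w2 ^+ 2) * x - w1); first by rewrite ww mul1r.
  by rewrite /r /t; ring.
have NE : (x - w1) ^+ 2 + (y - w2) ^+ 2 = r ^+ 2 + t ^+ 2.
  have -> : y - w2 = w2 * r + w1 * t.
    transitivity ((w1 ^+ 2 + w2 ^+ 2) * y - w2); first by rewrite ww mul1r.
    by rewrite /r /t; ring.
  by rewrite xE -[RHS]mul1r -ww; ring.
have K0 : 0 < K by rewrite (lt_le_trans _ K1).
have N0 : 0 <= r ^+ 2 + t ^+ 2 by rewrite addr_ge0 ?sqr_ge0.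
rewrite NE in ht hN *; rewrite -/t in ht; rewrite xE.
have hN' : (r ^+ 2 + t ^+ 2) * (16 * K ^+ 2) <= 1.
  by rewrite -ler_pdivlMr ?mul1r ?mulr_gt0 ?exprn_gt0.
have t2 : t ^+ 2 <= K ^+ 2 * (r ^+ 2 + t ^+ 2) ^+ 2.
  have : `|t| ^+ 2 <= (K * (r ^+ 2 + t ^+ 2)) ^+ 2.
    by rewrite ler_sqr ?nnegrE ?normr_ge0 ?mulr_ge0 ?(ltW K0).
  by rewrite real_normK ?num_real// exprMn.
have t3 : 16 * t ^+ 2 <= r ^+ 2 + t ^+ 2.
  have : K ^+ 2 * (r ^+ 2 + t ^+ 2) ^+ 2 * 16 <= r ^+ 2 + t ^+ 2.
    have := ler_wpM2l N0 hN'; rewrite mulr1; apply: le_trans.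
    by rewrite le_eqVlt; apply/orP; left; apply/eqP; ring.
  move=> h; apply: le_trans h; rewrite mulrC.
  by rewrite ler_pM2r.
have w2E : w2 ^+ 2 <= 2^-1 by lra.
have h1 : (w1 * r - w2 * t) ^+ 2 >= 2^-1 * (w1 * r) ^+ 2 - (w2 * t) ^+ 2.
  have := sqr_ge0 (w1 * r - 2 * (w2 * t)); rewrite -subr_ge0; nra.
have h2 : 2^-1 * r ^+ 2 <= w1 ^+ 2 * r ^+ 2 by rewrite ler_wpM2r ?sqr_ge0.
have h3 : w2 ^+ 2 * t ^+ 2 <= 2^-1 * t ^+ 2 by rewrite ler_wpM2r ?sqr_ge0.
rewrite -!exprMn in h2 h3; move: h1 h2 h3; rewrite !exprMn => h1 h2 h3.
lra.
Qed.

Definition cell : set (R * R) := `[-1, 1]%classic `*` `[-1, 1]%classic.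

Lemma cell_finite (M : R) : 0 <= M ->
  (\int[(mu \x mu)%E]_z (M * \1_cell z)%:E < +oo)%E.
Proof.
move=> M0; have mc : measurable cell by apply: measurableX; exact: measurable_itv.
under eq_integral do rewrite EFinM.
rewrite ge0_integralZl_EFin//; last first.
  by apply/measurable_EFinP/measurable_indic.
rewrite integral_indic// setIT /= product_measure1E//=; [|exact: measurable_itv..].
rewrite lebesgue_measure_itv/=.
by case: ifP => _; rewrite ?mule0 ?mul0e ?ltry// -?EFinD -?EFinM ltry.
Qed.

(** [Some i] stands for the sliver at [v i], sliced along the coordinate in which the vertex has
    square at least [1/2]. [None] stands for points whose squared distance from their vertex exceeds
    [1 / (16 * K^2)], where the density is at most [12 * 16 * K^2]. *)
Let bound K (k : option 'I_n) (p : R * R) : R :=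
  if k is Some i then
    if 2^-1 <= complex.Re (v i) ^+ 2
    then cusp_density (complex.Re (v i)) (complex.Im (v i)) (complex.Re (v i)) (9 * K) p
    else cusp_density_swap (complex.Im (v i)) (complex.Re (v i)) (complex.Im (v i)) (9 * K) p
  else 192 * K ^+ 2 * \1_cell p.

Let bound_ge0 K k p : 0 <= bound K k p.
Proof.
case: k => [i|] /=; first by case: ifP => _; exact: cusp_density_ge0.
by rewrite mulr_ge0// mulr_ge0// sqr_ge0.
Qed.

Let bound_measurable K k : measurable_fun setT (bound K k).
Proof.
rewrite /bound; case: k => [i|].
  by case: (2^-1 <= complex.Re (v i) ^+ 2); [exact: measurable_cusp_density|exact: measurable_cusp_density_swap].
apply: measurable_funM; first exact: measurable_cst.
by apply: measurable_indic; apply: measurableX; exact: measurable_itv.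
Qed.

Let bound_finite K k : 1 <= K -> (\int[(mu \x mu)%E]_z (bound K k z)%:E < +oo)%E.
Proof.
move=> K1; have K0 : 0 <= 9 * K by rewrite mulr_ge0// (le_trans _ K1).
rewrite /bound; case: k => [i|]; last by apply: cell_finite; rewrite mulr_ge0// sqr_ge0.
have h := sqnormv iv i; rewrite /sqnorm in h.
case hi : (2^-1 <= complex.Re (v i) ^+ 2).
  apply: cusp_density_int1 => //; apply: contraTneq hi => ->.
  by rewrite expr0n /=; apply/negP => h'; lra.
apply: cusp_density_int2 => //; apply: contraFneq hi => e.
by move: h; rewrite e expr0n addr0 => ->; rewrite invf_le1 ?ler1n.
Qed.

Lemma density_bound : exists2 K : R, 1 <= K & forall z : D, ideal_polygon v z ->
  exists k, 4 / (1 - complex.Re (val z) ^+ 2 - complex.Im (val z) ^+ 2) ^+ 2 <=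
    bound K k (complex.Re (val z), complex.Im (val z)).
Proof.
have [K K1 hK] := cusp_sliver iv; exists K => // z /PE Pz.
have z1 := sqnorm_lt1 z; have hz j : 0 <= nform (v j) (v (ordS j)) (val z) := Pz j.
have [i hi] := cusp_vertex iv z1 hz; have ht := hK i _ z1 hz.
have wn := sqnormv iv i.
have N0 : 0 < sqnorm (val z - v i).
  rewrite lt_def sqnorm_ge0 sqnorm_eq0 subr_eq0 andbT; apply: contraTneq z1 => ->.
  by rewrite wn ltxx.
have x1 : sqnorm (val z) < 1 := z1.
have -> : 1 - complex.Re (val z) ^+ 2 - complex.Im (val z) ^+ 2 = 1 - sqnorm (val z).
  by rewrite /sqnorm opprD addrA.
have d0 : 0 < (1 - sqnorm (val z)) ^+ 2 by rewrite exprn_gt0// subr_gt0.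
(* [cusp_vertex] bounds [sqnorm (z - v i)] by [3 * (1 - sqnorm z)^2], which is where the [12] in
   [cusp_density] comes from. *)
have fb : 4 / (1 - sqnorm (val z)) ^+ 2 <= 12 / sqnorm (val z - v i).
  by rewrite ler_pdivrMr// mulrAC ler_pdivlMr//; lra.
have K0 : 0 < K by rewrite (lt_le_trans _ K1).
have sq1 (x y : R) : x ^+ 2 + y ^+ 2 < 1 -> `|x| <= 1 /\ `|y| <= 1.
  have := sqr_ge0 x; have := sqr_ge0 y; rewrite -(real_normK (num_real x)).
  rewrite -(real_normK (num_real y)); have := normr_ge0 x; have := normr_ge0 y.
  by split; nra.
move: hi ht wn N0 x1 fb; case vE : (v i) => [w1 w2]; case: (val z) => [x y].
rewrite /cross /sqnorm /= => hi ht wn N0 x1 fb.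
have [xa ya] := sq1 _ _ x1.
have [hN|hN] := leP ((x - w1) ^+ 2 + (y - w2) ^+ 2) (16 * K ^+ 2)^-1; last first.
  exists None; rewrite /bound /= indicE mem_set; last first.
    by split; rewrite /= in_itv/= -ler_norml.
  rewrite mulr1; apply: (le_trans fb); rewrite ler_pdivrMr//.
  have : 1 <= (16 * K ^+ 2) * ((x - w1) ^+ 2 + (y - w2) ^+ 2).
    by rewrite mulrC -ler_pdivrMr ?div1r ?ltW// mulr_gt0// exprn_gt0.
  by nra.
exists (Some i); rewrite /bound vE /=.
have fin (a b s t : R) : a ^+ 2 + b ^+ 2 = 1 -> 2^-1 <= a ^+ 2 -> `|s| <= 1 ->
    0 < (s - a) ^+ 2 + (t - b) ^+ 2 ->
    `|a * t - b * s| <= K * ((s - a) ^+ 2 + (t - b) ^+ 2) ->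
    (s - a) ^+ 2 + (t - b) ^+ 2 <= (16 * K ^+ 2)^-1 ->
    12 / ((s - a) ^+ 2 + (t - b) ^+ 2) <= cusp_density a b a (9 * K) (s, t).
  move=> ab a2 s1 NN0 hst hNst.
  have h := sliver_width ab K1 hst hNst a2.
  have sa0 : 0 < (s - a) ^+ 2 by lra.
  rewrite /cusp_density indicE mem_set ?mulr1 /=; last first.
    split=> //=; apply: (le_trans hst); rewrite [9 * K]mulrC -mulrA.
    by rewrite ler_wpM2l// ltW.
  by rewrite ler_pM2l// lef_pV2 ?posrE// lerDl sqr_ge0.
apply: (le_trans fb); case: ifP => hw; first by apply: fin.
rewrite /cusp_density_swap /= addrC; apply: fin => //; first by rewrite addrC.
- by move/negbT: hw; rewrite -ltNge; lra.
- by rewrite addrC.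
- by rewrite distrC [X in _ <= K * X]addrC.
- by rewrite addrC.
Qed.

Let image_region := [set (complex.Re (val z), complex.Im (val z)) | z in ideal_polygon v].

Let measurable_image_region : measurable image_region.
Proof.
have mx : measurable_fun setT (fun p : R * R => p.1) by exact: measurable_fst.
have my : measurable_fun setT (fun p : R * R => p.2) by exact: measurable_snd.
have mc (c : R) : measurable_fun setT (fun _ : R * R => c) by exact: measurable_cst.
have mn : measurable_fun setT (fun p : R * R => sqnorm (p.1 +i* p.2)%C).
  by apply: measurable_funD; apply: measurable_funX.
have mo a b : measurable_fun setT (fun p : R * R => geoform a b (p.1 +i* p.2)%C).
  apply: measurable_funD; apply: measurable_funM => //.
    by apply: measurable_funD.
  by apply: measurable_funB; apply: measurable_funM.
have -> : image_region = (fun p : R * R => sqnorm (p.1 +i* p.2)%C) @^-1` `]-oo, 1[%classic `&`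
    \bigcap_(i in [set: 'I_n])
      (fun p : R * R => geoform (v i) (v (ordS i)) (p.1 +i* p.2)%C) @^-1` `[0, +oo[%classic.
  apply/seteqP; split=> p.
    move=> [z /PE Pz <-]; have e : (complex.Re (val z) +i* complex.Im (val z))%C = val z.
      by case: (val z).
    split; first by rewrite /= in_itv/= e sqnorm_lt1.
    move=> i _; rewrite /= in_itv/= e andbT -nform_og_ge0 ?sqnorm_lt1//; exact: Pz.
  rewrite /= in_itv/= => -[p1 hp].
  have [z zE] := disc_ex p1.
  exists z; last by rewrite zE; case: p {p1 hp zE}.
  apply/PE => i; rewrite /side_form nform_og_ge0 ?sqnorm_lt1// zE.
  by have := hp i I; rewrite /= in_itv/= andbT.
apply: measurableI.
  by rewrite -[X in measurable X]setTI; apply: mn => //; exact: measurable_itv.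
apply: fin_bigcap_measurable; first exact: finite_finset.
move=> i _; rewrite -[X in measurable X]setTI; apply: mo => //; exact: measurable_itv.
Qed.

Lemma area_finite : (hyperbolic_area (ideal_polygon v) < +oo)%E.
Proof.
have [K K1 hK] := density_bound.
pose G (p : R * R) : \bar R := (\sum_(k <- index_enum (option 'I_n)) (bound K k p)%:E)%E.
have G0 p : (0 <= G p)%E by apply: sume_ge0 => k _; rewrite lee_fin.
have mG : measurable_fun setT G.
  by apply: emeasurable_sum => k; apply/measurable_EFinP; exact: bound_measurable.
have iG : (\int[(mu \x mu)%E]_z G z < +oo)%E.
  rewrite ge0_integral_sum//.
  - by rewrite lte_sum_pinfty// => k _; exact: bound_finite.
  - by move=> k; apply/measurable_EFinP; exact: bound_measurable.
  - by move=> k p _; rewrite lee_fin.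
rewrite /hyperbolic_area -/image_region.
apply: le_lt_trans iG.
apply: (@le_trans _ _ (\int[(mu \x mu)%E]_(z in image_region) G z)%E); last first.
  by apply: ge0_subset_integral.
apply: ge0_le_integral => //.
- by move=> p _; rewrite lee_fin divr_ge0// sqr_ge0.
- apply/measurable_EFinP; apply: measurable_funTS.
  apply: measurable_funM; first exact: measurable_cst.
  apply: (measurableT_comp (@inv_measurable R)); apply: measurable_funX.
  apply: measurable_funB; last by apply: measurable_funX; exact: measurable_snd.
  apply: measurable_funB; first exact: measurable_cst.
  by apply: measurable_funX; exact: measurable_fst.
- exact: measurable_funTS.
move=> p [z Pz <-]; have [k hk] := hK z Pz.
rewrite /G (bigD1_seq k) ?mem_index_enum ?index_enum_uniq//=.
apply: (@le_trans _ _ (bound K k (complex.Re (val z), complex.Im (val z)))%:E).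
  by rewrite lee_fin.
by rewrite leeDl// sume_ge0// => j _; rewrite lee_fin.
Qed.

End Area.

(** * The quotient *)

Section Gauge.
Context {R : realType} {n : nat}.
Local Notation C := R[i].
Variable v : 'I_n -> C.
Hypothesis iv : ideal_vertices v.
Implicit Types (i j : 'I_n) (x y k : C) (p : R * R * R).

(** The barycentre is strictly inside every side in the Klein model, whereas the origin lies on a
    side as soon as that side is a diameter. *)
Definition center : C := (n%:R^-1)%:C%C * \sum_i v i.

Lemma n_gt0 : (0 < n)%N. Proof. by have := ge3n iv; lia. Qed.

Lemma orient_sum (a b : C) (s : seq 'I_n) (f : 'I_n -> C) : (0 < size s)%N ->
  orient a b (((size s)%:R^-1)%:C%C * \sum_(i <- s) f i) =
  (size s)%:R^-1 * \sum_(i <- s) orient a b (f i).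
Proof.
move=> s0; have N0 : (size s)%:R != 0 :> R by rewrite pnatr_eq0 -lt0n.
have orientE' (x : C) : orient a b x = cross (b - a) x - cross (b - a) a.
  by rewrite /orient /cross; case: a b x => [? ?] [? ?] [? ?] /=; ring.
have crossD (x y c : C) : cross c (x + y) = cross c x + cross c y.
  by case: x y c => [? ?] [? ?] [? ?]; rewrite /cross /=; ring.
have crossZ (t : R) (c x : C) : cross c (t%:C%C * x) = t * cross c x.
  by case: c x => [? ?] [? ?]; rewrite /cross /=; ring.
have crossS : cross (b - a) (\sum_(i <- s) f i) = \sum_(i <- s) cross (b - a) (f i).
  elim: (s) => [|i t IH]; first by rewrite !big_nil /cross /=; ring.
  by rewrite !big_cons crossD IH.
rewrite orientE' crossZ crossS; under [in RHS]eq_bigr do rewrite orientE'.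
rewrite [in RHS]sumrB [in RHS]mulrBr; congr (_ - _).
by rewrite big_const_seq count_predT iter_addr_0 -[cross _ _ *+ _]mulr_natl mulKf.
Qed.

Definition center_form i : R := orient (v i) (v (ordS i)) center.

Lemma center_form_gt0 i : 0 < center_form i.
Proof.
have n0 := n_gt0.
have s0 : (0 < size (enum 'I_n))%N by rewrite size_enum_ord.
have := @orient_sum (v i) (v (ordS i)) (enum 'I_n) v s0.
rewrite size_enum_ord !big_enum /center_form /center => ->.
rewrite mulr_gt0 ?invr_gt0 ?ltr0n// (bigD1 (ordS (ordS i)))//= ltr_pwDl//.
  by apply: (side_gt0 iv); [exact: (ordSS_neq iv)|exact: (ordS_neq iv)].
by apply: sumr_ge0 => j _; exact: (side_ge0 iv).
Qed.

Lemma sqnorm_center : sqnorm center < 1.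
Proof.
have hk i : 0 <= orient (v i) (v (ordS i)) center by exact/ltW/center_form_gt0.
have [//|[i e]] := ideal_point iv hk.
by have := center_form_gt0 i; rewrite /center_form e orient0l ltxx.
Qed.

Definition lin_form i x : R := cross (v (ordS i) - v i) x.

Lemma orient_lin_form i x : orient (v i) (v (ordS i)) (center + x) = center_form i + lin_form i x.
Proof.
by rewrite /center_form /lin_form /orient /cross; case: (v i) (v (ordS i)) center x => [? ?] [? ?] [? ?] [? ?] /=; ring.
Qed.

(* Minkowski functional of the polygon in the Klein model, centred at [center]. *)
Definition gauge x : R := \big[Num.max/0]_i (- lin_form i x / center_form i).

Lemma gauge_ge0 x : 0 <= gauge x.
Proof. by rewrite /gauge; apply: (big_rec (fun t : R => 0 <= t)) => // i y _ y0; rewrite le_max y0 orbT. Qed.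

Lemma gauge_le x (t : R) : 0 <= t -> gauge x <= t <-> forall i, 0 <= t * center_form i + lin_form i x.
Proof.
move=> t0; split=> [h i|h].
  have : - lin_form i x / center_form i <= t by apply: le_trans h; rewrite /gauge (bigD1 i)//= le_max lexx.
  by rewrite ler_pdivrMr ?center_form_gt0// -subr_ge0 opprK.
rewrite /gauge; elim/big_ind: _ => //; first by move=> a b a0 b0; rewrite ge_max a0.
by move=> i _; rewrite ler_pdivrMr ?center_form_gt0// -subr_ge0 opprK.
Qed.

Lemma gauge_lt x (t : R) : 0 < t -> gauge x < t <-> forall i, 0 < t * center_form i + lin_form i x.
Proof.
move=> t0; split=> [h i|h].
  have : - lin_form i x / center_form i < t by apply: le_lt_trans h; rewrite /gauge (bigD1 i)//= le_max lexx.
  by rewrite ltr_pdivrMr ?center_form_gt0// -subr_gt0 opprK.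
rewrite /gauge; elim/big_ind: _ => //; first by move=> a b a0 b0; rewrite gt_max a0.
by move=> i _; rewrite ltr_pdivrMr ?center_form_gt0// -subr_gt0 opprK.
Qed.

Lemma gauge_le1 x : gauge x <= 1 <-> forall i, 0 <= orient (v i) (v (ordS i)) (center + x).
Proof.
by rewrite gauge_le//; split=> h i; have := h i; rewrite orient_lin_form mul1r.
Qed.

Lemma gauge_lt1 x : gauge x < 1 <-> forall i, 0 < orient (v i) (v (ordS i)) (center + x).
Proof.
by rewrite gauge_lt//; split=> h i; have := h i; rewrite orient_lin_form mul1r.
Qed.

Lemma lin_formZ i (t : R) x : lin_form i (t%:C%C * x) = t * lin_form i x.
Proof. by rewrite /lin_form /cross; case: (_ - _) x => [? ?] [? ?] /=; ring. Qed.

Lemma gaugeZ (t : R) x : 0 < t -> gauge (t%:C%C * x) = t * gauge x.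
Proof.
move=> t0; have t0' := ltW t0.
have le y (s : R) : 0 < s -> gauge (s%:C%C * y) <= s * gauge y.
  move=> s0; apply/gauge_le; first by rewrite mulr_ge0 ?gauge_ge0// ltW.
  move=> i; rewrite lin_formZ -mulrA -mulrDr mulr_ge0 ?(ltW s0)//.
  by have /(gauge_le y (gauge_ge0 y)) := lexx (gauge y).
apply/eqP; rewrite eq_le le//= -ler_pdivlMl//.
have := le (t%:C%C * x) t^-1; rewrite invr_gt0 => /(_ t0).
by rewrite mulrA -rmorphM/= mulVf ?gt_eqF// mul1r.
Qed.

(** The linear forms sum to zero around the polygon, so if all are nonnegative at [x] they all
    vanish there. Two consecutive sides are not parallel, which forces [x = 0]. *)
Lemma gauge_gt0 x : x != 0 -> 0 < gauge x.
Proof.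
move=> x0; rewrite lt_def gauge_ge0 andbT; apply: contra x0 => /eqP g0.
have hl i : 0 <= lin_form i x.
  by have := (gauge_le x (lexx 0)).1; rewrite g0 => /(_ (lexx 0) i); rewrite mul0r add0r.
have s0 : \sum_i lin_form i x = 0.
  have lE i : lin_form i x = cross (v (ordS i)) x - cross (v i) x.
    by rewrite /lin_form /cross; clear; case: (v i) (v (ordS i)) x => [? ?] [? ?] [? ?] /=; ring.
  under eq_bigr do rewrite lE.
  rewrite sumrB (reindex_inj (h := @ord_pred n))/=; last exact: can_inj (@ord_predK n).
  by under eq_bigr do rewrite ord_predK; rewrite subrr.
have l0 i : lin_form i x = 0.
  apply/eqP; rewrite eq_le hl andbT -s0 (bigD1 i)//= lerDl.
  by apply: sumr_ge0 => j _.
pose i : 'I_n := Ordinal n_gt0.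
have h1 := l0 i; have h2 := l0 (ordS i).
have h3 := @side_gt0 R n v iv i (ordS (ordS i)) (ordSS_neq iv i) (ordS_neq iv _).
move: h1 h2 h3; rewrite /lin_form /orient /cross -sqnorm_eq0 /sqnorm.
move: (v i) (v (ordS i)) (v (ordS (ordS i))) => [a1 a2] [b1 b2] [c1 c2].
clear; case: x => [x1 x2] /= e1 e2 e3.
have det0 : (b1 - a1) * (c2 - a2) - (b2 - a2) * (c1 - a1) != 0 by rewrite gt_eqF.
have x10 : x1 = 0.
  apply: (mulfI det0); rewrite mulr0.
  transitivity ((c1 - b1) * ((b1 - a1) * x2 - (b2 - a2) * x1) - (b1 - a1) * ((c1 - b1) * x2 - (c2 - b2) * x1)).
    by ring.
  by rewrite e1 e2 !mulr0 subrr.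
have x20 : x2 = 0.
  apply: (mulfI det0); rewrite mulr0.
  transitivity ((c2 - b2) * ((b1 - a1) * x2 - (b2 - a2) * x1) - (b2 - a2) * ((c1 - b1) * x2 - (c2 - b2) * x1)).
    by ring.
  by rewrite e1 e2 !mulr0 subrr.
by rewrite x10 x20 expr0n addr0.
Qed.

Lemma gauge0 : gauge 0 = 0.
Proof.
apply/eqP; rewrite eq_le gauge_ge0 andbT; apply/gauge_le => // i.
by rewrite mul0r add0r /lin_form /cross /= !mulr0 subrr.
Qed.

Lemma gauge_vertex i : gauge (v i - center) = 1.
Proof.
have e : center + (v i - center) = v i by rewrite addrC subrK.
apply/eqP; rewrite eq_le; apply/andP; split.
  by apply/gauge_le1 => j; rewrite e; exact: (side_ge0 iv).
rewrite leNgt; apply/negP => /gauge_lt1 /(_ i).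
by rewrite e orient0l ltxx.
Qed.

Definition planar p : C := (p.1.1 +i* p.1.2)%C.

Definition height p : R := gauge (planar p) + `|p.2|.

(* Inverse of the radial projection of the bipyramid [gauge x + |t| = 1] onto the
   sphere, followed by the projection onto the plane. *)
Definition sphere_klein p : C := center + (height p)^-1%:C%C * planar p.

Lemma height_gt0 p : sphere p -> 0 < height p.
Proof.
rewrite /sphere /= => hp; have [e|ne] := eqVneq (planar p) 0.
  rewrite /height e gauge0 add0r normr_gt0; apply: contra_eq_neq hp => ->.
  by case: e => -> ->; rewrite !expr0n !addr0 eq_sym oner_eq0.
by rewrite ltr_pwDl ?gauge_gt0.
Qed.

Lemma gauge_sphere_klein p : sphere p -> gauge (sphere_klein p - center) = gauge (planar p) / height p.
Proof.
move=> hp; rewrite /sphere_klein addrC addKr gaugeZ ?invr_gt0 ?height_gt0//.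
by rewrite mulrC.
Qed.

Lemma one_sub_gauge_sphere_klein p : sphere p -> 1 - gauge (sphere_klein p - center) = `|p.2| / height p.
Proof.
move=> hp; rewrite gauge_sphere_klein// -{1}(@divff _ (height p)); last by rewrite gt_eqF ?height_gt0.
by rewrite -mulrBl /height addrC addKr.
Qed.

Lemma sphere_klein_polygon p : sphere p -> forall i, 0 <= orient (v i) (v (ordS i)) (sphere_klein p).
Proof.
move=> hp i; have : gauge (sphere_klein p - center) <= 1.
  by rewrite -subr_ge0 one_sub_gauge_sphere_klein// divr_ge0 ?normr_ge0 ?ltW ?height_gt0.
by move=> /gauge_le1 /(_ i); rewrite addrC subrK.
Qed.

Definition cusp i : R * R * R :=
  let y := ((Num.sqrt (sqnorm (v i - center)))^-1)%:C%C * (v i - center) in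
  (complex.Re y, complex.Im y, 0).

Lemma sqnorm_cusp i : 0 < sqnorm (v i - center).
Proof.
rewrite lt_def sqnorm_ge0 sqnorm_eq0 subr_eq0 andbT; apply/eqP => e.
by have := sqnorm_center; rewrite -e (sqnormv iv) ltxx.
Qed.

Lemma planar_cusp i : planar (cusp i) = ((Num.sqrt (sqnorm (v i - center)))^-1)%:C%C * (v i - center).
Proof. by rewrite /cusp /planar /=; case: (_ * _). Qed.

Lemma cusp_sphere i : sphere (cusp i).
Proof.
have := sqnorm_scale (v i - center) (Num.sqrt (sqnorm (v i - center)))^-1.
rewrite exprVn sqr_sqrtr ?sqnorm_ge0// mulVf ?gt_eqF ?sqnorm_cusp//.
by rewrite /sphere /cusp /= /sqnorm expr0n addr0.
Qed.

Lemma sphere_klein_cusp i : sphere_klein (cusp i) = v i.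
Proof.
have s0 : 0 < Num.sqrt (sqnorm (v i - center)) by rewrite sqrtr_gt0 sqnorm_cusp.
rewrite /sphere_klein /height planar_cusp gaugeZ ?invr_gt0// gauge_vertex mulr1 normr0 addr0.
by rewrite invrK mulrA -rmorphM/= divff ?gt_eqF// mul1r addrC subrK.
Qed.

(** A vertex has gauge [1], which forces [p] onto the equator, and there a point is determined by
    its direction. *)
Lemma sphere_klein_vertex p i : sphere p -> sphere_klein p = v i -> p = cusp i.
Proof.
move=> hp hk; have h0 := height_gt0 hp.
have p2 : p.2 = 0.
  have := one_sub_gauge_sphere_klein hp; rewrite hk gauge_vertex subrr => /esym/eqP.
  by rewrite mulf_eq0 invr_eq0 (gt_eqF h0) orbF normr_eq0 => /eqP.
have yE : planar p = (height p)%:C%C * (v i - center).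
  rewrite -hk /sphere_klein addrC addKr mulrA -rmorphM/= divff ?gt_eqF// mul1r//.
have n1 : sqnorm (planar p) = 1.
  by move: hp; rewrite /sphere /= p2 expr0n addr0.
have hE : height p = (Num.sqrt (sqnorm (v i - center)))^-1.
  apply: (@mulIf _ (Num.sqrt (sqnorm (v i - center)))); first by rewrite gt_eqF ?sqrtr_gt0 ?sqnorm_cusp.
  rewrite mulVf ?gt_eqF ?sqrtr_gt0 ?sqnorm_cusp// -[height p]ger0_norm ?ltW// -sqrtr_sqr.
  by rewrite -sqrtrM ?sqr_ge0// -sqnorm_scale -yE n1 sqrtr1.
rewrite /cusp -hE -yE; by clear -p2; case: p p2 => [[a b] c] /= ->.
Qed.

Definition cusps : set (R * R * R) := [set cusp i | i in [set: 'I_n]].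

Lemma sphere_klein_lt1 p : sphere p -> ~ cusps p -> sqnorm (sphere_klein p) < 1.
Proof.
move=> hp hc; have [//|[i e]] := ideal_point iv (sphere_klein_polygon hp).
by case: hc; exists i => //; rewrite -(sphere_klein_vertex hp e).
Qed.

Definition klein_inv k : C := (1 + Num.sqrt (1 - sqnorm k))^-1%:C%C * k.

Lemma klein_invK k : sqnorm k < 1 -> sqnorm (klein_inv k) < 1 /\ klein (klein_inv k) = k.
Proof.
move=> k1; set s := Num.sqrt (1 - sqnorm k).
have s0 : 0 < s by rewrite sqrtr_gt0 subr_gt0.
have s2 : s ^+ 2 = 1 - sqnorm k by rewrite sqr_sqrtr// subr_ge0 ltW.
have e : sqnorm (klein_inv k) = (1 - s) / (1 + s).
  rewrite /klein_inv sqnorm_scale -/s (_ : sqnorm k = (1 - s) * (1 + s)); last by rewrite -[LHS](subKr 1) -s2; ring.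
  by field; apply/eqP; lra.
split; first by rewrite e ltr_pdivrMr ?mul1r; lra.
rewrite /klein e /klein_inv mulrA -rmorphM/= -/s.
have -> : 2 / (1 + (1 - s) / (1 + s)) * (1 + s)^-1 = 1.
  by field; do ?[apply/andP; split]; apply/eqP; lra.
by rewrite mul1r.
Qed.

Lemma kleinK (z : C) : sqnorm z < 1 -> klein_inv (klein z) = z.
Proof.
move=> z1; have z0 := one_sqnorm_gt0 z.
rewrite /klein_inv one_sub_klein sqrtr_sqr ger0_norm; last first.
  by rewrite divr_ge0 ?ltW// subr_gt0.
rewrite /klein mulrA -rmorphM/=.
have -> : (1 + (1 - sqnorm z) / (1 + sqnorm z))^-1 * (2 / (1 + sqnorm z)) = 1.
  by field; do ?[apply/andP; split]; apply/eqP; lra.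
by rewrite mul1r.
Qed.

End Gauge.

(** * Continuity of distances, nonexpansive maps and gauges *)

Section Continuity.
Context {R : realType}.
Local Notation C := R[i].
Local Notation D := (disc R).
Local Notation d := hsinh2.

Lemma hsinh2_continuous (z : D) (e : R) : 0 < e -> nbhs z [set y : D | d y z < e].
Proof.
move=> e0; pose c := 1 - sqnorm (val z).
have c0 : 0 < c by rewrite subr_gt0 sqnorm_lt1.
have h1 : nbhs z [set y : D | sqnorm (val y) < (1 + sqnorm (val z)) / 2].
  have : nbhs (sqnorm (val z)) [set t : R | t < (1 + sqnorm (val z)) / 2].
    apply: open_nbhs_nbhs; split; first exact: open_lt.
    by have := sqnorm_lt1 z => /= ?; lra.
  exact: sqnormD_continuous.
have h2 : nbhs z [set y : D | sqnorm (val y - val z) < e * (c ^+ 2 / 2)].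
  by apply/nbhs_D; exists (e * (c ^+ 2 / 2)) => //; rewrite mulr_gt0// divr_gt0// exprn_gt0.
apply: filterS (filterI h1 h2) => y [/= y1 y2].
have y0 := sqnorm_lt1 y.
rewrite /hsinh2 /sinh2 ltr_pdivrMr; last by rewrite mulr_gt0// subr_gt0.
apply: (lt_le_trans y2); rewrite ler_pM2l// -/c.
have : c / 2 <= 1 - sqnorm (val y) by rewrite /c; lra.
by rewrite expr2 => h; nra.
Qed.

Lemma sqnorm_le_hsinh2 (y z : D) : sqnorm (val y - val z) <= d y z.
Proof.
rewrite /hsinh2 /sinh2 ler_pdivlMr; last by rewrite mulr_gt0// subr_gt0 sqnorm_lt1.
rewrite ler_piMr ?sqnorm_ge0// mulr_ile1 ?subr_ge0 ?(ltW (sqnorm_lt1 _))//.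
  by rewrite gerBl sqnorm_ge0.
by rewrite gerBl sqnorm_ge0.
Qed.

Lemma nonexpansive_continuous (phi : D -> D) :
  (forall y z, d (phi y) (phi z) <= d y z) -> continuous phi.
Proof.
move=> h z U /nbhs_D[e e0 eU]; suff : nbhs z (phi @^-1` U) by [].
apply: filterS (hsinh2_continuous z e0) => y /= hy; apply: eU.
exact: le_lt_trans (sqnorm_le_hsinh2 _ _) (le_lt_trans (h _ _) hy).
Qed.

Lemma continuous_glue (T Z : topologicalType) (c : T -> R) (g1 g2 : T -> Z) :
  continuous c -> continuous g1 -> continuous g2 ->
  (forall t, c t = 0 -> g1 t = g2 t) ->
  continuous (fun t => if 0 <= c t then g1 t else g2 t).
Proof.
move=> cc c1 c2 e t U; set f := (fun t => _).
suff h : nbhs (f t) U -> nbhs t (f @^-1` U) by exact: h.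
rewrite {1}/f => hU; have [ct|ct|ct] := ltgtP 0 (c t).
- rewrite (ltW ct) in hU.
  have n1 : nbhs t [set t' | 0 < c t'].
    have : nbhs (c t) [set x : R | 0 < x] by apply: open_nbhs_nbhs; split=> //; exact: open_gt.
    exact: cc.
  have n2 : nbhs t (g1 @^-1` U) by exact: c1.
  by apply: filterS (filterI n1 n2) => y [/= y0 y1]; rewrite /f ltW.
- rewrite leNgt ct /= in hU.
  have n1 : nbhs t [set t' | c t' < 0].
    have : nbhs (c t) [set x : R | x < 0] by apply: open_nbhs_nbhs; split=> //; exact: open_lt.
    exact: cc.
  have n2 : nbhs t (g2 @^-1` U) by exact: c2.
  by apply: filterS (filterI n1 n2) => y [/= y0 y1]; rewrite /f leNgt y0.
- rewrite -ct lexx in hU.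
  have n1 : nbhs t (g1 @^-1` U) by exact: c1.
  have n2 : nbhs t (g2 @^-1` U) by apply: c2; rewrite -e.
  by apply: filterS (filterI n1 n2) => y [/= y0 y1]; rewrite /f; case: ifP.
Qed.

Lemma klein_Re_continuous : continuous (fun z : D => complex.Re (klein (val z))).
Proof.
move=> z.
have -> : (fun z : D => complex.Re (klein (val z))) =
    (fun z : D => 2 * (1 + sqnorm (val z))^-1 * complex.Re (val z)).
  by apply/funext => y; rewrite /klein; case: (val y) => a b /=; ring.
have q : 1 + sqnorm (val z) != 0 by rewrite gt_eqF ?one_sqnorm_gt0.
have cst (a : R) : continuous (fun _ : D => a) by move=> y; exact: cst_continuous.
exact (continuousM (continuousM (cst 2 z) (@continuousV _ _ (fun z : D => 1 + sqnorm (val z)) z q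
  (continuousD (cst 1 z) (@sqnormD_continuous R z)))) (@rez_continuous R z)).
Qed.

Lemma klein_Im_continuous : continuous (fun z : D => complex.Im (klein (val z))).
Proof.
move=> z.
have -> : (fun z : D => complex.Im (klein (val z))) =
    (fun z : D => 2 * (1 + sqnorm (val z))^-1 * complex.Im (val z)).
  by apply/funext => y; rewrite /klein; case: (val y) => a b /=; ring.
have q : 1 + sqnorm (val z) != 0 by rewrite gt_eqF ?one_sqnorm_gt0.
have cst (a : R) : continuous (fun _ : D => a) by move=> y; exact: cst_continuous.
exact (continuousM (continuousM (cst 2 z) (@continuousV _ _ (fun z : D => 1 + sqnorm (val z)) z q
  (continuousD (cst 1 z) (@sqnormD_continuous R z)))) (@imz_continuous R z)).
Qed.

Lemma sqnorm_continuous (T : topologicalType) (f : T -> C) (t : T) :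
  {for t, continuous (fun s => complex.Re (f s))} ->
  {for t, continuous (fun s => complex.Im (f s))} ->
  {for t, continuous (fun s => sqnorm (f s))}.
Proof.
move=> h1 h2; exact (continuousD (continuousM h1 h1) (continuousM h2 h2)).
Qed.

Lemma gauge_continuous (n : nat) (v : 'I_n -> C) (T : topologicalType) (f : T -> C) (t : T) :
  {for t, continuous (fun s => complex.Re (f s))} ->
  {for t, continuous (fun s => complex.Im (f s))} ->
  {for t, continuous (fun s => gauge v (f s))}.
Proof.
move=> h1 h2; rewrite /gauge.
have cst (a : R) : {for t, continuous (fun _ : T => a)} by exact: cst_continuous.
elim: (index_enum _) => [|i s IH].
  rewrite (_ : (fun s => _) = (fun _ : T => 0)); first exact: cst.
  by apply/funext => s; rewrite big_nil.
have hl : {for t, continuous (fun s => - lin_form v i (f s) / center_form v i)}.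
  exact (continuousM (continuousN (continuousB
    (continuousM (cst (complex.Re (v (ordS i) - v i))) h2)
    (continuousM (cst (complex.Im (v (ordS i) - v i))) h1))) (cst (center_form v i)^-1)).
rewrite (_ : (fun s => _) = (fun y : T => - lin_form v i (f y) / center_form v i) \max
    (fun y : T => \big[Num.max/0]_(j <- s) (- lin_form v j (f y) / center_form v j))).
  exact (continuous_max hl IH).
by apply/funext => y; rewrite big_cons.
Qed.

End Continuity.

(** * The homeomorphism with the punctured sphere *)

Section Quotient.
Context {R : realType} {n : nat}.
Local Notation C := R[i].
Local Notation D := (disc R).
Local Notation d := hsinh2.
Variables (v : 'I_n -> C) (l : 'I_n).
Hypothesis iv : ideal_vertices v.
Hypothesis diam : is_diameter (side v l).
Implicit Types (i j : 'I_n) (x y z : D) (h s t : disc_group R).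
Local Notation g := (side_form v).
Local Notation sg := (side_reflection v).
Local Notation P := (ideal_polygon v).
Local Notation H := (reflection_group v).
Local Notation Gamma := (rotation_group v).

(** For a point over a side several elements qualify and the choice is arbitrary; by [fold_uniq] the
    image [fold z] does not depend on it. *)
Definition folder z : disc_group R :=
  xget (1%g : disc_group R) [set h : disc_group R | H h /\ P (h z)].

Lemma folderP z : H (folder z) /\ P (folder z z).
Proof.
rewrite /folder; case: xgetP => [h _ //|none].
by have [h Hh Ph] := H_cover iv diam z; case: (none h).
Qed.

Definition fold z : D := folder z z.

Lemma P_fold z : P (fold z). Proof. by have [] := folderP z. Qed.

Lemma fold_eq h z : H h -> P (h z) -> fold z = h z.
Proof.
move=> Hh Ph; have [Hf Pf] := folderP z.
have e : (h * (folder z)^-1)%g (fold z) = h z.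
  by rewrite /fold /=; congr (h _); exact: bij_funK.
have Hk : H (h * (folder z)^-1)%g.
  by apply: (subgroupM (subgroup_H v)) => //; exact: (subgroupV (subgroup_H v)).
have := fold_uniq iv Hk Pf; rewrite -/(fold z) e => /(_ Ph).
by move->.
Qed.

Lemma fold_P z : P z -> fold z = z.
Proof. by move=> Pz; apply: (@fold_eq 1%g) => //; exact: subgroup1 (subgroup_H v). Qed.

Lemma fold_H h z : H h -> fold (h z) = fold z.
Proof.
move=> Hh; have [Hf Pf] := folderP (h z).
rewrite {1}/fold; apply/esym; apply: (@fold_eq (folder (h z) * h)%g) => //.
exact: (subgroupM (subgroup_H v)).
Qed.

(* Replacing [folder y] by [folder z] on [z] can only decrease the distance to a
   point of [P]. *)
Lemma hsinh2_fold y z : d (fold y) (fold z) <= d y z.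
Proof.
have [Hf Pf] := folderP y; have [Hg Pg] := folderP z.
rewrite -(H_isom iv y z Hf) -/(fold y).
have e : (folder y * (folder z)^-1)%g (fold z) = folder y z.
  by rewrite /fold /=; congr (folder y _); exact: bij_funK.
rewrite -e; apply: (fold_min iv _ Pf Pg).
by apply: (subgroupM (subgroup_H v)) => //; exact: (subgroupV (subgroup_H v)).
Qed.

Lemma fold_continuous : continuous fold.
Proof. exact: nonexpansive_continuous hsinh2_fold. Qed.

Lemma H_continuous h : H h -> continuous h.
Proof. by move=> Hh; apply: nonexpansive_continuous => y z; rewrite (H_isom iv). Qed.

(** Tells the translates of [P] under [Gamma] from those of its mirror image. Points over a side
    count as upper. *)
Definition upper z : bool := `[< exists2 s, Gamma s & P (s z) >].

Lemma upper_Gamma s z : Gamma s -> upper (s z) = upper z.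
Proof.
have sG := subgroup_Gamma v.
move=> Gs; apply/asboolP/asboolP => -[t Gt Pt].
  by exists (t * s)%g => //; exact: (subgroupM sG).
exists (t * s^-1)%g; first by apply: (subgroupM sG) => //; exact: (subgroupV sG).
by rewrite [X in P X](_ : _ = t z)//=; congr (t _); exact: bij_funK.
Qed.

(** Over the interior of [P] the element carrying [z] into [P] is unique, so any such [h] decides
    [upper z]. With [h] fixed, this makes [upper] locally constant there. *)
Lemma upperE h z : H h -> (forall i, 0 < g i (h z)) -> upper z = `[< Gamma h >].
Proof.
move=> Hh hz; apply/asboolP/asboolP => [[s Gs Ps]|Gh]; last first.
  by exists h => //; apply/PE => i; exact: ltW.
have Ph : P (h z) by apply/PE => i; exact: ltW.
have Hk : H (s * h^-1)%g.
  by apply: (subgroupM (subgroup_H v)); [exact: Gs.1|exact: (subgroupV (subgroup_H v))].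
have [w rw wE] := H_word iv Hk.
have e : (s * h^-1)%g (h z) = s z by rewrite /=; congr (s _); exact: bij_funK.
have := strict_domain iv rw Ph; rewrite -wE e => /(_ Ps)[_ [w0|[i _ gi]]].
  move: wE; rewrite w0 /word_val big_nil => sh; suff -> : h = s by [].
  by rewrite -[LHS]mul1g -sh -mulgA mulVg mulg1.
by have := hz i; rewrite gi ltxx.
Qed.

Definition fold_offset z : C := klein (val (fold z)) - center v.

(** Height of the bipyramid over the folded point; it vanishes exactly over the sides. *)
Definition fold_height z : R := 1 - gauge v (fold_offset z).

Lemma center_fold_offset z : center v + fold_offset z = klein (val (fold z)).
Proof. by rewrite /fold_offset addrC subrK. Qed.

Lemma fold_height_ge0 z : 0 <= fold_height z.
Proof.
rewrite subr_ge0; apply/(gauge_le1 iv) => i; rewrite center_fold_offset -nform_ge0 ?sqnorm_lt1//.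
by have /PE := P_fold z; apply.
Qed.

Lemma fold_height_gt0 z : 0 < fold_height z <-> forall i, 0 < g i (fold z).
Proof.
rewrite subr_gt0 (gauge_lt1 iv); split=> h i; have := h i.
  by rewrite center_fold_offset -nform_gt0 ?sqnorm_lt1.
by rewrite center_fold_offset -nform_gt0 ?sqnorm_lt1.
Qed.

Lemma fold_height_eq0 z : fold_height z = 0 -> exists i, g i (fold z) = 0.
Proof.
move=> b0; apply: contrapT => hn.
suff : 0 < fold_height z by rewrite b0 ltxx.
apply/fold_height_gt0 => i; rewrite lt_def (_ : 0 <= _); last first.
  by have /PE := P_fold z; apply.
by rewrite andbT; apply/eqP => gi; apply: hn; exists i.
Qed.

(** The two halves of the double go to the two halves of the bipyramid. The sign is immaterial over
    the sides, where the height is [0]. *)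
Definition signed_height z : R := if upper z then fold_height z else - fold_height z.

Lemma normr_signed_height z : `|signed_height z| = fold_height z.
Proof. by rewrite /signed_height; case: ifP => _; rewrite ?normrN ger0_norm ?fold_height_ge0. Qed.

Definition fold_radius z : R := Num.sqrt (sqnorm (fold_offset z) + fold_height z ^+ 2).

Lemma fold_radius2_gt0 z : 0 < sqnorm (fold_offset z) + fold_height z ^+ 2.
Proof.
have [x0|x0] := eqVneq (fold_offset z) 0.
  by rewrite /fold_height x0 sqnorm0 (gauge0 iv) subr0 expr1n add0r ltr01.
by rewrite ltr_pwDl ?sqr_ge0// lt_def sqnorm_ge0 sqnorm_eq0 x0.
Qed.

Lemma fold_radius_gt0 z : 0 < fold_radius z. Proof. by rewrite sqrtr_gt0 fold_radius2_gt0. Qed.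

(** Radial projection to the sphere of the bipyramid point over [fold_offset z] at height
    [signed_height z]. *)
Definition Phi z : R * R * R :=
  (complex.Re (fold_offset z) / fold_radius z, complex.Im (fold_offset z) / fold_radius z, signed_height z / fold_radius z).

Lemma Phi_sphere z : sphere (Phi z).
Proof.
rewrite /sphere /= !expr_div_n -!mulrDl sqr_sqrtr ?(ltW (fold_radius2_gt0 z))//.
have -> : signed_height z ^+ 2 = fold_height z ^+ 2 by rewrite -(normr_signed_height z) real_normK ?num_real.
by rewrite -/(sqnorm (fold_offset z)) divff// gt_eqF ?fold_radius2_gt0.
Qed.

Lemma planar_Phi z : planar (Phi z) = ((fold_radius z)^-1)%:C%C * fold_offset z.
Proof.
rewrite /planar /=; case: (fold_offset z) => a b /=.
by apply/eqP; rewrite eq_complex /=; apply/andP; split; apply/eqP; ring.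
Qed.

Lemma height_Phi z : height v (Phi z) = (fold_radius z)^-1.
Proof.
rewrite /height planar_Phi (gaugeZ iv) ?invr_gt0 ?fold_radius_gt0//= normrM normfV normr_signed_height.
by rewrite (ger0_norm (ltW (fold_radius_gt0 z))) mulrC -mulrDl /fold_height addrC subrK mul1r.
Qed.

Lemma sphere_klein_Phi z : sphere_klein v (Phi z) = klein (val (fold z)).
Proof.
rewrite /sphere_klein height_Phi planar_Phi invrK mulrA -rmorphM/= divff ?gt_eqF ?fold_radius_gt0//.
by rewrite mul1r center_fold_offset.
Qed.

Definition punctured : set (R * R * R) := @sphere R `\` cusps v.

Lemma Phi_punctured z : punctured (Phi z).
Proof.
split; first exact: Phi_sphere.
move=> [i _ e]; have := sqnorm_klein_lt1 (sqnorm_lt1 (fold z)).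
by rewrite -sphere_klein_Phi -e (sphere_klein_cusp iv) (sqnormv iv) ltxx.
Qed.

Definition fold_sphere z : punctured := exist _ (Phi z) (mem_set (Phi_punctured z)).

Lemma fold_sphere_Gamma s z : Gamma s -> fold_sphere (s z) = fold_sphere z.
Proof.
move=> Gs; apply: val_inj => /=.
by rewrite /Phi /fold_radius /signed_height /fold_height /fold_offset (upper_Gamma z Gs) (fold_H z Gs.1).
Qed.

Lemma fold_offset_continuous : continuous (fun z => complex.Re (fold_offset z)) /\
  continuous (fun z => complex.Im (fold_offset z)).
Proof.
have cst (a : R) z : {for z, continuous (fun _ : D => a)} by exact: cst_continuous.
split=> z.
  have -> : (fun y => complex.Re (fold_offset y)) = (fun y => complex.Re (klein (val (fold y))) - complex.Re (center v)).
    by apply/funext => y; rewrite /fold_offset; case: (klein _) (center v) => ? ? [? ?].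
  exact (continuousB (@continuous_comp _ _ _ fold (fun z => complex.Re (klein (val z))) z
    (@fold_continuous z) (@klein_Re_continuous R (fold z))) (cst (complex.Re (center v)) z)).
have -> : (fun y => complex.Im (fold_offset y)) = (fun y => complex.Im (klein (val (fold y))) - complex.Im (center v)).
  by apply/funext => y; rewrite /fold_offset; case: (klein _) (center v) => ? ? [? ?].
exact (continuousB (@continuous_comp _ _ _ fold (fun z => complex.Im (klein (val z))) z
  (@fold_continuous z) (@klein_Im_continuous R (fold z))) (cst (complex.Im (center v)) z)).
Qed.

Lemma fold_height_continuous : continuous fold_height.
Proof.
move=> z; have cst (a : R) : {for z, continuous (fun _ : D => a)} by exact: cst_continuous.
have [c1 c2] := fold_offset_continuous.
exact (continuousB (cst 1) (@gauge_continuous R n v _ fold_offset z (@c1 z) (@c2 z))).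
Qed.

(** Over a side the absolute value is [fold_height], which tends to [0]. Elsewhere the fixed element
    [folder z] carries all points near [z] into the interior of [P], so the sign is locally
    constant. *)
Lemma signed_height_continuous : continuous signed_height.
Proof.
move=> z; have [b0|b0] := eqVneq (fold_height z) 0.
  move=> U; have -> : signed_height z = 0 by rewrite /signed_height b0 oppr0 if_same.
  move=> /nbhs_ballP[e /= e0 eU]; suff : nbhs z (signed_height @^-1` U) by [].
  have n1 : nbhs z [set y | fold_height y < e].
    have : nbhs (fold_height z) [set x : R | x < e].
      by apply: open_nbhs_nbhs; split; [exact: open_lt|rewrite /= b0].
    exact: fold_height_continuous.
  by apply: filterS n1 => y /= hy; apply: eU; rewrite /ball /= sub0r normrN normr_signed_height.
have bp : 0 < fold_height z by rewrite lt_def b0 fold_height_ge0.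
have [Hh Ph] := folderP z.
have hU : nbhs z [set y | forall i, 0 < g i (folder z y)].
  have : nbhs (folder z z) [set y : D | forall i, 0 < g i y].
    by apply: open_nbhs_nbhs; split; [exact: strict_open|exact/fold_height_gt0].
  exact: (H_continuous Hh).
have e y : (forall i, 0 < g i (folder z y)) -> upper y = upper z.
  by move=> hy; rewrite (upperE Hh hy) (upperE Hh ((fold_height_gt0 z).1 bp)).
have cs : {for z, continuous (fun y => if upper z then fold_height y else - fold_height y)}.
  case: (upper z); first exact: fold_height_continuous.
  exact (continuousN (@fold_height_continuous z)).
move=> U; have -> : signed_height z = (if upper z then fold_height z else - fold_height z) by [].
move=> /cs nU; suff : nbhs z (signed_height @^-1` U) by [].
have nU' : nbhs z [set y | U (if upper z then fold_height y else - fold_height y)] by exact: nU.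
by apply: filterS (filterI hU nU') => y [/= /e hy]; rewrite /signed_height hy.
Qed.

Lemma fold_sphere_continuous : continuous fold_sphere.
Proof.
move=> z; apply: continuous_sub.
have [c1 c2] := fold_offset_continuous.
have rc : {for z, continuous (fun y => (fold_radius y)^-1)}.
  apply: continuousV; first by rewrite gt_eqF ?fold_radius_gt0.
  exact (@continuous_comp _ _ _ (fun y => sqnorm (fold_offset y) + fold_height y ^+ 2) Num.sqrt z
    (continuousD (sqnorm_continuous (@c1 z) (@c2 z))
      (continuousM (@fold_height_continuous z) (@fold_height_continuous z)))
    (@sqrt_continuous R _)).
have p1 : (complex.Re (fold_offset y) / fold_radius y) @[y --> z] --> complex.Re (fold_offset z) / fold_radius z.
  exact (continuousM (@c1 z) rc).
have p2 : (complex.Im (fold_offset y) / fold_radius y) @[y --> z] --> complex.Im (fold_offset z) / fold_radius z.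
  exact (continuousM (@c2 z) rc).
have p3 : (signed_height y / fold_radius y) @[y --> z] --> signed_height z / fold_radius z.
  exact (continuousM (@signed_height_continuous z) rc).
exact: (cvg_pair (cvg_pair p1 p2) p3).
Qed.

Definition disc_of (z : C) : D :=
  if pselect (`|z| < 1) is left h then exist _ z (mem_set h) else disc0.

Lemma disc_ofE (z : C) : sqnorm z < 1 -> val (disc_of z) = z.
Proof. by rewrite -norm_lt1 /disc_of; case: pselect. Qed.

Definition base_point (p : punctured) : D := disc_of (klein_inv (sphere_klein v (val p))).

Lemma puncturedP (p : punctured) : sphere (val p) /\ ~ cusps v (val p).
Proof. by case: p => p /= /set_mem. Qed.

Lemma klein_base p : klein (val (base_point p)) = sphere_klein v (val p).
Proof.
have [hp hc] := puncturedP p; have [h1 h2] := klein_invK (sphere_klein_lt1 iv hp hc).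
by rewrite /base_point disc_ofE.
Qed.

Lemma base_val p : val (base_point p) = klein_inv (sphere_klein v (val p)).
Proof.
have [hp hc] := puncturedP p; have [h1 h2] := klein_invK (sphere_klein_lt1 iv hp hc).
by rewrite /base_point disc_ofE.
Qed.

Lemma base_P p : P (base_point p).
Proof.
apply/PE => i; rewrite /side_form nform_ge0 ?sqnorm_lt1// klein_base.
by have [hp _] := puncturedP p; exact: sphere_klein_polygon.
Qed.

Lemma base_continuous : continuous base_point.
Proof.
move=> p; apply: continuous_sub.
rewrite (_ : val \o base_point = fun q : punctured => klein_inv (sphere_klein v (val q))); last first.
  by apply/funext => q /=; exact: base_val.
have vc := @val_continuous _ punctured.
have c1 : {for p, continuous (fun q : punctured => (val q).1.1)}.
  exact (@continuous_comp _ _ _ _ _ p (@vc p) (@continuous_comp _ _ _ fst fst (val p) cvg_fst cvg_fst)).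
have c2 : {for p, continuous (fun q : punctured => (val q).1.2)}.
  exact (@continuous_comp _ _ _ _ _ p (@vc p) (@continuous_comp _ _ _ fst snd (val p) cvg_fst cvg_snd)).
have c3 : {for p, continuous (fun q : punctured => (val q).2)}.
  exact (@continuous_comp _ _ _ _ _ p (@vc p) cvg_snd).
have cst (a : R) : {for p, continuous (fun _ : punctured => a)} by exact: cst_continuous.
have cn : {for p, continuous (fun q : punctured => `|(val q).2|)}.
  by apply: (continuous_comp c3); exact: norm_continuous.
have ch : {for p, continuous (fun q : punctured => (height v (val q))^-1)}.
  apply: continuousV; first by rewrite gt_eqF ?(height_gt0 iv)//; have [] := puncturedP p.
  exact (continuousD (@gauge_continuous R n v _ (fun q : punctured => planar (val q)) p c1 c2)
    cn).
have k1 : {for p, continuous (fun q : punctured => complex.Re (sphere_klein v (val q)))}.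
  have -> : (fun q : punctured => complex.Re (sphere_klein v (val q))) =
      (fun q : punctured => complex.Re (center v) + (height v (val q))^-1 * (val q).1.1).
    by apply/funext => q; rewrite /sphere_klein /planar; case: (center v) => a b /=; ring.
  exact (continuousD (cst _) (continuousM ch c1)).
have k2 : {for p, continuous (fun q : punctured => complex.Im (sphere_klein v (val q)))}.
  have -> : (fun q : punctured => complex.Im (sphere_klein v (val q))) =
      (fun q : punctured => complex.Im (center v) + (height v (val q))^-1 * (val q).1.2).
    by apply/funext => q; rewrite /sphere_klein /planar; case: (center v) => a b /=; ring.
  exact (continuousD (cst _) (continuousM ch c2)).
have cs : {for p, continuous (fun q : punctured => (1 + Num.sqrt (1 - sqnorm (sphere_klein v (val q))))^-1)}.
  apply: continuousV; first by rewrite gt_eqF// ltr_pwDl// sqrtr_ge0.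
  exact (continuousD (cst 1) (@continuous_comp _ _ _ (fun q : punctured => 1 - sqnorm (sphere_klein v (val q)))
    Num.sqrt p (continuousB (cst 1) (sqnorm_continuous k1 k2)) (@sqrt_continuous R _))).
apply: continuous_C.
  rewrite (_ : _ \o _ = fun q : punctured =>
    (1 + Num.sqrt (1 - sqnorm (sphere_klein v (val q))))^-1 * complex.Re (sphere_klein v (val q))).
    exact (continuousM cs k1).
  by apply/funext => q; rewrite /= /klein_inv; case: (sphere_klein v (val q)) => a b /=; ring.
rewrite (_ : _ \o _ = fun q : punctured =>
  (1 + Num.sqrt (1 - sqnorm (sphere_klein v (val q))))^-1 * complex.Im (sphere_klein v (val q))).
  exact (continuousM cs k2).
by apply/funext => q; rewrite /= /klein_inv; case: (sphere_klein v (val q)) => a b /=; ring.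
Qed.

Local Notation Q := (orbit_space Gamma).
Local Notation piQ := (\pi_(orbit_space Gamma)%qT : D -> Q).

Lemma orbit_Gamma s z : Gamma s -> orbit_of Gamma (s z) = orbit_of Gamma z.
Proof.
have sG := subgroup_Gamma v.
move=> Gs; apply/seteqP; split=> _ [t Gt <-].
  by exists (t * s)%g => //; exact: (subgroupM sG).
exists (t * s^-1)%g; first by apply: (subgroupM sG) => //; exact: (subgroupV sG).
by rewrite /=; congr (t _); exact: bij_funK.
Qed.

Lemma piQ_Gamma s z : Gamma s -> piQ (s z) = piQ z.
Proof.
by move=> Gs; apply/(eqmodP (same_orbit_equiv Gamma)); apply/asboolP; exact: orbit_Gamma.
Qed.

Lemma piQ_inv y z : piQ y = piQ z -> exists2 s, Gamma s & z = s y.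
Proof.
move=> /(eqmodP (same_orbit_equiv Gamma))/asboolP e.
have : orbit_of Gamma y z.
  by rewrite e; exists 1%g => //; exact: subgroup1 (subgroup_Gamma v).
by case=> s Gs <-; exists s.
Qed.

Definition quotient_to_sphere : Q -> punctured := fold_sphere \o (repr : Q -> D).

Lemma quotient_to_sphere_pi z : quotient_to_sphere (piQ z) = fold_sphere z.
Proof.
have e : piQ (repr (piQ z)) = piQ z by exact: reprK.
have [s Gs zE] := piQ_inv e.
by rewrite [in RHS]zE (fold_sphere_Gamma _ Gs).
Qed.

Lemma quotient_to_sphere_continuous : continuous quotient_to_sphere.
Proof.
apply: repr_comp_continuous; first exact: fold_sphere_continuous.
by move=> y z /eqP /piQ_inv[s Gs ->]; rewrite (fold_sphere_Gamma _ Gs).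
Qed.

Definition sphere_to_quotient (p : punctured) : Q :=
  if 0 <= (val p).2 then piQ (base_point p) else piQ (sg l (base_point p)).

(** A point of side [i] is fixed by [sg i], so its mirror image is its image under [sg l * sg i], an
    element of [Gamma]. This glues the two copies of [P] along their sides. *)
Lemma piQ_side i z : g i z = 0 -> piQ (sg l z) = piQ z.
Proof.
move=> gi; rewrite -{1}(g_eq0 iv gi); apply: (@piQ_Gamma (sg l * sg i)%g).
apply: Gamma_sg_l => //; first exact: H_sg.
exact: not_Gamma_sg.
Qed.

Lemma fold_base p : fold (base_point p) = base_point p.
Proof. exact/fold_P/base_P. Qed.

Lemma fold_offset_base p : fold_offset (base_point p) = (height v (val p))^-1%:C%C * planar (val p).
Proof. by rewrite /fold_offset fold_base klein_base /sphere_klein addrC addKr. Qed.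

Lemma fold_height_base p : fold_height (base_point p) = `|(val p).2| / height v (val p).
Proof.
have [hp _] := puncturedP p; rewrite -(one_sub_gauge_sphere_klein iv hp) /fold_height /fold_offset fold_base klein_base.
by [].
Qed.

Lemma fold_offset_H h z : H h -> fold_offset (h z) = fold_offset z.
Proof. by move=> Hh; rewrite /fold_offset fold_H. Qed.

Lemma fold_height_H h z : H h -> fold_height (h z) = fold_height z.
Proof. by move=> Hh; rewrite /fold_height fold_offset_H. Qed.

Lemma fold_radius_H h z : H h -> fold_radius (h z) = fold_radius z.
Proof. by move=> Hh; rewrite /fold_radius fold_offset_H// fold_height_H. Qed.

Lemma fold_radius_base p : fold_radius (base_point p) = (height v (val p))^-1.
Proof.
have [hp _] := puncturedP p; have h0 := height_gt0 iv hp.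
rewrite /fold_radius fold_offset_base fold_height_base sqnorm_scale exprMn exprVn [_ * sqnorm _]mulrC -mulrDl.
rewrite real_normK ?num_real// (_ : sqnorm _ + _ = 1); last exact: hp.
by rewrite mul1r -exprVn sqrtr_sqr ger0_norm// invr_ge0 ltW.
Qed.

Lemma Phi_of h p : H h -> signed_height (h (base_point p)) = (val p).2 / height v (val p) ->
  Phi (h (base_point p)) = val p.
Proof.
move=> Hh hs; have [hp _] := puncturedP p; have h0 := height_gt0 iv hp.
have hn : height v (val p) != 0 by rewrite gt_eqF.
rewrite /Phi hs fold_offset_H// fold_radius_H// fold_offset_base fold_radius_base invrK mulfVK//.
have e (a b : R) : complex.Re ((height v (val p))^-1%:C%C * (a +i* b)%C) * height v (val p) = a /\
    complex.Im ((height v (val p))^-1%:C%C * (a +i* b)%C) * height v (val p) = b.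
  by split; rewrite /=; field.
have [-> ->] := e (val p).1.1 (val p).1.2.
by case: (val p) => [[? ?] ?].
Qed.

Lemma sphere_to_quotientK : cancel sphere_to_quotient quotient_to_sphere.
Proof.
move=> p; apply: val_inj; rewrite /sphere_to_quotient; have H1 : H 1%g := subgroup1 (subgroup_H v).
have G1 : Gamma 1%g := subgroup1 (subgroup_Gamma v).
have [hp _] := puncturedP p; have h0 := height_gt0 iv hp.
case: (leP 0 (val p).2) => hc; rewrite quotient_to_sphere_pi /=.
  apply: (@Phi_of 1%g) => //.
  have up : upper (base_point p) by apply/asboolP; exists 1%g => //; exact: base_P.
  by rewrite /signed_height /= up fold_height_base ger0_norm.
apply: Phi_of; first exact: H_sg.
have bp : 0 < fold_height (base_point p) by rewrite fold_height_base divr_gt0// normr_gt0 lt_eqF.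
have hz i : 0 < g i (sg l (sg l (base_point p))).
  by rewrite (sgK iv); have := (fold_height_gt0 (base_point p)).1 bp i; rewrite fold_base.
have up : upper (sg l (base_point p)) = false.
  rewrite (upperE (H_sg l) hz); apply/asboolP; exact: not_Gamma_sg.
rewrite /signed_height up fold_height_H ?fold_height_base; last exact: H_sg.
by rewrite ltr0_norm// mulNr opprK.
Qed.

Lemma quotient_to_sphereK : cancel quotient_to_sphere sphere_to_quotient.
Proof.
move=> q; rewrite -[q]reprK; move: (repr q) => z; rewrite -/(piQ z) quotient_to_sphere_pi.
have bz : base_point (fold_sphere z) = fold z.
  by apply: val_inj; rewrite base_val /= sphere_klein_Phi kleinK// sqnorm_lt1.
rewrite /sphere_to_quotient bz /=; have [Hh Ph] := folderP z.
have r0 := fold_radius_gt0 z.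
have sE : (0 <= signed_height z / fold_radius z) = (0 <= signed_height z) by rewrite pmulr_lge0// invr_gt0.
rewrite sE; have [Gh|nG] := pselect (Gamma (folder z)).
  have up : upper z by apply/asboolP; exists (folder z).
  by rewrite /signed_height up fold_height_ge0 /fold piQ_Gamma.
have Gs : Gamma (sg l * folder z)%g by exact: Gamma_sg_l.
have e2 : piQ (sg l (fold z)) = piQ z by exact: (piQ_Gamma z Gs).
(* Here the chosen element reverses orientation although the signed height is nonnegative. That
   happens only over a side, where the two branches give the same class. *)
case: ifP => // s0; rewrite -[RHS]e2.
have b0 : fold_height z = 0.
  apply/eqP; rewrite eq_le fold_height_ge0 andbT leNgt; apply/negP => bp.
  have := upperE Hh ((fold_height_gt0 z).1 bp); rewrite asboolF// => up.
  by move: s0; rewrite /signed_height up oppr_ge0 leNgt bp.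
have [i gi] := fold_height_eq0 b0.
by rewrite (piQ_side gi).
Qed.

Lemma sphere_to_quotient_continuous : continuous sphere_to_quotient.
Proof.
apply: (@continuous_glue R punctured Q (fun p => (val p).2) (piQ \o base_point) (piQ \o sg l \o base_point)).
- move=> p; exact (@continuous_comp _ _ _ _ _ p (@val_continuous _ punctured p) cvg_snd).
- move=> p; exact (@continuous_comp _ _ _ base_point _ p (@base_continuous p) (@pi_continuous _ _ _)).
- move=> p; exact (@continuous_comp _ _ _ base_point _ p (@base_continuous p)
    (@continuous_comp _ _ _ (sg l) _ _ (@H_continuous _ (H_sg l) _) (@pi_continuous _ _ _))).
move=> p c0 /=; have b0 : fold_height (base_point p) = 0 by rewrite fold_height_base c0 normr0 mul0r.
by have [i +] := fold_height_eq0 b0; rewrite fold_base => gi; rewrite (piQ_side gi).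
Qed.

Lemma punctured_sphere : is_punctured_sphere R Q.
Proof.
exists (cusps v); split.
- by apply: finite_image; exact: finite_finset.
- by exists (cusp v l); exists l.
- by move=> _ [i _ <-]; exact: cusp_sphere.
exists quotient_to_sphere, sphere_to_quotient; split; [exact: quotient_to_sphereK|exact: sphere_to_quotientK|exact: quotient_to_sphere_continuous|exact: sphere_to_quotient_continuous].
Qed.

End Quotient.

Unset Implicit Arguments.

Theorem lemmaA1 (R : realType) (n : nat) (v : 'I_n -> R[i]) (l : 'I_n) :
  ideal_vertices v ->
  is_diameter (side v l) ->
  let P := ideal_polygon v in
  let H := generated [set side_reflection v i | i in [set: 'I_n]] in
  let Gamma := H `&` orientation_preserving in
  let Omega := P `|` side_reflection v l @` P in
  [/\ index_two Gamma H,
      is_free Gamma,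
      nonuniform_lattice Gamma,
      is_ideal_polygon Omega /\ is_ford_domain Gamma Omega
    & is_punctured_sphere R (orbit_space Gamma)].
Proof.
move=> iv diam P H Gamma Omega.
have OmegaE : Omega = ideal_polygon (double_vertex v l) := Omega_polygon iv diam.
split.
- exact: (index_two_Gamma l iv).
- by exists (@rotation_basis R n v l); exact: (free_basis_Gamma iv diam).
- split.
  + exact: (fuchsian_Gamma iv diam).
  + exists Omega; first exact: (fundamental_Omega iv diam).
    rewrite OmegaE; apply: area_finite.
    exact: (ideal_vertices_double iv diam).
  + by move=> A; exact: (not_compact iv diam).
- split; last exact: (ford_Omega iv diam).
  exists n.-1.*2, (double_vertex v l); split; last exact: OmegaE.
  exact: (ideal_vertices_double iv diam).
- exact: (punctured_sphere iv diam).
Qed.
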